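(* Let $R(\cdot)$ be a free Schur contraction, i.e. an analytic function $R(z)\in\mathcal L(\ker\bar\omega,\ker\bar\omega^* )$ with $\|R(z)\|\le1$ $(z\in\mathbb D)$; let $W(z)=\bar\omega+R(z)(I-\bar\omega^*\bar\omega)$, $A(z)=\Pi W(z)$, $\Gamma(z)=\Pi'W(z)(I-zA(z))^{-1}$, and, for $d\in\mathcal D_X$, $d(z)=(I-zA(z))^{-1}d$ $(z\in\mathbb D)$. Then $\Gamma(\cdot)\in\mathcal L(\mathcal D_X,H^2(\mathcal D_{T'}))$, $d\mapsto\Gamma(\cdot)d$, is an isometry if and only if the following two conditions are satisfied: (1) for each $d\in\mathcal D_X$, $$\int_0^{2\pi}h_d(e^{i\theta})\frac{d\theta}{2\pi}=\|d\|^2,\qquad\text{where } h_d(e^{i\theta})=\lim_{\rho\nearrow1}\|D_{zA(z)}d(z)\|^2\big|_{z=\rho e^{i\theta}}\ \text{a.e.};$$ (2) for each $d\in\mathcal D_X$, $$\lim_{\rho\nearrow1}\Big[(1-|z|^2)\|d(z)\|^2+\|D_{R(z)}(I-\bar\omega^*\bar\omega)d(z)\|^2\Big]\Big|_{z=\rho e^{i\theta}}=0\quad\text{for a.e. }\theta.$$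
   Context: All Hilbert spaces are complex and separable; $\mathbb D$ is the open unit disc. For a contraction $C$, $D_C=(I-C^*C)^{1/2}$ and $\mathcal D_C$ is the closure of the range of $D_C$. $H^2(\mathcal E)$ is the Hardy space of $\mathcal E$-valued functions on $\mathbb D$. Setting: $T'\in\mathcal L(\mathcal H')$ is a completely nonunitary contraction, $T\in\mathcal L(\mathcal H)$ is an isometry, $X\in\mathcal L(\mathcal H,\mathcal H')$ satisfies $T'X=XT$, $\|X\|\le1$. The isometry $\omega:(D_XT\mathcal H)^-\to\{D_{T'}Xh\oplus D_Xh:h\in\mathcal H\}^-\subset\mathcal D_{T'}\oplus\mathcal D_X$ is the continuous extension of $D_XTh\mapsto D_{T'}Xh\oplus D_Xh$. The partial isometry $\bar\omega\in\mathcal L(\mathcal D_X,\mathcal D_{T'}\oplus\mathcal D_X)$ equals $\omega$ on $(D_XT\mathcal H)^-$ and $0$ on $\mathcal D_X\ominus(D_XT\mathcal H)^-$. The operators $\Pi',\Pi$ on $\mathcal D_{T'}\oplus\mathcal D_X$ are $\Pi'(d'\oplus d)=d'\in\mathcal D_{T'}$, $\Pi(d'\oplus d)=d\in\mathcal D_X$. The function $z\mapsto\|D_{zA(z)}d(z)\|^2=\mathrm{Re}\,((I+zA(z))(I-zA(z))^{-1}d,d)$ is nonnegative and harmonic in $\mathbb D$, so its radial limit $h_d(e^{i\theta})$ exists a.e. The map $d\mapsto\Gamma(\cdot)d$ is always a contraction from $\mathcal D_X$ into $H^2(\mathcal D_{T'})$. *)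

(* Defs.v *)
From HB Require Import structures.
From mathcomp Require Import all_boot all_order all_algebra.
From mathcomp Require Import all_classical all_reals all_analysis.
From mathcomp Require Import complex ring.
Set Implicit Arguments. Unset Strict Implicit. Unset Printing Implicit Defensive.
Import Order.TTheory GRing.Theory Num.Theory.
Import numFieldNormedType.Exports.
Local Open Scope classical_set_scope.
Local Open Scope ring_scope.
Local Open Scope complex_scope.

HB.mixin Record isHilbert (R : realType) V & CompleteNormedModule R[i] V := {
  hdot : {dot V for (@Num.conj R[i])};
  hdot_norm : forall x : V, hdot x x = `|x| ^+ 2 }.

#[short(type="hilbertType")]
HB.structure Definition Hilbert (R : realType) :=
  {V of CompleteNormedModule R[i] V & isHilbert R V}.

Section HilbertTheory.
Variables (R : realType) (V : hilbertType R).
Implicit Types x y z : V.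

Lemma hdotC x y : hdot x y = Num.conj (hdot y x).
Proof. by rewrite [LHS](@hermitian_subproof _ _ _ _ hdot) expr0 mul1r. Qed.
Lemma hdotP (a : R[i]) x y z : hdot (a *: x + y) z = a * hdot x z + hdot y z.
Proof. exact: linearPl. Qed.

End HilbertTheory.

Record csubspace (R : realType) (V : hilbertType R) := CSubspace {
  cs_set :> set V;
  cs_closed : closed cs_set;
  cs_zero : cs_set 0;
  cs_linear : forall (a : R[i]) u v,
    cs_set u -> cs_set v -> cs_set (a *: u + v) }.

Section Csub.
Variables (R : realType) (V : hilbertType R) (S : csubspace V).

Definition cs_pred : {pred V} := fun x => `[< cs_set S x >].

Lemma cs_pred_submod : submod_closed cs_pred.
Proof.
split; first by apply/asboolP; exact: cs_zero.
by move=> a u v /asboolP Su /asboolP Sv; apply/asboolP; exact: cs_linear.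
Qed.

HB.instance Definition _ := GRing.isSubmodClosed.Build R[i] V cs_pred cs_pred_submod.

Definition csub : Type := {x : V | cs_pred x}.
HB.instance Definition _ := SubType.copy csub {x : V | cs_pred x}.
HB.instance Definition _ := [Choice of csub by <:].
HB.instance Definition _ := [SubChoice_isSubLmodule of csub by <:].

Definition csub_norm (x : csub) : R[i] := `|val x|.
Lemma csub_normD x y : csub_norm (x + y) <= csub_norm x + csub_norm y.
Proof. exact: ler_normD. Qed.
Lemma csub_normZ (a : R[i]) x : csub_norm (a *: x) = `|a| * csub_norm x.
Proof. exact: normrZ. Qed.
Lemma csub_norm0 x : csub_norm x = 0 -> x = 0.
Proof. by move/normr0_eq0 => x0; apply: val_inj. Qed.
HB.instance Definition _ :=
  Lmodule_isNormed.Build R[i] csub csub_normD csub_normZ csub_norm0.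

Lemma csub_normE (x : csub) : `|x| = `|val x|.
Proof. by []. Qed.

Lemma csub_complete (F : set_system csub) : ProperFilter F -> cauchy F -> cvg F.
Proof.
move=> FF Fc; pose G := (val : csub -> V) @ F.
have FG : ProperFilter G by exact: fmap_proper_filter.
have FF0 : Filter F := @filter_filter _ _ FF.
have Fb := proj2 (@cauchy_ballP _ _ F FF0) Fc.
have Gc : cauchy G.
  apply: (proj1 (cauchy_ballP _)) => //. move=> e e0; rewrite /G near_map2.
  apply: (@filterS _ _ (filter_prod_filter FF0 FF0) _ _ _ (Fb e e0)) => -[x y].
  by rewrite -!ball_normE.
have /cvg_ex[/= l Gl] := @cauchy_cvg V G FG Gc.
have Sl : cs_pred l.
  apply/asboolP; apply: (closed_cvg (cs_set S) (@cs_closed _ _ S) _ _ Gl).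
  by near=> x; apply/asboolP; exact: (valP x).
apply/cvg_ex; exists (Sub l Sl).
apply/cvgrPdist_lt => e e0.
by move/cvgrPdist_lt : Gl => /(_ e e0).
Unshelve. all: by end_near. Qed.
HB.instance Definition _ := Uniform_isComplete.Build csub csub_complete.

Definition csub_dot (x y : csub) : R[i] := hdot (val x) (val y).
Lemma csub_dot_norm0 x : csub_dot x x = `|x| ^+ 2.
Proof. exact: hdot_norm. Qed.
Lemma csub_dot_bilinear : bilinear_for
  (GRing.Scale.Law.clone _ _ *%R _) (GRing.Scale.Law.clone _ _ (@Num.conj R[i] \; *%R) _) csub_dot.
Proof.
split => [u'|u] a x y; rewrite /csub_dot.
  exact: hdotP.
rewrite [LHS]hdotC [val (_ + _)]/= hdotP.
by rewrite rmorphD rmorphM /= -!hdotC.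
Qed.
HB.instance Definition _ := bilinear_isBilinear.Build R[i] csub csub _ _ _ csub_dot csub_dot_bilinear.
Lemma csub_dot_herm x y : csub_dot x y = (-1) ^+ false * Num.conj (csub_dot y x).
Proof. by rewrite expr0 mul1r; exact: hdotC. Qed.
HB.instance Definition _ := isHermitianSesquilinear.Build R[i] csub false (@Num.conj R[i]) csub_dot csub_dot_herm.
Lemma csub_dot_gt0 x : x != 0 -> 0 < csub_dot x x.
Proof. by move=> x0; rewrite /csub_dot hdot_norm exprn_gt0// normr_gt0. Qed.
HB.instance Definition _ := isDotProduct.Build R[i] csub csub_dot csub_dot_gt0.
HB.instance Definition _ := isHilbert.Build R csub csub_dot_norm0.
End Csub.

Section Hsum.
Variables (R : realType) (U V : hilbertType R).

(* An alias, because the product type itself carries the maximum norm. *)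
Definition hsum : Type := (U * V)%type.
HB.instance Definition _ := GRing.Lmodule.copy hsum (U * V)%type.

Definition hsum_norm (x : hsum) : R[i] := sqrtC (`|x.1| ^+ 2 + `|x.2| ^+ 2).

Lemma hsum_normD x y : hsum_norm (x + y) <= hsum_norm x + hsum_norm y.
Proof.
rewrite /hsum_norm; set a := `|x.1|; set b := `|x.2|; set c := `|y.1|; set d := `|y.2|.
have [a0 b0 c0 d0] : [/\ 0 <= a, 0 <= b, 0 <= c & 0 <= d] by rewrite !normr_ge0.
set s := sqrtC (a ^+ 2 + b ^+ 2); set t := sqrtC (c ^+ 2 + d ^+ 2).
have s0 : 0 <= s by rewrite sqrtC_ge0 addr_ge0// exprn_ge0.
have t0 : 0 <= t by rewrite sqrtC_ge0 addr_ge0// exprn_ge0.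
have sE : s ^+ 2 = a ^+ 2 + b ^+ 2 by rewrite sqrtCK.
have tE : t ^+ 2 = c ^+ 2 + d ^+ 2 by rewrite sqrtCK.
have st : a * c + b * d <= s * t.
  rewrite -(@ler_pXn2r _ 2) ?nnegrE ?addr_ge0 ?mulr_ge0//.
  rewrite exprMn sE tE -subr_ge0.
  have -> : (a ^+ 2 + b ^+ 2) * (c ^+ 2 + d ^+ 2) - (a * c + b * d) ^+ 2
    = (a * d - b * c) ^+ 2 by ring.
  by rewrite real_exprn_even_ge0// realB ?realM// ger0_real.
rewrite -(@ler_pXn2r _ 2) ?nnegrE ?sqrtC_ge0 ?addr_ge0 ?exprn_ge0// sqrtCK.
rewrite sqrrD sE tE.
apply: (@le_trans _ _ ((a + c) ^+ 2 + (b + d) ^+ 2)).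
  by rewrite lerD// ler_pXn2r ?nnegrE ?addr_ge0 ?normr_ge0// ler_normD.
have -> : (a + c) ^+ 2 + (b + d) ^+ 2 =
    (a ^+ 2 + b ^+ 2) + (a * c + b * d) *+ 2 + (c ^+ 2 + d ^+ 2) by ring.
by rewrite lerD2r lerD2l lerMn2r st.
Qed.

Lemma hsum_normZ (a : R[i]) x : hsum_norm (a *: x) = `|a| * hsum_norm x.
Proof.
rewrite /hsum_norm /= !normrZ !exprMn -mulrDr sqrtCM ?nnegrE ?addr_ge0 ?exprn_ge0//.
by rewrite sqrCK.
Qed.

Lemma hsum_norm0 x : hsum_norm x = 0 -> x = 0.
Proof.
move/eqP; rewrite sqrtC_eq0 paddr_eq0 ?exprn_ge0// !expf_eq0/= !normr_eq0.
by case: x => x1 x2 /= /andP[/eqP -> /eqP ->].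
Qed.

HB.instance Definition _ :=
  Lmodule_isNormed.Build R[i] hsum hsum_normD hsum_normZ hsum_norm0.

Lemma hsum_normE (x : hsum) : `|x| = sqrtC (`|x.1| ^+ 2 + `|x.2| ^+ 2).
Proof. by []. Qed.

Lemma hsum_norm_fst (x : hsum) : `|x.1| <= `|x|.
Proof.
rewrite hsum_normE -(@ler_pXn2r _ 2) ?nnegrE ?sqrtC_ge0 ?addr_ge0 ?exprn_ge0//.
by rewrite sqrtCK lerDl exprn_ge0.
Qed.

Lemma hsum_norm_snd (x : hsum) : `|x.2| <= `|x|.
Proof.
rewrite hsum_normE -(@ler_pXn2r _ 2) ?nnegrE ?sqrtC_ge0 ?addr_ge0 ?exprn_ge0//.
by rewrite sqrtCK lerDr exprn_ge0.
Qed.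

Lemma hsum_norm_le (x : hsum) : `|x| <= `|x.1| + `|x.2|.
Proof.
rewrite hsum_normE -(@ler_pXn2r _ 2) ?nnegrE ?sqrtC_ge0 ?addr_ge0 ?exprn_ge0//.
rewrite sqrtCK sqrrD [leRHS]addrAC lerDl mulrn_wge0// mulr_ge0//.
Qed.

Lemma hsum_complete (F : set_system hsum) : ProperFilter F -> cauchy F -> cvg F.
Proof.
move=> FF Fc; pose G1 := (fst : hsum -> U) @ F; pose G2 := (snd : hsum -> V) @ F.
have FG1 : ProperFilter G1 by exact: fmap_proper_filter.
have FG2 : ProperFilter G2 by exact: fmap_proper_filter.
have FF0 : Filter F := @filter_filter _ _ FF.
have Fb := proj2 (@cauchy_ballP _ _ F FF0) Fc.
have G1c : cauchy G1.
  apply: (proj1 (cauchy_ballP _)) => //. move=> e e0; rewrite /G1 near_map2.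
  apply: (@filterS _ _ (filter_prod_filter FF0 FF0) _ _ _ (Fb e e0)) => -[x y]; rewrite -!ball_normE /= => xy.
  exact: le_lt_trans (hsum_norm_fst (x - y)) xy.
have G2c : cauchy G2.
  apply: (proj1 (cauchy_ballP _)) => //. move=> e e0; rewrite /G2 near_map2.
  apply: (@filterS _ _ (filter_prod_filter FF0 FF0) _ _ _ (Fb e e0)) => -[x y]; rewrite -!ball_normE /= => xy.
  exact: le_lt_trans (hsum_norm_snd (x - y)) xy.
have /cvg_ex[/= l1 Gl1] := @cauchy_cvg U G1 FG1 G1c.
have /cvg_ex[/= l2 Gl2] := @cauchy_cvg V G2 FG2 G2c.
apply/cvg_ex; exists ((l1, l2) : hsum).
apply/cvgrPdist_lt => e e0.
have e20 : 0 < e / 2 by rewrite divr_gt0.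
move/cvgrPdist_lt : Gl1 => /(_ _ e20) H1.
move/cvgrPdist_lt : Gl2 => /(_ _ e20) H2.
near=> x; apply: le_lt_trans (hsum_norm_le _) _.
rewrite [e]splitr ltrD//=; near: x; [exact: H1|exact: H2].
Unshelve. all: by end_near. Qed.

HB.instance Definition _ := Uniform_isComplete.Build hsum hsum_complete.

Definition hsum_dot (x y : hsum) : R[i] := hdot x.1 y.1 + hdot x.2 y.2.

Lemma hsum_dot_bilinear : bilinear_for
  (GRing.Scale.Law.clone _ _ *%R _)
  (GRing.Scale.Law.clone _ _ (@Num.conj R[i] \; *%R) _) hsum_dot.
Proof.
have hdotPr (W : hilbertType R) (a : R[i]) (x y z : W) :
    hdot z (a *: x + y) = Num.conj a * hdot z x + hdot z y.
  by rewrite hdotC hdotP rmorphD rmorphM /= -!hdotC.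
split => [u'|u] a x y; rewrite /hsum_dot /=.
  by rewrite !hdotP mulrDr addrACA.
by rewrite !hdotPr mulrDr addrACA.
Qed.
HB.instance Definition _ :=
  bilinear_isBilinear.Build R[i] hsum hsum _ _ _ hsum_dot hsum_dot_bilinear.

Lemma hsum_dot_herm x y : hsum_dot x y = (-1) ^+ false * Num.conj (hsum_dot y x).
Proof. by rewrite expr0 mul1r /hsum_dot rmorphD /= -!hdotC. Qed.
HB.instance Definition _ := isHermitianSesquilinear.Build R[i] hsum false
  (@Num.conj R[i]) hsum_dot hsum_dot_herm.

Lemma hsum_dot_normE x : hsum_dot x x = `|x| ^+ 2.
Proof. by rewrite hsum_normE sqrtCK /hsum_dot !hdot_norm. Qed.

Lemma hsum_dot_gt0 x : x != 0 -> 0 < hsum_dot x x.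
Proof. by move=> x0; rewrite hsum_dot_normE exprn_gt0// normr_gt0. Qed.
HB.instance Definition _ := isDotProduct.Build R[i] hsum hsum_dot hsum_dot_gt0.

HB.instance Definition _ := isHilbert.Build R hsum hsum_dot_normE.
End Hsum.

(* The norm takes values in R[i], as for every normed module over R[i];
   [rnorm] is the same number in R. *)
Definition rnorm (R : realType) (V : hilbertType R) (x : V) : R :=
  complex.Re `|x|.

Definition separable (R : realType) (V : hilbertType R) : Prop :=
  exists2 D : set V, countable D & dense D.

Record bop (R : realType) (U V : hilbertType R) := Bop {
  bop_fun :> U -> V;
  bop_linear : linear bop_fun;
  bop_continuous : continuous bop_fun }.

HB.instance Definition _ (R : realType) (U V : hilbertType R) (A : bop U V) :=
  GRing.isLinear.Build R[i] U V *:%R (bop_fun A) (bop_linear A).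

Section BopLmodule.
Variables (R : realType) (U V : hilbertType R).
Implicit Types (A B C : bop U V) (a b : R[i]).

Lemma bopP A B : (forall x, A x = B x) -> A = B.
Proof.
case: A B => [f fl fc] [g gl gc] /= fg.
have fgE : f = g by apply/funext.
by subst g; congr Bop; exact: Prop_irrelevance.
Qed.

HB.instance Definition _ := gen_eqMixin (bop U V).
HB.instance Definition _ := gen_choiceMixin (bop U V).

Lemma bop_zero_linear : linear (fun _ : U => 0 : V).
Proof. by move=> a x y; rewrite scaler0 addr0. Qed.
Lemma bop_zero_continuous : continuous (fun _ : U => 0 : V).
Proof. by move=> x; exact: cvg_cst. Qed.
Definition bop_zero : bop U V := Bop bop_zero_linear bop_zero_continuous.

Lemma bop_add_linear A B : linear (fun x => A x + B x).
Proof. by move=> a x y; rewrite !linearP scalerDr addrACA. Qed.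
Lemma bop_add_continuous A B : continuous (fun x => A x + B x).
Proof. by move=> x; apply: cvgD; exact: bop_continuous. Qed.
Definition bop_add A B : bop U V :=
  Bop (@bop_add_linear A B) (@bop_add_continuous A B).

Lemma bop_opp_linear A : linear (fun x => - A x).
Proof. by move=> a x y; rewrite linearP opprD scalerN. Qed.
Lemma bop_opp_continuous A : continuous (fun x => - A x).
Proof. by move=> x; apply: cvgN; exact: bop_continuous. Qed.
Definition bop_opp A : bop U V :=
  Bop (@bop_opp_linear A) (@bop_opp_continuous A).

Lemma bop_scale_linear a A : linear (fun x => a *: A x).
Proof.
by move=> b x y; rewrite linearP scalerDr !scalerA mulrC.
Qed.
Lemma bop_scale_continuous a A : continuous (fun x => a *: A x).
Proof. by move=> x; apply: cvgZl_tmp; exact: bop_continuous. Qed.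
Definition bop_scale a A : bop U V :=
  Bop (@bop_scale_linear a A) (@bop_scale_continuous a A).

Lemma bop_addA : associative bop_add.
Proof. by move=> A B C; apply: bopP => x /=; rewrite addrA. Qed.
Lemma bop_addC : commutative bop_add.
Proof. by move=> A B; apply: bopP => x /=; rewrite addrC. Qed.
Lemma bop_add0 : left_id bop_zero bop_add.
Proof. by move=> A; apply: bopP => x /=; rewrite add0r. Qed.
Lemma bop_addN : left_inverse bop_zero bop_opp bop_add.
Proof. by move=> A; apply: bopP => x /=; rewrite addNr. Qed.
HB.instance Definition _ :=
  GRing.isZmodule.Build (bop U V) bop_addA bop_addC bop_add0 bop_addN.

Lemma bop_scaleA a b A : bop_scale a (bop_scale b A) = bop_scale (a * b) A.
Proof. by apply: bopP => x /=; rewrite scalerA. Qed.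
Lemma bop_scale1 : left_id 1 bop_scale.
Proof. by move=> A; apply: bopP => x /=; rewrite scale1r. Qed.
Lemma bop_scaleDr : right_distributive bop_scale +%R.
Proof. by move=> a A B; apply: bopP => x /=; rewrite scalerDr. Qed.
Lemma bop_scaleDl A : {morph bop_scale^~ A : a b / a + b}.
Proof. by move=> a b; apply: bopP => x /=; rewrite scalerDl. Qed.
HB.instance Definition _ := GRing.Zmodule_isLmodule.Build R[i] (bop U V)
  bop_scaleA bop_scale1 bop_scaleDr bop_scaleDl.

End BopLmodule.

Section BopCategory.
Variable R : realType.
Implicit Types U V W : hilbertType R.

Lemma bid_linear U : linear (fun x : U => x).
Proof. by []. Qed.
Lemma bid_continuous U : continuous (fun x : U => x).
Proof. by move=> x; exact: cvg_id. Qed.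
Definition bid U : bop U U := Bop (@bid_linear U) (@bid_continuous U).

Lemma bcomp_linear U V W (A : bop V W) (B : bop U V) :
  linear (fun x => A (B x)).
Proof. by move=> a x y; rewrite !linearP. Qed.
Lemma bcomp_continuous U V W (A : bop V W) (B : bop U V) :
  continuous (fun x => A (B x)).
Proof. by move=> x; apply: continuous_comp; exact: bop_continuous. Qed.
Definition bcomp U V W (A : bop V W) (B : bop U V) : bop U W :=
  Bop (@bcomp_linear U V W A B) (@bcomp_continuous U V W A B).

Lemma lip1_continuous U V (f : U -> V) : linear f ->
  (forall x, `|f x| <= `|x|) -> continuous f.
Proof.
move=> fl fle x; apply/cvgrPdist_lt => e e0.
have fB u v : f u - f v = f (u - v).
  have -> : u - v = -1 *: v + u by rewrite scaleN1r addrC.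
  by rewrite fl scaleN1r addrC.
near=> y; rewrite fB; apply: le_lt_trans (fle _) _.
near: y; exact: cvgr_dist_lt.
Unshelve. all: by end_near. Qed.

Lemma hfst_linear U V : linear (fun x : hsum U V => x.1).
Proof. by []. Qed.
Definition hfst U V : bop (hsum U V) U :=
  Bop (@hfst_linear U V)
    (lip1_continuous (@hfst_linear U V) (@hsum_norm_fst R U V)).

Lemma hsnd_linear U V : linear (fun x : hsum U V => x.2).
Proof. by []. Qed.
Definition hsnd U V : bop (hsum U V) V :=
  Bop (@hsnd_linear U V)
    (lip1_continuous (@hsnd_linear U V) (@hsum_norm_snd R U V)).

Lemma cs_val_linear U (S : csubspace U) : linear (val : csub S -> U).
Proof. by []. Qed.
Lemma cs_val_le U (S : csubspace U) (x : csub S) : `|val x| <= `|x|.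
Proof. by []. Qed.
Definition cs_incl U (S : csubspace U) : bop (csub S) U :=
  Bop (@cs_val_linear U S) (lip1_continuous (@cs_val_linear U S) (@cs_val_le U S)).

(* The operator [A] regarded as an operator into the closed subspace [S];
   meaningful when the range of [A] lies in [S], and 0 otherwise. *)
Definition bcorestr U V (S : csubspace V) (A : bop U V) : bop U (csub S) :=
  xget 0 [set B : bop U (csub S) | forall x, val (B x) = A x].

Lemma bker_closed U V (A : bop U V) : closed [set x | A x = 0].
Proof.
apply: (@preimage_closed _ _ A [set 0]) => [x _|]; first exact: bop_continuous.
exact/accessible_closed_set1/hausdorff_accessible/norm_hausdorff.
Qed.
Lemma bker0 U V (A : bop U V) : [set x | A x = 0] 0.
Proof. exact: linear0. Qed.
Lemma bkerP U V (A : bop U V) (a : R[i]) u v :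
  [set x | A x = 0] u -> [set x | A x = 0] v -> [set x | A x = 0] (a *: u + v).
Proof. by move=> /= u0 v0; rewrite bop_linear u0 v0 scaler0 addr0. Qed.
Definition bker U V (A : bop U V) : csubspace U :=
  CSubspace (@bker_closed U V A) (@bker0 U V A) (@bkerP U V A).

Lemma brange_closed U V (A : bop U V) : closed (closure (range A)).
Proof. exact: closed_closure. Qed.
Lemma brange0 U V (A : bop U V) : closure (range A) 0.
Proof. by apply: subset_closure; exists 0 => //; exact: linear0. Qed.
Lemma brangeP U V (A : bop U V) (a : R[i]) u v :
  closure (range A) u -> closure (range A) v ->
  closure (range A) (a *: u + v).
Proof.
move=> Au Av B.
have f_cont : (fun p : V * V => a *: p.1 + p.2) @ nbhs (u, v) --> a *: u + v.
  apply: cvgD; last exact: cvg_snd.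
  by apply: cvgZl_tmp; exact: cvg_fst.
move=> /f_cont [[B1 B2]] /= [B1u B2v] B12.
have [_ [[x _ <-] B1x]] := Au _ B1u.
have [_ [[y _ <-] B2y]] := Av _ B2v.
exists (A (a *: x + y)); split; first by exists (a *: x + y).
by rewrite linearP; exact: (B12 (A x, A y)).
Qed.
Definition brange U V (A : bop U V) : csubspace V :=
  CSubspace (@brange_closed U V A) (@brange0 U V A) (@brangeP U V A).

End BopCategory.

Notation "A \ob B" := (bcomp A B) (at level 40, left associativity).
Arguments bid {R U}.
Arguments hfst {R U V}.
Arguments hsnd {R U V}.

Section Operators.
Variable R : realType.
Implicit Types U V W : hilbertType R.

Definition contractive U V (A : bop U V) := forall x, `|A x| <= `|x|.

Definition isometric U V (A : bop U V) := forall x, `|A x| = `|x|.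

(* [adj], [bsqrt], [binv] select the operator with the displayed property,
   which is unique when it exists, and are 0 otherwise. *)
Definition adj U V (A : bop U V) : bop V U :=
  xget 0 [set B : bop V U | forall x y, hdot (A x) y = hdot x (B y)].

(* In R[i], [0 <= a] says that [a] is real and nonnegative. *)
Definition bop_ge0 U (A : bop U U) := forall x, 0 <= hdot (A x) x.

Definition bsqrt U (A : bop U U) : bop U U :=
  xget 0 [set B : bop U U | bop_ge0 B /\ B \ob B = A].

Definition binv U (A : bop U U) : bop U U :=
  xget 0 [set B : bop U U | B \ob A = bid /\ A \ob B = bid].

Definition defect U V (C : bop U V) : bop U U := bsqrt (bid - adj C \ob C).

Definition defect_space U V (C : bop U V) : csubspace U := brange (defect C).

Definition defectr U V (C : bop U V) : bop U (csub (defect_space C)) :=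
  bcorestr (defect_space C) (defect C).

(* No nonzero closed subspace reduces [A] to a unitary operator. *)
Definition completely_nonunitary U (A : bop U U) :=
  forall M : csubspace U,
    (forall x, cs_set M x -> cs_set M (A x) /\ cs_set M (adj A x)) ->
    (forall x, cs_set M x -> `|A x| = `|x|) ->
    (forall y, cs_set M y -> exists2 x, cs_set M x & A x = y) ->
    forall x, cs_set M x -> x = 0.

(* Analyticity in the unit disc, as expansion in a power series with operator
   coefficients; for power series, convergence in the strong and in the norm
   sense on the disc are the same. *)
Definition op_analytic U V (F : R[i] -> bop U V) :=
  exists Th : nat -> bop U V, forall z : R[i], `|z| < 1 ->
    forall u, [series z ^+ n *: Th n u]_n @ \oo --> F z u.

Definition schur_contraction U V (F : R[i] -> bop U V) :=
  op_analytic F /\ forall z : R[i], `|z| < 1 -> contractive (F z).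

Definition is_taylor U (f : R[i] -> U) (a : nat -> U) :=
  forall z : R[i], `|z| < 1 -> [series z ^+ n *: a n]_n @ \oo --> f z.

Definition sqsum U (a : nat -> U) : \bar R :=
  (\sum_(0 <= n <oo) (rnorm (a n) ^+ 2)%:E)%E.

(* The Hardy space H^2(U), whose norm is the l^2 norm of the (unique) sequence
   of Taylor coefficients. *)
Definition hardy2 U : set (R[i] -> U) :=
  [set f | exists2 a, is_taylor f a & (sqsum a < +oo)%E].

Definition hardy2_norm U (f : R[i] -> U) : R :=
  Num.sqrt (fine (sqsum (xget (fun=> 0) [set a | is_taylor f a]))).

Definition expi (t : R) : R[i] := Complex (cos t) (sin t).

End Operators.

Section Lifting.
Variables (R : realType) (H' H : hilbertType R).
Variables (T' : bop H' H') (T : bop H H) (X : bop H H').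

Notation DT' := (csub (defect_space T')).
Notation DX := (csub (defect_space X)).

(* [omega_bar] is the bounded operator that maps D_X T h to D_T' X h + D_X h
   (hence, by continuity, equals omega on the closure of D_X T H), and
   vanishes on the orthogonal complement of D_X T H in the defect space. *)
Definition omega_bar : bop DX (hsum DT' DX) :=
  xget 0 [set W : bop DX (hsum DT' DX) |
    (forall h, W (defectr X (T h)) = (defectr T' (X h), defectr X h)) /\
    (forall d, (forall h, hdot d (defectr X (T h)) = 0) -> W d = 0)].

Notation om := omega_bar.
Notation K := (bker om).
Notation K' := (bker (adj om)).

(* I - omega_bar^* omega_bar, with codomain the kernel of omega_bar. *)
Definition ker_proj : bop DX (csub K) := bcorestr K (bid - adj om \ob om).

Variable Rz : R[i] -> bop (csub K) (csub K').
Implicit Type z : R[i].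

Definition Wfun z : bop DX (hsum DT' DX) :=
  om + cs_incl K' \ob Rz z \ob ker_proj.

Definition Afun z : bop DX DX := hsnd \ob Wfun z.

Definition resolvent z : bop DX DX := binv (bid - z *: Afun z).

Definition Gamma z : bop DX DT' := hfst \ob Wfun z \ob resolvent z.

(* The radial limit at e^(it) of |D_(zA(z)) d(z)|^2, where
   d(z) = resolvent z d. *)
Definition hd (d : DX) (t : R) : R :=
  lim ((let z := rho%:C%C * expi t in
        rnorm (defect (z *: Afun z) (resolvent z d)) ^+ 2)
       @[rho --> (1 : R)^'-]).

End Lifting.

(* Main.v *)
Require Import Defs.
From mathcomp Require Import all_boot all_order all_algebra.
From mathcomp Require Import all_classical all_reals all_analysis.
From mathcomp Require Import complex measurable_realfun ring lra.
Set Implicit Arguments.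
Unset Strict Implicit.
Unset Printing Implicit Defensive.
Import Order.TTheory GRing.Theory Num.Theory.
Import numFieldNormedType.Exports.
Local Open Scope classical_set_scope.
Local Open Scope ring_scope.
Local Open Scope complex_scope.

(* Write u(z) = (I - z A(z))^-1 d and p(z) = |D_(zA(z)) u(z)|^2. Since
   z A u = u - d, p(z) = |u|^2 - |u - d|^2 = 2 Re (u, d) - |d|^2, the real part
   of a power series with p(0) = |d|^2; and since |W v|^2 = |v|^2 - |D_R P v|^2,
   with P the projection onto ker omega_bar,
     p - |z Gamma d|^2 = (1 - |z|^2) |u|^2 + |z|^2 |D_R P u|^2 >= 0.
   So |G|^2 <= p with G = z Gamma d, and the claim is that |G|_(H^2)^2 = p(0) iff
   the radial limit of p has mean p(0) and p - |G|^2 tends to 0 radially a.e.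
   If the latter holds, Fatou's lemma along |z| = r -> 1 bounds |G|_(H^2)^2 from
   below. Conversely, if |G|_(H^2)^2 = p(0), then |G|^2, hence p, is close in L^1,
   uniformly in r, to its analogue for a trigonometric polynomial; the
   Hardy-Littlewood maximal inequality for Poisson means of functions that are
   small in L^1 then gives the a.e. limits of p and |G|^2, and their equality.
   The power series of u is obtained by solving for its coefficients; that their
   partial energies are bounded follows from the fact that the lower triangular
   Toeplitz matrix of a Schur function is a contraction. *)

(** * Trigonometric integrals and the Poisson kernel *)

(** Everything is done for one vector d at a time. The factor z in G leaves the Hardy norm unchanged
    and makes p - |G|^2 visibly nonnegative; compared with the bracket of condition (2), it only
    puts |z|^2 in front of the second term, which is harmless near the circle. Two obstacles shape
    the rest. Adjoints, defect operators, inverses and [omega_bar] are selected by a property, with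
    default 0, so each of them has to be shown to exist; hence Riesz representation, a square root
    iteration and a construction of partial isometries. Moreover the radial limit of p is a [lim],
    with a default value at angles of divergence, and is not known to be measurable; its integral is
    therefore reached through one-sided comparisons off a null set with liminf along the radii 1 -
    1/(k+2). No boundary function of G is ever constructed: boundary values of squared norms of its
    Taylor polynomials take its place. *)

Section SegmentIntegral.
Variable R : realType.
Implicit Types (f g F : R -> R) (a b : R).
Local Notation mu := (@lebesgue_measure R).

Definition segint a b f : R := \int[mu]_(t in `[a, b]) f t.

Lemma continuous_segment_integrable f a b : continuous f ->
  mu.-integrable `[a, b] (EFin \o f).
Proof.
move=> cf; apply: continuous_compact_integrable; first exact: segment_compact.
exact: continuous_subspaceT.
Qed.

Lemma segintE f a b : continuous f ->
  ((segint a b f)%:E = \int[mu]_(t in `[a, b]) (f t)%:E)%E.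
Proof.
move=> cf; rewrite /segint /Rintegral fineK//; apply: integrable_fin_num => //.
exact: continuous_segment_integrable.
Qed.

Lemma segintD f g a b : continuous f -> continuous g ->
  segint a b (fun t => f t + g t) = segint a b f + segint a b g.
Proof.
by move=> cf cg; apply: RintegralD => //; exact: continuous_segment_integrable.
Qed.

Lemma segintB f g a b : continuous f -> continuous g ->
  segint a b (fun t => f t - g t) = segint a b f - segint a b g.
Proof.
by move=> cf cg; apply: RintegralB => //; exact: continuous_segment_integrable.
Qed.

Lemma segintZ f (k : R) a b : continuous f ->
  segint a b (fun t => k * f t) = k * segint a b f.
Proof.
by move=> cf; apply: RintegralZl => //; exact: continuous_segment_integrable.
Qed.

Lemma le_segint f g a b : continuous f -> continuous g ->
  (forall t, a <= t <= b -> f t <= g t) -> segint a b f <= segint a b g.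
Proof.
move=> cf cg fg; apply: le_Rintegral => //; try exact: continuous_segment_integrable.
Qed.

Lemma segint_cst (k : R) a b : a <= b -> segint a b (fun=> k) = k * (b - a).
Proof.
move=> ab; rewrite /segint Rintegral_cst//= lebesgue_measure_itv /=.
case: ifPn => [_|]; first by rewrite -EFinB.
by rewrite lte_fin -leNgt => ba; rewrite /= (@le_anti _ _ a b) ?ab// subrr.
Qed.

Lemma segint_norm_le f a b : continuous f ->
  `|segint a b f| <= segint a b (fun t => `|f t|).
Proof.
by move=> cf; apply: le_normr_Rintegral => //; exact: continuous_segment_integrable.
Qed.

(** This is how identities for trigonometric polynomials pass to functions that they approximate
    uniformly on a circle. *)
Lemma segint_uniform f g a b (e : R) : a <= b -> continuous f -> continuous g ->
  (forall t, `|f t - g t| <= e) ->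
  `|segint a b f - segint a b g| <= e * (b - a).
Proof.
move=> ab cf cg fg; rewrite -segintB//.
have cfg : continuous (fun t => f t - g t).
  by move=> t; apply: cvgB; [exact: cf|exact: cg].
apply: le_trans (segint_norm_le _ _ cfg) _.
rewrite -segint_cst//; apply: le_segint => //; last exact: cst_continuous.
by move=> t; apply: cvg_norm; exact: cfg.
Qed.

Lemma segint_FTC F f a b : a < b -> continuous f ->
  (forall t : R, is_derive t (1 : R) F (f t)) -> segint a b f = F b - F a.
Proof.
move=> ab cf dF; rewrite /segint /Rintegral (@continuous_FTC2 _ f F)//.
- exact: continuous_subspaceT.
- have cF : continuous F.
    by move=> t; apply/differentiable_continuous/derivable1_diffP; have [] := dF t.
  by split=> [t _||]; [have [] := dF t|exact/cvg_at_right_filter/cF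
                     |exact/cvg_at_left_filter/cF].
- by move=> t _; rewrite derive1E; have [_ ->] := dF t.
Qed.

Lemma continuous_bigsum (n : nat) (f : nat -> R -> R) :
  (forall k, continuous (f k)) -> continuous (fun t => \sum_(k < n) f k t).
Proof.
move=> cf; elim: n => [|n IH].
  by under eq_fun do rewrite big_ord0; exact: cst_continuous.
under eq_fun do rewrite big_ord_recr /=.
by move=> t; apply: cvgD; [exact: IH|exact: cf].
Qed.

Lemma segint_sum (n : nat) (f : nat -> R -> R) a b : (forall k, continuous (f k)) ->
  segint a b (fun t => \sum_(k < n) f k t) = \sum_(k < n) segint a b (f k).
Proof.
move=> cf; elim: n => [|n IH].
  under eq_fun do rewrite big_ord0.
  by rewrite big_ord0 /segint /Rintegral integral0.
under eq_fun do rewrite big_ord_recr /=.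
rewrite big_ord_recr /= -IH segintD//; exact: continuous_bigsum.
Qed.

End SegmentIntegral.

Section TrigIntegrals.
Variable R : realType.
Implicit Types (r s t th rho a b : R) (n k : nat).

Lemma continuous_cosn k th : continuous (fun t => cos (k%:R * (t - th))).
Proof.
move=> t; apply: (continuous_comp (f := fun t => k%:R * (t - th))); last exact: continuous_cos.
by apply: cvgM; [exact: cvg_cst|apply: cvgB; [exact: cvg_id|exact: cvg_cst]].
Qed.

Lemma continuous_sinn k th : continuous (fun t => sin (k%:R * (t - th))).
Proof.
move=> t; apply: (continuous_comp (f := fun t => k%:R * (t - th))); last exact: continuous_sin.
by apply: cvgM; [exact: cvg_cst|apply: cvgB; [exact: cvg_id|exact: cvg_cst]].
Qed.

Lemma continuous_cosM k : continuous (fun t => cos (k%:R * t)).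
Proof.
by have := @continuous_cosn k 0; under eq_fun do rewrite subr0.
Qed.

Lemma continuous_sinM k : continuous (fun t => sin (k%:R * t)).
Proof.
by have := @continuous_sinn k 0; under eq_fun do rewrite subr0.
Qed.

Lemma sinn2pi s n : sin (s + 2 * pi * n%:R) = sin s.
Proof.
by rewrite -mulrA mulr_natr mulrC mulr_natr -mulrnA mulnC mulrnA (periodicn (@sinD2pi R)).
Qed.

Lemma cosn2pi s n : cos (s + 2 * pi * n%:R) = cos s.
Proof.
by rewrite -mulrA mulr_natr mulrC mulr_natr -mulrnA mulnC mulrnA (periodicn (@cosD2pi R)).
Qed.

Lemma segint_cosn k th a n : (0 < k)%N -> (0 < n)%N ->
  segint a (a + 2 * pi * n%:R) (fun t => cos (k%:R * (t - th))) = 0.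
Proof.
move=> k0 n0; have kR : k%:R != 0 :> R by rewrite pnatr_eq0 -lt0n.
have dF (t : R) : is_derive t (1 : R) (fun t => k%:R^-1 * sin (k%:R * (t - th)))
    (cos (k%:R * (t - th))).
  apply: is_derive_eq.
  by rewrite /GRing.scale /= subr0 mulr1; field.
rewrite (segint_FTC _ (@continuous_cosn k th) dF) ?ltrDl ?mulr_gt0 ?pi_gt0 ?ltr0n//.
have -> : k%:R * (a + 2 * pi * n%:R - th) = k%:R * (a - th) + 2 * pi * (n * k)%:R.
  by rewrite natrM; ring.
by rewrite sinn2pi subrr.
Qed.

Lemma segint_sinn k th a n : (0 < n)%N ->
  segint a (a + 2 * pi * n%:R) (fun t => sin (k%:R * (t - th))) = 0.
Proof.
move=> n0; have [->|k0] := posnP k.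
  under [X in segint _ _ X]eq_fun do rewrite mul0r sin0.
  by rewrite segint_cst ?mul0r// lerDl !mulr_ge0// ?pi_ge0.
have kR : k%:R != 0 :> R by rewrite pnatr_eq0 -lt0n.
have dF (t : R) : is_derive t (1 : R) (fun t => - k%:R^-1 * cos (k%:R * (t - th)))
    (sin (k%:R * (t - th))).
  apply: is_derive_eq.
  by rewrite /GRing.scale /= subr0 mulr1; field.
rewrite (segint_FTC _ (@continuous_sinn k th) dF) ?ltrDl ?mulr_gt0 ?pi_gt0 ?ltr0n//.
have -> : k%:R * (a + 2 * pi * n%:R - th) = k%:R * (a - th) + 2 * pi * (n * k)%:R.
  by rewrite natrM; ring.
by rewrite cosn2pi subrr.
Qed.

(** For r > 0 the characteristic roots of the recurrence are r and 1/r, and boundedness excludes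
    1/r: J n = x n.+1 - r x n satisfies J n = r^k J (n + k), which tends to 0. *)
Lemma bounded_linear_rec (x : nat -> R) r (M : R) : 0 <= r < 1 ->
  (forall n, `|x n| <= M) ->
  (forall n, r * x n.+2 - (1 + r ^+ 2) * x n.+1 + r * x n = 0) ->
  forall n, x n.+1 = r * x n.
Proof.
move=> /andP[r0 r1] xM xrec.
pose J n := x n.+1 - r * x n.
have JS n : J n = r * J n.+1 by rewrite /J; have := xrec n; lra.
have JM n : `|J n| <= M + r * M.
  apply: le_trans (ler_normB _ _) _; rewrite lerD// normrM (ger0_norm r0).
  by rewrite ler_wpM2l.
have Jk k n : J n = r ^+ k * J (n + k)%N.
  elim: k n => [|k IH] n; first by rewrite addn0 mul1r.
  by rewrite JS IH addSnnS mulrA -exprS.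
suff J0 n : J n = 0 by move=> n; apply/eqP; rewrite -subr_eq0; apply/eqP; exact: J0.
apply/normr0_eq0/le_anti; rewrite normr_ge0 andbT.
have : (fun k => r ^+ k * (M + r * M)) @ \oo --> 0 * (M + r * M).
  by apply: cvgMl; apply: cvg_expr; rewrite ger0_norm.
rewrite mul0r => x0; apply: ler_cvg_to (cvg_cst _) x0 _; near=> k.
by rewrite (Jk k) normrM ger0_norm ?exprn_ge0// ler_wpM2l ?exprn_ge0.
Unshelve. all: by end_near. Qed.

(** This is |1 - r e^(is)|^2, so [poisson] is the Poisson kernel without the factor 1/(2 pi). *)
Definition poisson_den r s := 1 + r ^+ 2 - 2 * r * cos s.
Definition poisson r s := (1 - r ^+ 2) / poisson_den r s.

Lemma poisson_den_ge r s : 0 <= r -> (1 - r) ^+ 2 <= poisson_den r s.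
Proof.
move=> r0; rewrite /poisson_den; have := cos_le1 s; rewrite -subr_ge0.
have -> : 1 + r ^+ 2 - 2 * r * cos s = (1 - r) ^+ 2 + 2 * r * (1 - cos s) by ring.
by move=> c0; rewrite lerDl !mulr_ge0.
Qed.

Lemma poisson_den_gt0 r s : 0 <= r < 1 -> 0 < poisson_den r s.
Proof.
move=> /andP[r0 r1]; apply: lt_le_trans (poisson_den_ge s r0).
by rewrite exprn_gt0// subr_gt0.
Qed.

Lemma poisson_ge0 r s : 0 <= r < 1 -> 0 <= poisson r s.
Proof.
move=> r01; rewrite /poisson divr_ge0 ?(ltW (poisson_den_gt0 _ r01))//.
by case/andP: r01 => r0 /ltW r1; rewrite subr_ge0 expr_le1.
Qed.

Lemma continuous_poisson_den_inv r th : 0 <= r < 1 ->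
  continuous (fun t => (poisson_den r (t - th))^-1).
Proof.
move=> r01 t; apply: cvgV; first by rewrite gt_eqF// poisson_den_gt0.
apply: cvgB; first exact: cvg_cst.
apply: cvgM; first exact: cvg_cst.
by have := @continuous_cosn 1 th t; under eq_fun do rewrite mul1r.
Qed.

Section Kernel.
Variables (r th : R).
Hypothesis r01 : 0 <= r < 1.

(** Moments of 1 / [poisson_den] rather than of the kernel: multiplying by the denominator leaves
    trigonometric functions with known integrals, hence a recurrence that determines the moments. *)
Let Cn n := segint (th - pi) (th + pi)
  (fun t => cos (n%:R * (t - th)) * (poisson_den r (t - th))^-1).
Let Sn n := segint (th - pi) (th + pi)
  (fun t => sin (n%:R * (t - th)) * (poisson_den r (t - th))^-1).

Let pi2E : th + pi = th - pi + 2 * pi * 1%:R :> R.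
Proof. by rewrite mulr1; ring. Qed.

Let cont_C n : continuous (fun t => cos (n%:R * (t - th)) * (poisson_den r (t - th))^-1).
Proof. by move=> t; apply: cvgM; [exact: continuous_cosn|exact: continuous_poisson_den_inv]. Qed.

Let cont_S n : continuous (fun t => sin (n%:R * (t - th)) * (poisson_den r (t - th))^-1).
Proof. by move=> t; apply: cvgM; [exact: continuous_sinn|exact: continuous_poisson_den_inv]. Qed.

Let le_pi : th - pi <= th + pi :> R.
Proof. by have := @pi_ge0 R; lra. Qed.

Let M : R := ((1 - r) ^- 2) * (th + pi - (th - pi)).

Let bound (f : R -> R) : (forall t, `|f t| <= 1) ->
  continuous (fun t => f t * (poisson_den r (t - th))^-1) ->
  `|segint (th - pi) (th + pi) (fun t => f t * (poisson_den r (t - th))^-1)| <= M.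
Proof.
move=> f1 cf; apply: le_trans (segint_norm_le _ _ cf) _.
rewrite /M -segint_cst//; apply: le_segint.
- by move=> t; apply: cvg_norm; exact: cf.
- exact: cst_continuous.
move=> t _; rewrite normrM normfV (gtr0_norm (poisson_den_gt0 _ r01)).
case/andP: r01 => r0 r1; have d0 : 0 < (1 - r) ^+ 2 by rewrite exprn_gt0// subr_gt0.
rewrite -[leRHS]mul1r ler_pM//; first by rewrite invr_ge0 ltW// poisson_den_gt0.
by rewrite lef_pV2 ?posrE ?poisson_den_gt0//; exact: poisson_den_ge.
Qed.

(** Since 2 cos s cos((n+1)s) = cos((n+2)s) + cos(ns), the left side is minus the integral of
    cos((n+1)s) over a period. *)
Let Crec n : r * Cn n.+2 - (1 + r ^+ 2) * Cn n.+1 + r * Cn n = 0.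
Proof.
have zero := @segint_cosn n.+1 th (th - pi) 1 isT isT; rewrite -pi2E in zero.
rewrite /Cn -!(segintZ _ _ _ (@cont_C _)).
rewrite -segintB; [|by move=> t; apply: cvgM; [exact: cvg_cst|exact: cont_C]..].
rewrite -segintD; last 2 first.
- by move=> t; apply: cvgB; (apply: cvgM; [exact: cvg_cst|exact: cont_C]).
- by move=> t; apply: cvgM; [exact: cvg_cst|exact: cont_C].
rewrite -[RHS](mulr0 (-1)) -[X in _ = _ * X]zero -segintZ; last exact: continuous_cosn.
congr segint; apply/funext => t; move: (t - th) => s.
have D0 : poisson_den r s != 0 by rewrite gt_eqF// poisson_den_gt0.
have e2 : n.+2%:R * s = n.+1%:R * s + s :> R by rewrite -[n.+2%:R]natr1; ring.
have e0 : n%:R * s = n.+1%:R * s - s :> R by rewrite -[n.+1%:R]natr1; ring.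
by rewrite e2 e0 cosD cosB /poisson_den; field.
Qed.

Let Srec n : r * Sn n.+2 - (1 + r ^+ 2) * Sn n.+1 + r * Sn n = 0.
Proof.
have zero := @segint_sinn n.+1 th (th - pi) 1 isT; rewrite -pi2E in zero.
rewrite /Sn -!(segintZ _ _ _ (@cont_S _)).
rewrite -segintB; [|by move=> t; apply: cvgM; [exact: cvg_cst|exact: cont_S]..].
rewrite -segintD; last 2 first.
- by move=> t; apply: cvgB; (apply: cvgM; [exact: cvg_cst|exact: cont_S]).
- by move=> t; apply: cvgM; [exact: cvg_cst|exact: cont_S].
rewrite -[RHS](mulr0 (-1)) -[X in _ = _ * X]zero -segintZ; last exact: continuous_sinn.
congr segint; apply/funext => t; move: (t - th) => s.
have D0 : poisson_den r s != 0 by rewrite gt_eqF// poisson_den_gt0.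
have e2 : n.+2%:R * s = n.+1%:R * s + s :> R by rewrite -[n.+2%:R]natr1; ring.
have e0 : n%:R * s = n.+1%:R * s - s :> R by rewrite -[n.+1%:R]natr1; ring.
by rewrite e2 e0 sinD sinB /poisson_den; field.
Qed.

Let SnE n : Sn n = 0.
Proof.
have SS : forall n, Sn n.+1 = r * Sn n.
  apply: (bounded_linear_rec r01 (M := M)); last exact: Srec.
  by move=> j; apply: (bound (f := fun t => sin (j%:R * (t - th)))) => [t|]; [exact: sin_max|exact: cont_S].
elim: n => [|n IH]; last by rewrite SS IH mulr0.
rewrite /Sn; under eq_fun do rewrite mul0r sin0 mul0r.
by rewrite segint_cst// mul0r.
Qed.

(** The recurrence gives C_n = r^n C_0. The value of C_0 comes from integrating 1 = [poisson_den] /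
    [poisson_den] over a period, which reads (1 + r^2) C_0 - 2 r C_1 = 2 pi. *)
Let CnE n : (1 - r ^+ 2) * Cn n = 2 * pi * r ^+ n.
Proof.
have CS : forall n, Cn n.+1 = r * Cn n.
  apply: (bounded_linear_rec r01 (M := M)); last exact: Crec.
  by move=> j; apply: (bound (f := fun t => cos (j%:R * (t - th)))) => [t|]; [exact: cos_max|exact: cont_C].
elim: n => [|n IH]; last by rewrite CS mulrCA IH exprS; ring.
rewrite expr0 mulr1.
have : 2 * r * Cn 1 = (1 + r ^+ 2) * Cn 0 - 2 * pi.
  have -> : 2 * pi = segint (th - pi) (th + pi) (fun=> 1) :> R.
    by rewrite segint_cst//; ring.
  rewrite /Cn -!(segintZ _ _ _ (@cont_C _)).
  rewrite -segintB; last 2 first.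
  - by move=> t; apply: cvgM; [exact: cvg_cst|exact: cont_C].
  - exact: cst_continuous.
  congr segint; apply/funext => t; move: (t - th) => s.
  have D0 : poisson_den r s != 0 by rewrite gt_eqF// poisson_den_gt0.
  rewrite mul0r mul1r cos0; move: D0; rewrite /poisson_den => D0; field.
  exact: D0.
by rewrite CS; lra.
Qed.

(** Writing k t = k (t - th) + k th splits the integrand into cosine and sine moments about th, and
    the sine moments vanish. *)
Lemma poisson_trig k (x y : R) :
  segint (th - pi) (th + pi) (fun t => poisson r (t - th) *
    (x * cos (k%:R * t) + y * sin (k%:R * t))) =
  2 * pi * (r ^+ k * (x * cos (k%:R * th) + y * sin (k%:R * th))).
Proof.
pose u := (1 - r ^+ 2) * (x * cos (k%:R * th) + y * sin (k%:R * th)).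
pose v := (1 - r ^+ 2) * (y * cos (k%:R * th) - x * sin (k%:R * th)).
transitivity (u * Cn k + v * Sn k); last by rewrite SnE mulr0 addr0 /u mulrAC CnE; ring.
rewrite /Cn /Sn -!(segintZ _ _ _ (@cont_C _)) -!(segintZ _ _ _ (@cont_S _)).
rewrite -segintD; last 2 first.
- by move=> t; apply: cvgM; [exact: cvg_cst|exact: cont_C].
- by move=> t; apply: cvgM; [exact: cvg_cst|exact: cont_S].
congr segint; apply/funext => t.
have -> : k%:R * t = k%:R * (t - th) + k%:R * th :> R by ring.
by rewrite cosD sinD /u /v /poisson; ring.
Qed.

End Kernel.
End TrigIntegrals.

Section Harmonic.
Variable R : realType.
Implicit Types (al be : nat -> R) (h : R -> R -> R) (r s t th rho a b e : R).

Definition trigsum al be N rho t : R :=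
  \sum_(k < N) rho ^+ k * (al k * cos (k%:R * t) + be k * sin (k%:R * t)).

(* Functions on the disc are written in polar coordinates. *)
Definition disc_harmonic h al be := forall rho, 0 <= rho < 1 -> forall e, 0 < e ->
  \forall N \near \oo, forall t, `|h rho t - trigsum al be N rho t| <= e.

Lemma continuous_trigterm al be k rho :
  continuous (fun t => rho ^+ k * (al k * cos (k%:R * t) + be k * sin (k%:R * t))).
Proof.
move=> t; apply: cvgM; first exact: cvg_cst.
by apply: cvgD; (apply: cvgM; first exact: cvg_cst); [exact: continuous_cosM|exact: continuous_sinM].
Qed.

Lemma continuous_trigsum al be N rho : continuous (trigsum al be N rho).
Proof.
by apply: (@continuous_bigsum _ _ (fun k t => rho ^+ k * (al k * cos (k%:R * t)
  + be k * sin (k%:R * t)))) => k; exact: continuous_trigterm.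
Qed.

Lemma segint_trigsum al be N rho a n : (0 < N)%N -> (0 < n)%N ->
  segint a (a + 2 * pi * n%:R) (trigsum al be N rho) = al 0 * (2 * pi * n%:R).
Proof.
move=> N0 n0; case: N N0 => // N _.
have ab : a <= a + 2 * pi * n%:R by rewrite lerDl !mulr_ge0// ?pi_ge0.
rewrite (@segint_sum _ _ (fun k t => rho ^+ k * (al k * cos (k%:R * t)
  + be k * sin (k%:R * t)))); last by move=> k; exact: continuous_trigterm.
rewrite big_ord_recl big1 ?addr0.
  under [X in segint _ _ X]eq_fun do rewrite expr0 !mul0r cos0 sin0 mul1r mulr1 mulr0 addr0.
  by rewrite segint_cst// addrAC subrr add0r.
move=> i _; rewrite segintZ; last first.
  by have := @continuous_trigterm al be (lift ord0 i) 1; under eq_fun do rewrite expr1n mul1r.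
have [cc cs] := (@continuous_cosM R (lift ord0 i), @continuous_sinM R (lift ord0 i)).
rewrite segintD; [|by move=> t; apply: cvgM; [exact: cvg_cst|exact: cc]
  |by move=> t; apply: cvgM; [exact: cvg_cst|exact: cs]].
rewrite !segintZ//.
have := @segint_cosn R (lift ord0 i) 0 a n isT n0; under eq_fun do rewrite subr0.
have := @segint_sinn R (lift ord0 i) 0 a n n0; under eq_fun do rewrite subr0.
by move=> -> ->; rewrite !mulr0 addr0 mulr0.
Qed.

Lemma poisson_trigsum al be N r rho th : 0 <= r < 1 ->
  segint (th - pi) (th + pi) (fun t => poisson r (t - th) * trigsum al be N rho t) =
  2 * pi * trigsum al be N (r * rho) th.
Proof.
move=> r01; under eq_fun do rewrite mulr_sumr.
rewrite (@segint_sum _ _ (fun k t => poisson r (t - th) *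
  (rho ^+ k * (al k * cos (k%:R * t) + be k * sin (k%:R * t))))); last first.
  move=> k t; apply: cvgM; last exact: continuous_trigterm.
  by apply: cvgM; [exact: cvg_cst|exact: continuous_poisson_den_inv].
rewrite mulr_sumr; apply: eq_bigr => k _.
have := poisson_trig th r01 k (rho ^+ k * al k) (rho ^+ k * be k).
have -> : (fun t => poisson r (t - th) * (rho ^+ k * al k * cos (k%:R * t) +
    rho ^+ k * be k * sin (k%:R * t))) = (fun t => poisson r (t - th) *
    (rho ^+ k * (al k * cos (k%:R * t) + be k * sin (k%:R * t)))).
  by apply/funext => t; ring.
by move=> ->; rewrite exprMn; ring.
Qed.

Section Limits.
Variables (h : R -> R -> R) (al be : nat -> R).
Hypothesis hh : disc_harmonic h al be.

Lemma harmonic_continuous rho : 0 <= rho < 1 -> continuous (h rho).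
Proof.
move=> rho01 t; apply/cvgrPdist_le => e e0; have e3 : 0 < e / 3 by rewrite divr_gt0.
have [N _ hN] := hh rho01 e3.
have /cvgrPdist_le/(_ _ e3) := @continuous_trigsum al be N rho t.
apply: filterS => u; have := hN N (leqnn N) t; have := hN N (leqnn N) u.
by rewrite !ler_norml => /andP[? ?] /andP[? ?] /andP[? ?]; apply/andP; split; lra.
Qed.

(** Mean value property over any whole number of periods: one period serves the final integrals, two
    serve the maximal inequality. *)
Lemma segint_harmonic rho a n : (0 < n)%N -> 0 <= rho < 1 ->
  segint a (a + 2 * pi * n%:R) (h rho) = al 0 * (2 * pi * n%:R).
Proof.
move=> n0 rho01; apply/eqP; rewrite -subr_eq0 -normr_le0; apply/ler_addgt0Pl => e e0.
rewrite addr0; have L0 : 0 < 2 * pi * n%:R :> R by rewrite !mulr_gt0 ?pi_gt0 ?ltr0n.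
have e3 : 0 < e / (2 * pi * n%:R) by rewrite divr_gt0.
have [N _ hN] := hh rho01 e3.
rewrite -(@segint_trigsum al be N.+1 rho a n)//.
apply: le_trans (segint_uniform _ _ _ (hN N.+1 (leqnSn N))) _.
- by rewrite lerDl ltW.
- exact: harmonic_continuous.
- exact: continuous_trigsum.
- by rewrite addrAC subrr add0r divfK ?gt_eqF.
Qed.

Lemma continuous_poisson r th : 0 <= r < 1 -> continuous (fun t => poisson r (t - th)).
Proof.
by move=> r01 t; apply: cvgM; [exact: cvg_cst|exact: continuous_poisson_den_inv].
Qed.

Lemma poisson_le r s : 0 <= r < 1 -> poisson r s <= 2 / (1 - r).
Proof.
move=> /andP[r0 r1]; have d0 : 0 < 1 - r by rewrite subr_gt0.
have D0 : 0 < poisson_den r s by rewrite poisson_den_gt0 ?r0.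
rewrite /poisson ler_pdivrMr// mulrAC ler_pdivlMr//.
apply: le_trans (_ : 2 * (1 - r) ^+ 2 <= _); last first.
  by rewrite ler_wpM2l// poisson_den_ge.
have -> : (1 - r ^+ 2) * (1 - r) = (1 + r) * (1 - r) ^+ 2 by ring.
by rewrite ler_wpM2r ?exprn_ge0 ?(ltW d0)//; lra.
Qed.

(** True termwise for trigonometric sums, where the kernel multiplies the kth coefficient by r^k;
    uniform approximation on the circles of radii rho and r rho gives the rest. *)
Lemma poisson_harmonic r rho th : 0 <= r < 1 -> 0 <= rho < 1 ->
  segint (th - pi) (th + pi) (fun t => poisson r (t - th) * h rho t) =
  2 * pi * h (r * rho) th.
Proof.
move=> r01 rho01; have [r0 r1] := andP r01; have [rho0 rho1] := andP rho01.
have rr01 : 0 <= r * rho < 1.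
  by rewrite mulr_ge0//= mulr_ilt1.
have pi0 := @pi_gt0 R; have d0 : 0 < 1 - r by rewrite subr_gt0.
apply/eqP; rewrite -subr_eq0 -normr_le0; apply/ler_addgt0Pl => e e0.
(* C adds up the two approximation errors: the integral over a period of the kernel bound 2 / (1 -
   r), and the factor 2 pi of the right side. *)
rewrite addr0; pose C := 2 / (1 - r) * (2 * pi) + 2 * pi.
have C0 : 0 < C by rewrite addr_gt0// ?mulr_gt0 ?invr_gt0.
have e3 : 0 < e / C by rewrite divr_gt0.
have [N1 _ hN1] := hh rho01 e3; have [N2 _ hN2] := hh rr01 e3.
pose N := maxn N1 N2.
have := hN1 N (leq_maxl _ _); have := hN2 N (leq_maxr _ _) => h2 h1.
have ce : e = (2 / (1 - r) * (e / C)) * (2 * pi) + 2 * pi * (e / C).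
  by rewrite -[LHS](divfK (lt0r_neq0 C0)); move: (e / C) => x; rewrite /C; ring.
set I := segint _ _ _.
have -> : I - 2 * pi * h (r * rho) th =
  (I - 2 * pi * trigsum al be N (r * rho) th) -
  2 * pi * (h (r * rho) th - trigsum al be N (r * rho) th) by ring.
apply: le_trans (ler_normB _ _) _; rewrite [leRHS]ce lerD//; last first.
  by rewrite normrM gtr0_norm ?mulr_gt0// ler_wpM2l// mulr_ge0// ltW.
rewrite -poisson_trigsum// /I.
have -> : 2 * pi = th + pi - (th - pi) :> R by ring.
apply: segint_uniform; first by lra.
- by move=> t; apply: cvgM; [exact: continuous_poisson|exact: harmonic_continuous].
- by move=> t; apply: cvgM; [exact: continuous_poisson|exact: continuous_trigsum].
move=> t; rewrite -mulrBr normrM ger0_norm ?poisson_ge0//.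
by rewrite ler_pM// ?poisson_ge0 ?poisson_le.
Qed.

End Limits.

Lemma harmonicB h1 h2 al1 be1 al2 be2 : disc_harmonic h1 al1 be1 -> disc_harmonic h2 al2 be2 ->
  disc_harmonic (fun rho t => h1 rho t - h2 rho t) (fun k => al1 k - al2 k) (fun k => be1 k - be2 k).
Proof.
move=> H1 H2 rho rho01 e e0; have e2 : 0 < e / 2 by rewrite divr_gt0.
near=> N => t.
have -> : trigsum (fun k => al1 k - al2 k) (fun k => be1 k - be2 k) N rho t =
    trigsum al1 be1 N rho t - trigsum al2 be2 N rho t.
  by rewrite /trigsum -sumrB; apply: eq_bigr => k _; ring.
have -> : h1 rho t - h2 rho t - (trigsum al1 be1 N rho t - trigsum al2 be2 N rho t) =
  (h1 rho t - trigsum al1 be1 N rho t) - (h2 rho t - trigsum al2 be2 N rho t) by ring.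
apply: le_trans (ler_normB _ _) _; rewrite [e]splitr lerD//.
- by move: t; near: N; exact: H1.
- by move: t; near: N; exact: H2.
Unshelve. all: by end_near. Qed.

Lemma harmonic_trigsum al be N :
  disc_harmonic (trigsum al be N) (fun k => if (k < N)%N then al k else 0)
    (fun k => if (k < N)%N then be k else 0).
Proof.
move=> rho rho01 e e0; exists N => // M /= NM t.
suff -> : trigsum al be N rho t = trigsum (fun k => if (k < N)%N then al k else 0)
    (fun k => if (k < N)%N then be k else 0) M rho t by rewrite subrr normr0 ltW.
rewrite /trigsum (big_ord_widen _ (fun k => rho ^+ k *
  (al k * cos (k%:R * t) + be k * sin (k%:R * t))) NM) big_mkcond.
by apply: eq_bigr => k _; case: ifP => // _; rewrite !mul0r addr0 mulr0.
Qed.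

End Harmonic.

(** * The radial maximal inequality *)

Section PoissonMaximal.
Variable R : realType.
Implicit Types (r s t th rho a b d e : R).
Local Notation mu := (@lebesgue_measure R).

(** The slope cos 1 / 2 works on both pieces: on [0, 1] the mean value theorem gives sin x >= x cos
    1, and beyond 1 monotonicity gives sin x >= cos 1 while x <= pi / 2 <= 2. *)
Lemma sin_ge_linear : exists2 c : R, 0 < c <= 1 &
  forall x : R, 0 <= x <= pi / 2 -> c * x <= sin x.
Proof.
have c0 := @cos1_gt0 R; have c1 := @cos_le1 R 1.
have /andP[p0 p2] := @pihalf_02 R; have p1 := @pihalf_ge1 R.
have sin_ge (x : R) : 0 <= x <= 1 -> cos 1 * x <= sin x.
  move=> /andP[x0 x1]; have [->|xn0] := eqVneq x 0; first by rewrite mulr0 sin0.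
  have xp : 0 < x by rewrite lt_neqAle eq_sym xn0.
  have [|c /[!in_itv]/= /andP[c0' cx]] := @MVT R sin cos 0 x xp (fun t _ => is_derive_sin t).
    by apply: continuous_subspaceT; exact: continuous_sin.
  rewrite sin0 !subr0 => ->; rewrite ler_wpM2r//.
  rewrite leNgt ltr_cos ?in_itv/= ?(ltW c0')//; first by rewrite -leNgt; lra.
    by lra.
  by apply/andP; split; lra.
exists (cos 1 / 2) => [|x /andP[x0 xp]]; first by apply/andP; split; lra.
have [x1|x1] := lerP x 1; first by have := sin_ge x; rewrite x0 x1 => /(_ isT); nra.
have s1 : cos 1 <= sin 1 :> R by have := sin_ge 1; rewrite ler01 lexx mulr1; exact.
apply: le_trans (_ : sin 1 <= _); first by nra.
rewrite leNgt ltr_sin ?in_itv/=; first by rewrite -leNgt ltW.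
  by apply/andP; split; lra.
by apply/andP; split; lra.
Qed.

(** The denominator is (1 - r)^2 + 4 r sin^2(s/2); r >= 1/2 and the linear lower bound of the sine
    make it comparable to (1 - r)^2 + s^2. *)
Lemma poisson_bound : exists2 C : R, 0 < C & forall r s, 2^-1 <= r < 1 -> `|s| <= pi ->
  poisson r s <= C * ((1 - r) / ((1 - r) ^+ 2 + s ^+ 2)).
Proof.
have [c /andP[c0 c1] sc] := sin_ge_linear.
(* Numerator (1 + r)(1 - r) <= 2 (1 - r), over a denominator at least c^2 / 2 times (1 - r)^2 +
   s^2. *)
exists (4 / c ^+ 2) => [|r s /andP[r2 r1] sp]; first by rewrite divr_gt0 ?exprn_gt0.
have r0 : 0 <= r by apply: le_trans r2.
have d0 : 0 < 1 - r by rewrite subr_gt0.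
have D0 : 0 < (1 - r) ^+ 2 + s ^+ 2 by rewrite ltr_wpDr ?exprn_gt0 ?sqr_ge0.
have P0 : 0 < poisson_den r s by rewrite poisson_den_gt0// r0.
have cosE : cos s = 1 - 2 * sin (`|s| / 2) ^+ 2.
  have {1}-> : cos s = cos ((`|s| / 2) *+ 2) by rewrite -mulr_natr divfK// cos_norm.
  rewrite cos_mulr2n cos2sin2; ring.
have s2 : c ^+ 2 * s ^+ 2 <= 4 * sin (`|s| / 2) ^+ 2.
  have : c * (`|s| / 2) <= sin (`|s| / 2).
    by apply: sc; rewrite divr_ge0//= ler_pM2r.
  rewrite -(@ler_pXn2r _ 2)// ?nnegrE; last 2 first.
  - by rewrite mulr_ge0 ?divr_ge0// ltW.
  - by apply: sin_ge0_pi; rewrite divr_ge0//=; apply: le_trans (_ : `|s| <= _) => //; rewrite ler_pdivrMr// ler_peMr// ler1n.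
  by rewrite exprMn expr_div_n real_normK ?num_real//; lra.
have den : c ^+ 2 / 2 * ((1 - r) ^+ 2 + s ^+ 2) <= poisson_den r s.
  have -> : poisson_den r s = (1 - r) ^+ 2 + 2 * r * (1 - cos s).
    by rewrite /poisson_den; ring.
  have c2 : c ^+ 2 <= 1 by rewrite expr_le1// ltW.
  have -> : 1 - cos s = 2 * sin (`|s| / 2) ^+ 2 by rewrite cosE; ring.
  rewrite mulrDr lerD//.
    by rewrite ler_piMl ?sqr_ge0//; lra.
  set S := sin _ ^+ 2 in s2 *; have S0 : 0 <= S by exact: sqr_ge0.
  by apply: le_trans (_ : 2 * S <= _); [lra|nra].
rewrite /poisson ler_pdivrMr//.
have -> : 1 - r ^+ 2 = (1 + r) * (1 - r) by ring.
apply: le_trans (_ : 2 * (1 - r) <= _); first by rewrite ler_pM2r//; lra.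
apply: le_trans (_ : 4 / c ^+ 2 * ((1 - r) / ((1 - r) ^+ 2 + s ^+ 2)) *
  (c ^+ 2 / 2 * ((1 - r) ^+ 2 + s ^+ 2)) <= _).
  by rewrite le_eqVlt; apply/orP; left; apply/eqP; field; rewrite !gt_eqF.
by rewrite ler_wpM2l// !mulr_ge0 ?invr_ge0 ?exprn_ge0 ?(ltW c0) ?(ltW d0) ?(ltW D0).
Qed.

(* Dominates the Poisson kernel at 1 - r = d by averages over intervals. *)
Lemma dyadic_bound d s K : 0 < d -> `|s| < 2 ^+ K * d ->
  d / (d ^+ 2 + s ^+ 2) <= \sum_(k < K.+1) 4 / (4 ^+ k * d) * (`|s| < 2 ^+ k * d)%R%:R.
Proof.
move=> d0; have D0 : 0 < d ^+ 2 + s ^+ 2 by rewrite ltr_wpDr ?exprn_gt0 ?sqr_ge0.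
have pos k : 0 <= 4 / (4 ^+ k * d) by rewrite divr_ge0// mulr_ge0 ?exprn_ge0 ?ltW.
elim: K => [|K IH] sK; rewrite big_ord_recr /= sK mulr1.
  rewrite big_ord0 add0r mul1r ler_pdivrMr// mulrAC ler_pdivlMr//.
  by have := sqr_ge0 s; nra.
have [sK'|sK'] := ltP `|s| (2 ^+ K * d).
  by apply: le_trans (IH sK') _; rewrite lerDl.
apply: ler_wpDl; first by apply: sumr_ge0 => k _; rewrite mulr_ge0.
have K0 : 0 < 4 ^+ K :> R by rewrite exprn_gt0.
have : (2 ^+ K * d) ^+ 2 <= s ^+ 2.
  rewrite -[s ^+ 2]real_normK ?num_real// ler_pXn2r ?nnegrE//.
  by rewrite mulr_ge0 ?exprn_ge0// ltW.
have -> : (2 ^+ K * d) ^+ 2 = 4 ^+ K * d ^+ 2.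
  by rewrite exprMn exprAC; congr (_ ^+ _ * _); rewrite expr2; ring.
move=> s2.
rewrite ler_pdivrMr// mulrAC ler_pdivlMr ?mulr_gt0 ?exprn_gt0//.
have -> : 4 ^+ K.+1 = 4 * 4 ^+ K :> R by rewrite exprS.
have -> : d * (4 * 4 ^+ K * d) = 4 * (4 ^+ K * d ^+ 2) by ring.
by rewrite ler_pM2l//; apply: le_trans s2 _; rewrite lerDr sqr_ge0.
Qed.

End PoissonMaximal.

(** * A weak type inequality for radial maximal functions *)

Section WeakType.
Variable R : realType.
Implicit Types (r s t th rho a b d e : R).
Local Notation mu := (@lebesgue_measure R).

Let J : set R := `[- pi, 3 * pi].

Let pi0 : 0 < pi :> R. Proof. exact: pi_gt0. Qed.

Let mW (W : R -> R) : continuous W -> measurable_fun [set: R] (W \_ J).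
Proof.
move=> cW; apply/(measurable_restrictT _ (measurable_itv _)).
by apply: measurable_funTS; exact: continuous_measurable_fun.
Qed.

(** The kernel is dominated by multiples c_k of indicators of the balls of radius 2^k d; each
    contributes at most c_k times the length of its ball times the maximal function, and these
    products 8 C / 2^k sum to less than 16 C. The cut-off to [J] changes nothing on the period
    centred at th. *)
Lemma poisson_HL_maximal : exists2 C : R, 0 < C &
  forall (W : R -> R) r th, continuous W -> (forall t, 0 <= W t) ->
  2^-1 <= r < 1 -> 0 <= th <= 2 * pi ->
  ((segint (th - pi) (th + pi) (fun t => poisson r (t - th) * W t))%:E
     <= C%:E * HL_maximal (W \_ J) th)%E.
Proof.
have [C C0 PC] := poisson_bound R; exists (16 * C); first by rewrite mulr_gt0.
move=> W r th cW W0 r01 /andP[th0 th2].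
have [r2 r1] := andP r01; have d0 : 0 < 1 - r by rewrite subr_gt0.
have r0 : 0 <= r by apply: le_trans r2.
set d := 1 - r in d0 *.
(* Enough dyadic balls to cover the half period |s| <= pi, as [dyadic_bound] requires. *)
have [K piK] : exists K, pi < 2 ^+ K * d.
  exists (Num.bound (pi / d)); rewrite -ltr_pdivrMr//.
  apply: lt_trans (archi_boundP _) _; first by rewrite divr_ge0 ?ltW.
  by rewrite -natrX ltr_nat ltn_expl.
pose c k := C * (4 / (4 ^+ k * d)).
have c_ge0 k : 0 <= c k by rewrite /c !mulr_ge0 ?invr_ge0 ?mulr_ge0 ?exprn_ge0 ?ltW.
pose B k : set R := ball th (2 ^+ k * d).
have mB k : measurable (B k) by exact: measurable_ball.
have mWJ := mW cW.
have mabs A : measurable A -> measurable_fun A (fun t => `|((W \_ J) t)%:E|%E).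
  by move=> mD; apply: measurable_funTS; apply/measurableT_comp => //; exact/measurable_EFinP.
have mres k A : measurable A -> measurable_fun A ((fun t => `|((W \_ J) t)%:E|%E) \_ (B k)).
  move=> mA; apply/measurable_restrict; [exact: mB|exact: mA|].
  by apply: mabs; apply: measurableI; [exact: mA|exact: mB].
have mD : measurable (`[th - pi, th + pi] : set R) by exact: measurable_itv.
have cP : continuous (fun t => poisson r (t - th) * W t).
  by move=> t; apply: cvgM; [apply: continuous_poisson; rewrite r0|exact: cW].
rewrite segintE//; set D : set R := [set` _].
apply: (@le_trans _ _ (\int[mu]_(t in D)
   \sum_(k < K.+1) ((c k)%:E * ((fun t => `|((W \_ J) t)%:E|) \_ (B k)) t))%E).
  apply: ge0_le_integral => //.
  - by move=> t _; rewrite lee_fin mulr_ge0// poisson_ge0// r0.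
  - by apply/measurable_EFinP/measurable_funTS; exact: continuous_measurable_fun.
  - apply: emeasurable_sum => k; apply: measurable_funeM.
    exact: mres.
  move=> t; rewrite /D /= in_itv /= => /andP[t1 t2].
  have Jt : t \in J by rewrite inE /J /= in_itv /=; apply/andP; split; lra.
  have ts : `|t - th| <= pi by rewrite ler_norml; apply/andP; split; lra.
  apply: (@le_trans _ _ (\sum_(k < K.+1) (c k * (`|t - th| < 2 ^+ k * d)%R%:R * W t)%:E)%E).
    rewrite sumEFin lee_fin -mulr_suml ler_wpM2r//.
    apply: le_trans (PC _ _ r01 ts) _; rewrite -/d.
    under eq_bigr do rewrite /c -mulrA.
    by rewrite -mulr_sumr ler_wpM2l ?(ltW C0)// dyadic_bound// (le_lt_trans ts).
  apply: lee_sum => k _; rewrite patchE.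
  have -> : (t \in B k) = (`|t - th| < 2 ^+ k * d).
    by rewrite /B; apply/idP/idP; rewrite inE /ball /= distrC.
  case: ifPn => _; last by rewrite mulr0 mul0r mule0.
  by rewrite patchE Jt /= mulr1 ger0_norm.
rewrite ge0_integral_sum//; last 2 first.
- move=> k; apply: measurable_funeM.
  exact: mres.
- by move=> k t _; rewrite mule_ge0 ?lee_fin// patchE; case: ifP.
apply: (@le_trans _ _ (\sum_(k < K.+1) (8 * C / 2 ^+ k)%:E * HL_maximal (W \_ J) th)%E).
  apply: lee_sum => k _.
  rewrite ge0_integralZl_EFin//; last 2 first.
  - by move=> t _; rewrite patchE; case: ifP.
  - exact: mres.
  have Bpos : 0 < 2 ^+ k * d by rewrite mulr_gt0 ?exprn_gt0.
  have : (iavg (W \_ J) (B k) <= HL_maximal (W \_ J) th)%E.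
    by apply: ereal_sup_ubound; exists (2 ^+ k * d) => //; rewrite /= in_itv/= Bpos.
  rewrite /iavg lebesgue_measure_ball ?(ltW Bpos)// inver mulrn_eq0/= gt_eqF//.
  rewrite lee_pdivrMl ?mulrn_wgt0// => HB.
  have -> : 8 * C / 2 ^+ k = c k * ((2 ^+ k * d) *+ 2).
    rewrite /c; have -> : 4 ^+ k = 2 ^+ k * 2 ^+ k :> R.
      by rewrite -exprMn; congr (_ ^+ _); ring.
    by field; rewrite !gt_eqF ?exprn_gt0.
  rewrite [(c k * (_ *+ 2))%:E]EFinM -[X in (_ <= X)%E]muleA; apply: lee_wpmul2l; first by rewrite lee_fin.
  apply: le_trans HB; rewrite -integral_mkcondr; apply: ge0_subset_integral => //.
  - by apply: measurableI; [exact: mD|exact: mB].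
  - exact: mB.
  - by apply: (mabs _ (mB k)).
rewrite -ge0_sume_distrl; last by move=> k _; rewrite lee_fin !mulr_ge0 ?invr_ge0 ?exprn_ge0 ?ltW.
apply: lee_wpmul2r.
  apply: (@le_trans _ _ (iavg (W \_ J) (ball th 1))).
    by rewrite /iavg mule_ge0 ?inve_ge0 ?integral_ge0.
  by apply: ereal_sup_ubound; exists 1 => //; rewrite /= in_itv/= ltr01.
rewrite sumEFin lee_fin.
have -> : \sum_(k < K.+1) 8 * C / 2 ^+ k = 16 * C - 8 * C / 2 ^+ K.
  elim: (K) => [|n IH]; first by rewrite big_ord_recl big_ord0 expr0 invr1; ring.
  by rewrite big_ord_recr /= IH exprS; field; rewrite gt_eqF ?exprn_gt0.
by rewrite gerBl !mulr_ge0 ?invr_ge0 ?exprn_ge0 ?ltW.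
Qed.

(** Subharmonicity in the form that the maximal inequality uses; it covers both |v| for v harmonic
    and |G|^2 for G analytic. *)
Definition subpoisson (w : R -> R -> R) := forall r rho th, 0 <= r < 1 -> 0 <= rho < 1 ->
  2 * pi * w (r * rho) th <=
  segint (th - pi) (th + pi) (fun t => poisson r (t - th) * w rho t).

(** The radius r is reached from the larger circle of radius rho by the kernel of parameter r / rho,
    which lies in [1/2, 1). *)
Let subpoisson_HL : exists2 C : R, 0 < C & forall (w : R -> R -> R) r rho th,
  (forall rho, 0 <= rho < 1 -> continuous (w rho)) -> (forall rho t, 0 <= w rho t) ->
  subpoisson w -> 2^-1 <= r -> r < rho < 1 -> 0 <= th <= 2 * pi ->
  ((w r th)%:E <= C%:E * HL_maximal (w rho \_ J) th)%E.
Proof.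
have [C C0 HC] := poisson_HL_maximal; exists (C / (2 * pi)).
  by rewrite divr_gt0 ?mulr_gt0.
move=> w r rho th cw w0 sw r2 /andP[rrho rho1] th02.
have r0 : 0 < r by apply: lt_le_trans r2; rewrite invr_gt0.
have rho0 : 0 < rho by apply: lt_trans rrho.
have rho01 : 0 <= rho < 1 by rewrite ltW.
have q1 : r / rho < 1 by rewrite ltr_pdivrMr// mul1r.
have qr : r <= r / rho by rewrite ler_pdivlMr// ger_pMr// ltW.
have q2 : 2^-1 <= r / rho < 1 by rewrite q1 andbT (le_trans r2).
have q0 : 0 <= r / rho < 1 by rewrite q1 andbT divr_ge0 ?ltW.
have := sw (r / rho) rho th q0 rho01; rewrite divfK ?gt_eqF// => H1.
have := HC (w rho) (r / rho) th (cw _ rho01) (w0 rho) q2 th02 => H2.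
rewrite mulrC EFinM -muleA lee_pdivlMl ?mulr_gt0// -EFinM.
by apply: le_trans H2; rewrite lee_fin.
Qed.

(* The interval from -pi to 3 pi contains the periods centred at points of
   the interval from 0 to 2 pi. *)
Lemma weak_type_radial : exists2 C : R, 0 < C & forall (w : R -> R -> R) (e lam : R),
  (forall rho, 0 <= rho < 1 -> continuous (w rho)) -> (forall rho t, 0 <= w rho t) ->
  subpoisson w -> (forall rho0, rho0 < 1 -> exists2 rho, rho0 < rho < 1 &
    segint (- pi) (3 * pi) (w rho) <= e) ->
  0 < lam ->
  exists N : set R, [/\ measurable N, (mu N <= (C * e / lam)%:E)%E &
    forall th r, 0 <= th <= 2 * pi -> 2^-1 <= r < 1 -> lam < w r th -> N th].
Proof.
have [C C0 HC] := subpoisson_HL; exists (3 * C); first by rewrite mulr_gt0.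
move=> w e lam cw w0 sw we lam0.
pose rn n : R := 1 - n.+2%:R^-1.
have rn1 n : rn n < 1 by rewrite gtrBl invr_gt0.
(* Radii are capped at [rn n] so that a single circle of radius rho > [rn n] with small integral
   controls them all. The union runs over uncountably many r, but its members are open, so it is
   measurable. *)
pose U n : set R := \bigcup_(r in [set r | 2^-1 <= r < rn n]) [set th | lam < w r th].
have oU n : open (U n).
  apply: bigcup_open => r /= /andP[r2 rr].
  rewrite (_ : [set th | _] = w r @^-1` [set x | lam < x])//.
  apply: open_comp; last exact: open_gt.
  move=> t _; apply: cw; rewrite (lt_trans rr)// andbT.
  by apply: le_trans r2.
pose N n := U n `&` `[0, 2 * pi].
have mN n : measurable (N n).
  by apply: measurableI; [exact: open_measurable|exact: measurable_itv].
have muN n : (mu (N n) <= (3 * C * e / lam)%:E)%E.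
  have [rho /andP[rrho rho1] Irho] := we _ (rn1 n).
  have rho01 : 0 <= rho < 1.
    rewrite rho1 andbT; apply: le_trans (ltW rrho).
    by rewrite subr_ge0 invf_le1// ler1n.
  have crho := cw _ rho01.
  have iW : mu.-integrable J (EFin \o w rho) by exact: continuous_segment_integrable.
  have locW : locally_integrable [set: R] (w rho \_ J).
    apply: open_integrable_locally; first exact: openT.
    rewrite -restrict_EFin; have [H _] := integrable_mkcond (mu := mu) (D := J) (EFin \o w rho) (measurable_itv _).
    exact: H iW.
  have lamC : 0 < lam / C by rewrite divr_gt0.
  have NHL : N n `<=` [set th | ((lam / C)%:E < HL_maximal (w rho \_ J) th)%E].
    move=> th [[r /= /andP[r2 rr] lw]]; rewrite /= in_itv/= => th02.
    have rrho' : r < rho < 1 by rewrite (lt_trans rr).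
    have := HC w r rho th cw w0 sw r2 rrho' th02.
    move=> /(lt_le_trans _) H; have {}H := H lam%:E; rewrite lte_fin in H.
    have := H lw; rewrite -lte_pdivrMl// -EFinM mulrC; exact.
  have mHL : measurable [set th | ((lam / C)%:E < HL_maximal (w rho \_ J) th)%E].
    rewrite -[X in measurable X]setTI; apply: emeasurable_fun_o_infty => //.
    exact: measurable_HL_maximal.
  (* The Hardy-Littlewood inequality at level lam / C supplies the factor 3 of the constant. *)
  apply: le_trans (le_trans _ (maximal_inequality locW lamC)) _.
    by apply: le_measure; [apply: mem_set; exact: mN|exact: mem_set|exact: NHL].
  have -> : (\int[mu]_(y in [set: R]) `|((w rho \_ J) y)%:E| =
     (segint (- pi) (3 * pi) (w rho))%:E)%E.
    rewrite segintE// [RHS]integral_mkcond; apply: eq_integral => y _.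
    rewrite !patchE; case: ifP => _; last by rewrite abse0.
    by rewrite /= ger0_norm.
  rewrite -EFinM lee_fin.
  have -> : 3 * C * e / lam = 3 / (lam / C) * e by field; rewrite !gt_eqF.
  by rewrite ler_wpM2l// divr_ge0// ltW.
exists (\bigcup_n N n); split.
- exact: bigcup_measurable.
(* The sets N n increase with the cap, so their common bound passes to the union. *)
- have Nlim := @nondecreasing_cvg_mu _ _ _ mu N mN (bigcup_measurable (fun n _ => mN n)).
  have /Nlim Nl : {homo N : n m / (n <= m)%N >-> (n <= m)%O}.
    move=> n m nm; apply/subsetPset => th [[r /= /andP[r2 rr] lw] th02]; split=> //.
    exists r => //=; rewrite r2 (lt_le_trans rr)//.
    by rewrite lerD2l lerN2 lef_pV2 ?posrE// ler_nat.
  rewrite -(cvg_lim _ Nl)//; apply: lime_le; first by apply/cvg_ex; eexists; exact: Nl.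
  by apply: nearW => n /=; exact: muN.
- move=> th r th02 /andP[r2 r1] lw.
  have [n rrn] : exists n, r < rn n.
    have r0 : 0 < 1 - r by rewrite subr_gt0.
    exists (Num.bound (1 - r)^-1); rewrite /rn ltrBrDr -ltrBrDl.
    rewrite -[ltRHS]invrK ltf_pV2 ?posrE ?invr_gt0//.
    apply: lt_le_trans (archi_boundP _) _; first by rewrite invr_ge0 ltW.
    by rewrite ler_nat; do 2 apply: leqW.
  exists n => //; split; last by rewrite /= in_itv.
  by exists r => //=; rewrite r2.
Qed.

End WeakType.

(** * Operators on Hilbert spaces *)

Section ComplexReal.
Variable R : realType.
Implicit Types (a b : R[i]) (x y : R).

Lemma cReM a b : complex.Re (a * b) = complex.Re a * complex.Re b - complex.Im a * complex.Im b.
Proof. by case: a b => ? ? []. Qed.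
Lemma cReD a b : complex.Re (a + b) = complex.Re a + complex.Re b.
Proof. by case: a b => ? ? []. Qed.
Lemma cReN a : complex.Re (- a) = - complex.Re a.
Proof. by case: a. Qed.
Lemma cReB a b : complex.Re (a - b) = complex.Re a - complex.Re b.
Proof. by case: a b => ? ? []. Qed.
Lemma cReConj a : complex.Re (Num.conj a) = complex.Re a.
Proof. by case: a. Qed.

Lemma complex_nnegE a : 0 <= a -> a = (complex.Re a)%:C.
Proof. by case: a => x y; rewrite lecE /= => /andP[/eqP -> _]. Qed.

Definition cabs a : R := complex.Re `|a|.

Lemma cabsE a : `|a| = (cabs a)%:C.
Proof. exact: complex_nnegE. Qed.
Lemma cabs_ge0 a : 0 <= cabs a.
Proof. by rewrite /cabs normc_def /= sqrtr_ge0. Qed.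
Lemma cabsM a b : cabs (a * b) = cabs a * cabs b.
Proof. by apply: (@complexI R); rewrite -cabsE normrM !cabsE rmorphM. Qed.
Lemma cabsX a n : cabs (a ^+ n) = cabs a ^+ n.
Proof. by apply: (@complexI R); rewrite -cabsE normrX !cabsE rmorphXn. Qed.
Lemma cabs_real x : cabs x%:C = `|x|.
Proof. by rewrite /cabs normc_def /= expr0n addr0 sqrtr_sqr. Qed.
Lemma cabs_lt1 a : (`|a| < 1) = (cabs a < 1).
Proof. by rewrite cabsE -(ltcR _ 1). Qed.
Lemma cabs_expi t : cabs (expi t : R[i]) = 1.
Proof. by rewrite /cabs normc_def /= cos2Dsin2 sqrtr1. Qed.

Lemma expiX t n : (expi t : R[i]) ^+ n = expi (n%:R * t).
Proof.
elim: n => [|n IH]; first by rewrite expr0 mul0r /expi cos0 sin0.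
rewrite exprS IH /expi -natr1 mulrDl mul1r addrC cosD sinD.
by apply/eqP; rewrite eq_complex /=; apply/andP; split; apply/eqP; ring.
Qed.
End ComplexReal.

(** * The real inner product and its estimates *)

Section HilbertReal.
Variables (R : realType) (V : hilbertType R).
Implicit Types (x y z : V) (a : R[i]) (t : R).

Lemma hdotDl x y z : hdot (x + y) z = hdot x z + hdot y z.
Proof. by have := hdotP 1 x y z; rewrite scale1r mul1r. Qed.
Lemma hdot0l z : hdot 0 z = 0.
Proof. by apply: (@addIr _ (hdot 0 z)); rewrite -hdotDl !add0r. Qed.
Lemma hdotZl a x z : hdot (a *: x) z = a * hdot x z.
Proof. by have := hdotP a x 0 z; rewrite addr0 hdot0l addr0. Qed.
Lemma hdotNl x z : hdot (- x) z = - hdot x z.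
Proof. by rewrite -scaleN1r hdotZl mulN1r. Qed.
Lemma hdotBl x y z : hdot (x - y) z = hdot x z - hdot y z.
Proof. by rewrite hdotDl hdotNl. Qed.
Lemma hdotDr x y z : hdot z (x + y) = hdot z x + hdot z y.
Proof. by rewrite hdotC hdotDl rmorphD /= -!hdotC. Qed.
Lemma hdotZr a x z : hdot z (a *: x) = Num.conj a * hdot z x.
Proof. by rewrite hdotC hdotZl rmorphM /= -hdotC. Qed.
Lemma hdotBr x y z : hdot z (x - y) = hdot z x - hdot z y.
Proof. by rewrite hdotC hdotBl rmorphB /= -!hdotC. Qed.
Lemma hdot0r z : hdot z 0 = 0.
Proof. by rewrite hdotC hdot0l rmorph0. Qed.

Lemma rnormE x : `|x| = (rnorm x)%:C.
Proof. exact: complex_nnegE. Qed.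
Lemma rnorm_ge0 x : 0 <= rnorm x.
Proof. by have := normr_ge0 x; rewrite rnormE lecE /= => /andP[]. Qed.
Lemma rnorm0 : rnorm (0 : V) = 0.
Proof. by rewrite /rnorm normr0. Qed.
Lemma rnorm0_eq0 x : rnorm x = 0 -> x = 0.
Proof. by move=> x0; apply: normr0_eq0; rewrite rnormE x0. Qed.
Lemma rnormN x : rnorm (- x) = rnorm x.
Proof. by rewrite /rnorm normrN. Qed.
Lemma rnormBC x y : rnorm (x - y) = rnorm (y - x).
Proof. by rewrite -rnormN opprB. Qed.
Lemma rnormD x y : rnorm (x + y) <= rnorm x + rnorm y.
Proof. by rewrite -lecR rmorphD /= -!rnormE ler_normD. Qed.
Lemma rnormB x y : rnorm (x - y) <= rnorm x + rnorm y.
Proof. by rewrite -(rnormN y) rnormD. Qed.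
Lemma rnormZ a x : rnorm (a *: x) = cabs a * rnorm x.
Proof. by apply: (@complexI R); rewrite -rnormE normrZ cabsE rnormE rmorphM. Qed.
Lemma rnorm_dist x y : `|rnorm x - rnorm y| <= rnorm (x - y).
Proof.
rewrite ler_norml; have := rnormD (x - y) y; rewrite subrK.
have := rnormD (y - x) x; rewrite subrK rnormBC => ? ?.
by apply/andP; split; lra.
Qed.

Lemma rnorm_sum n (F : 'I_n -> V) : rnorm (\sum_(k < n) F k) <= \sum_(k < n) rnorm (F k).
Proof.
elim/big_rec2: _ => [|k s x _ IH]; first by rewrite rnorm0.
by apply: le_trans (rnormD _ _) _; rewrite lerD2l.
Qed.

(** The real part turns estimates into real arithmetic; [hdot_Im] recovers the imaginary part by
    multiplying a vector by 'i. *)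
Definition rdot x y : R := complex.Re (hdot x y).

Lemma rdotC x y : rdot x y = rdot y x.
Proof. by rewrite /rdot hdotC cReConj. Qed.
Lemma rdotDl x y z : rdot (x + y) z = rdot x z + rdot y z.
Proof. by rewrite /rdot hdotDl cReD. Qed.
Lemma rdotDr x y z : rdot z (x + y) = rdot z x + rdot z y.
Proof. by rewrite !(rdotC z) rdotDl. Qed.
Lemma rdotBl x y z : rdot (x - y) z = rdot x z - rdot y z.
Proof. by rewrite /rdot hdotBl cReB. Qed.
Lemma rdotBr x y z : rdot z (x - y) = rdot z x - rdot z y.
Proof. by rewrite !(rdotC z) rdotBl. Qed.
Lemma rdot_suml n (F : 'I_n -> V) z : rdot (\sum_(k < n) F k) z = \sum_(k < n) rdot (F k) z.
Proof.
elim/big_rec2: _ => [|k s x _ <-]; first by rewrite /rdot hdot0l.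
by rewrite rdotDl.
Qed.
Lemma rdot_sumr n (F : 'I_n -> V) z : rdot z (\sum_(k < n) F k) = \sum_(k < n) rdot z (F k).
Proof. by rewrite rdotC rdot_suml; apply: eq_bigr => k _; rewrite rdotC. Qed.
Lemma rdotZl t x z : rdot (t%:C *: x) z = t * rdot x z.
Proof. by rewrite /rdot hdotZl cReM /= mul0r subr0. Qed.
Lemma rdotZr t x z : rdot z (t%:C *: x) = t * rdot z x.
Proof. by rewrite !(rdotC z) rdotZl. Qed.

Lemma hdot_rnorm x : hdot x x = (rnorm x ^+ 2)%:C.
Proof. by rewrite hdot_norm rnormE rmorphXn. Qed.
Lemma rdotxx x : rdot x x = rnorm x ^+ 2.
Proof. by rewrite /rdot hdot_rnorm. Qed.

Lemma sqr_rnormD x y : rnorm (x + y) ^+ 2 = rnorm x ^+ 2 + 2 * rdot x y + rnorm y ^+ 2.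
Proof. by rewrite -!rdotxx !rdotDl !rdotDr (rdotC y x); ring. Qed.
Lemma sqr_rnormB x y : rnorm (x - y) ^+ 2 = rnorm x ^+ 2 - 2 * rdot x y + rnorm y ^+ 2.
Proof. by rewrite -!rdotxx !rdotBl !rdotBr (rdotC y x); ring. Qed.

Lemma rdot_young x y : 2 * rdot x y <= rnorm x ^+ 2 + rnorm y ^+ 2.
Proof. by have := sqr_ge0 (rnorm (x - y)); rewrite sqr_rnormB; lra. Qed.

(** The squared norm of |v| u - |u| v is nonnegative; expanding it and dividing by 2 |u| |v| bounds
    the product from above, and -x gives the other sign. *)
Lemma rdot_CS x y : `|rdot x y| <= rnorm x * rnorm y.
Proof.
have CS u v : rdot u v <= rnorm u * rnorm v.
  have := sqr_ge0 (rnorm ((rnorm v)%:C *: u - (rnorm u)%:C *: v)).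
  rewrite sqr_rnormB rdotZl rdotZr !rnormZ !cabs_real !ger0_norm ?rnorm_ge0//.
  have [/rnorm0_eq0 ->|u0] := eqVneq (rnorm u) 0.
    by move=> _; rewrite /rdot hdot0l /= rnorm0 mul0r.
  have [/rnorm0_eq0 ->|v0] := eqVneq (rnorm v) 0.
    by move=> _; rewrite /rdot hdot0r /= rnorm0 mulr0.
  have p : 0 < 2 * (rnorm v * rnorm u) by rewrite !mulr_gt0// lt_neqAle eq_sym ?u0 ?v0 rnorm_ge0.
  move=> H; rewrite -subr_ge0 -(pmulr_rge0 _ p); apply: le_trans H _.
  by rewrite le_eqVlt; apply/orP; left; apply/eqP; ring.
rewrite ler_norml CS andbT lerNl.
by have := CS (- x) y; rewrite rnormN /rdot hdotNl cReN.
Qed.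

Lemma hdot_ext x y : (forall z, hdot z x = hdot z y) -> x = y.
Proof.
move=> xy; apply/eqP; rewrite -subr_eq0; apply/eqP/rnorm0_eq0/eqP.
by rewrite -sqrf_eq0 -rdotxx /rdot hdotBr xy subrr.
Qed.

Lemma hdot_Im x y : complex.Im (hdot x y) = - rdot ('i *: x) y.
Proof. by rewrite /rdot hdotZl; case: (hdot x y) => u v /=; ring. Qed.

Lemma rdot_i x y : rdot ('i *: x) y = - rdot x ('i *: y).
Proof. by rewrite /rdot hdotZl hdotZr; case: (hdot x y) => u v /=; ring. Qed.

Lemma cvg_rnorm (T : Type) (F : set_system T) {FF : Filter F} (f : T -> V) (l : V) :
  f @ F --> l <-> forall e : R, 0 < e -> \forall s \near F, rnorm (l - f s) <= e.
Proof.
split=> [/cvgrPdist_le fl e e0|fl].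
  have := fl e%:C; rewrite ltcR => /(_ e0); apply: filterS => t.
  by rewrite rnormE lecR.
apply/cvgrPdist_le => e e0; have e'0 : 0 < complex.Re e.
  by rewrite -ltcR -complex_nnegE// ltW.
have := fl _ e'0; apply: filterS => t.
by rewrite rnormE (complex_nnegE (ltW e0)) lecR.
Qed.

Lemma cvg_seq_unique (f : nat -> V) (l m : V) : f @ \oo --> l -> f @ \oo --> m -> l = m.
Proof. by move=> fl fm; rewrite -(cvg_lim (@norm_hausdorff _ _) fl) -(cvg_lim (@norm_hausdorff _ _) fm). Qed.

Lemma rnorm_complete (x : nat -> V) :
  (forall e : R, 0 < e -> exists N, forall n m, (N <= n)%N -> (N <= m)%N -> rnorm (x n - x m) <= e) ->
  exists l : V, x @ \oo --> l.
Proof.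
move=> xc; suff /cvg_ex[l xl] : cvg (x @ \oo) by exists l.
apply: cauchy_cvg; apply: (proj1 (cauchy_ballP _)) => // e e0.
have e'0 : 0 < complex.Re e by rewrite -ltcR -complex_nnegE// ltW.
have e2 : 0 < complex.Re e / 2 by rewrite divr_gt0.
have [N HN] := xc _ e2; rewrite near_map2.
exists ([set n | (N <= n)%N], [set n | (N <= n)%N]); first by split; exists N.
move=> [n m] /= [Nn Nm]; rewrite -ball_normE /= rnormE (complex_nnegE (ltW e0)) ltcR.
by apply: le_lt_trans (HN n m Nn Nm) _; rewrite ltr_pdivrMr// ltr_pMr// ltr1n.
Qed.

End HilbertReal.

Lemma le_rnorm (R : realType) (V W : hilbertType R) (x : V) (y : W) :
  (`|x| <= `|y|) = (rnorm x <= rnorm y).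
Proof. by rewrite !rnormE lecR. Qed.

Section Bounded.
Variable R : realType.
Implicit Types U V W : hilbertType R.

Lemma bop0 U V (A : bop U V) : A 0 = 0.
Proof. exact: linear0. Qed.
Lemma bopD U V (A : bop U V) x y : A (x + y) = A x + A y.
Proof. exact: linearD. Qed.
Lemma bopB U V (A : bop U V) x y : A (x - y) = A x - A y.
Proof. exact: linearB. Qed.
Lemma bopZ U V (A : bop U V) a x : A (a *: x) = a *: A x.
Proof. exact: linearZ. Qed.

Lemma bop_bounded U V (A : bop U V) : exists2 M : R, 0 < M &
  forall x, rnorm (A x) <= M * rnorm x.
Proof.
have /cvg_rnorm/(_ 1 ltr01) := @bop_continuous _ _ _ A 0.
rewrite linear0 => /nbhs_norm0P[e /= e0 He].
have e'0 : 0 < complex.Re e by rewrite -ltcR -complex_nnegE// ltW.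
pose c := complex.Re e / 2; have c0 : 0 < c by rewrite divr_gt0.
exists (c^-1) => [|x]; first by rewrite invr_gt0.
have [/rnorm0_eq0 ->|x0] := eqVneq (rnorm x) 0; first by rewrite linear0 !rnorm0 mulr0.
have xp : 0 < rnorm x by rewrite lt_neqAle eq_sym x0 rnorm_ge0.
have := He ((c / rnorm x)%:C *: x) _; rewrite /= sub0r rnormN linearZ /=.
have sc : cabs (c / rnorm x)%:C = c / rnorm x by rewrite cabs_real ger0_norm// divr_ge0 ?rnorm_ge0// ltW.
rewrite rnormE !rnormZ sc divfK// (complex_nnegE (ltW e0)) ltcR => H.
have {}H : c / rnorm x * rnorm (A x) <= 1.
  by apply: H; rewrite /c ltr_pdivrMr// ltr_pMr// ltr1n.
rewrite ler_pdivlMl//; apply: le_trans (_ : (c / rnorm x * rnorm (A x)) * rnorm x <= _).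
  by rewrite le_eqVlt; apply/orP; left; apply/eqP; field.
by rewrite -[leRHS]mul1r ler_wpM2r// rnorm_ge0.
Qed.

Lemma linear_bounded_continuous U V (f : U -> V) (M : R) : linear f ->
  (forall x, rnorm (f x) <= M * rnorm x) -> continuous f.
Proof.
move=> fl fM x; apply/cvg_rnorm => e e0.
have fB u v : f u - f v = f (u - v).
  have -> : u - v = -1 *: v + u by rewrite scaleN1r addrC.
  by rewrite fl scaleN1r addrC.
have [M0|M0] := lerP M 0.
  near=> y; rewrite fB; apply: le_trans (fM _) _; apply: le_trans (ltW e0).
  by rewrite mulr_le0_ge0// rnorm_ge0.
have /cvg_rnorm/(_ (e / M)) : (fun y : U => y) @ nbhs x --> x by exact: cvg_id.
rewrite divr_gt0// => /(_ isT); apply: filterS => y xy.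
by rewrite fB; apply: le_trans (fM _) _; rewrite mulrC -ler_pdivlMr.
Unshelve. all: by end_near. Qed.

Definition mk_bop U V (f : U -> V) (M : R) (fl : linear f)
  (fM : forall x, rnorm (f x) <= M * rnorm x) : bop U V :=
  Bop fl (linear_bounded_continuous fl fM).

Lemma cvg_bop U V (A : bop U V) (x : nat -> U) (l : U) :
  x @ \oo --> l -> (fun n => A (x n)) @ \oo --> A l.
Proof. by move=> xl; apply: continuous_cvg => //; exact: bop_continuous. Qed.

Lemma cvg_rdotl U (x : nat -> U) (l z : U) :
  x @ \oo --> l -> (fun n => rdot (x n) z) @ \oo --> rdot l z.
Proof.
move=> /cvg_rnorm xl; apply/cvgrPdist_le => e e0.
have z1 : 0 < rnorm z + 1 by rewrite ltr_wpDl ?rnorm_ge0.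
have := xl (e / (rnorm z + 1)); rewrite divr_gt0// => /(_ isT).
apply: filterS => n xn; rewrite -rdotBl; apply: le_trans (rdot_CS _ _) _.
apply: le_trans (_ : e / (rnorm z + 1) * rnorm z <= _).
  by rewrite ler_wpM2r// rnorm_ge0.
by rewrite mulrAC ler_pdivrMr// ler_wpM2l ?(ltW e0)// lerDl.
Qed.

Lemma cvg_rnormF (T : Type) (F : set_system T) {FF : Filter F} U (x : T -> U) (l : U) :
  x @ F --> l -> (fun n => rnorm (x n)) @ F --> rnorm l.
Proof.
move=> /cvg_rnorm xl; apply/cvgrPdist_le => e e0.
by have := xl e e0; apply: filterS => n; exact/le_trans/rnorm_dist.
Qed.

(* The representing vector minimizes |x|^2 - 2 Re phi(x). *)
Lemma riesz U (phi : U -> R[i]) (M : R) :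
  (forall a x y, phi (a *: x + y) = a * phi x + phi y) ->
  (forall x, `|complex.Re (phi x)| <= M * rnorm x) ->
  exists y, forall x, phi x = hdot x y.
Proof.
move=> phil phiM; pose rphi x := complex.Re (phi x).
have rphiD x y : rphi (x + y) = rphi x + rphi y.
  by rewrite /rphi -[x]scale1r phil scale1r mul1r cReD.
have phi0 : phi 0 = 0.
  by have := phil 1 0 0; rewrite scaler0 addr0 mul1r => H; apply: (@addIr _ (phi 0)); rewrite add0r -H.
have phiZ a x : phi (a *: x) = a * phi x by rewrite -[_ *: _]addr0 phil phi0 addr0.
have rphiZ (t : R) x : rphi (t%:C *: x) = t * rphi x.
  by rewrite /rphi phiZ cReM /= mul0r subr0.
pose J x := rnorm x ^+ 2 - 2 * rphi x.
(* From (|x| - M)^2 >= 0. *)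
have JM x : - M ^+ 2 <= J x.
  have := phiM x; rewrite ler_norml -/(rphi x) => /andP[_ H].
  by rewrite /J; have := sqr_ge0 (rnorm x - M); nra.
pose S := range J.
have infS : has_inf S.
  by split; [exists (J 0); exists 0|exists (- M ^+ 2) => _ [x _ <-]].
have Jinf x : inf S <= J x by apply: ge_inf; [case: infS|exists x].
have /choice[x xJ] n : exists x, J x <= inf S + n.+1%:R^-1.
  have e0 : 0 < n.+1%:R^-1 :> R by rewrite invr_gt0.
  by have [_ [x _ <-] /ltW] := inf_adherent e0 infS; exists x.
(* Parallelogram law, with J at the midpoint of a and b bounded below by inf S; it makes the
   minimizing sequence Cauchy. *)
have Jpar a b : rnorm (a - b) ^+ 2 <= 2 * J a + 2 * J b - 4 * inf S.
  have := Jinf (2^-1%:C *: (a + b)).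
  rewrite /J rphiZ rphiD rnormZ exprMn cabs_real ger0_norm// sqr_rnormD sqr_rnormB.
  have -> : (2^-1 : R) ^+ 2 = 4^-1 by field.
  lra.
have xdist n m : rnorm (x n - x m) ^+ 2 <= 2 * n.+1%:R^-1 + 2 * m.+1%:R^-1.
  move: (Jpar (x n) (x m)) (xJ n) (xJ m).
  move: (J (x n)) (J (x m)) (inf S) (n.+1%:R^-1) (m.+1%:R^-1) (rnorm _ ^+ 2) => *; lra.
have inv_small (e : R) : 0 < e -> exists N, forall n, (N <= n)%N -> n.+1%:R^-1 <= e.
  move=> e0; exists (Num.bound e^-1) => n Nn.
  rewrite -[leRHS]invrK lef_pV2 ?posrE ?invr_gt0//.
  apply: le_trans (ltW (archi_boundP _)) _; first by rewrite invr_ge0 ltW.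
  by rewrite ler_nat leqW.
have [|y xy] := rnorm_complete (x := x).
  move=> e e0; have e4 : 0 < e ^+ 2 / 4 by rewrite divr_gt0// exprn_gt0.
  have [N HN] := inv_small _ e4.
  exists N => n m /HN n4 /HN m4; rewrite -(@ler_pXn2r _ 2) ?nnegrE ?rnorm_ge0 ?(ltW e0)//.
  apply: le_trans (xdist _ _) _; move: n4 m4; move: (n.+1%:R^-1) (m.+1%:R^-1) => *; lra.
(* J (x_n + t z) >= inf S >= J (x_n) - 1/(n+1), in the limit. Choosing below the t that minimizes
   this quadratic forces its linear coefficient to vanish. *)
have main z (t : R) : 0 <= t ^+ 2 * rnorm z ^+ 2 + 2 * t * (rdot y z - rphi z).
  have L : (fun n => n.+1%:R^-1 + t ^+ 2 * rnorm z ^+ 2 + 2 * t * (rdot (x n) z - rphi z)) @ \oo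
     --> (0 : R) + t ^+ 2 * rnorm z ^+ 2 + 2 * t * (rdot y z - rphi z).
    apply: cvgD; first by apply: cvgD; [exact: cvg_harmonic|exact: cvg_cst].
    by apply: cvgM; [exact: cvg_cst|apply: cvgB; [exact: cvg_rdotl|exact: cvg_cst]].
  rewrite add0r in L; apply: ler_cvg_to (cvg_cst 0) L _; apply: nearW => n.
  have := Jinf (x n + t%:C *: z); have := xJ n.
  rewrite /J rphiD rphiZ sqr_rnormD rdotZr rnormZ cabs_real exprMn real_normK ?num_real//.
  move: (inf S) (n.+1%:R^-1) (rphi (x n)) (rphi z) (rnorm _ ^+ 2) (rnorm _ ^+ 2) (rdot _ _).
  by move=> *; lra.
have rE z : rdot y z = rphi z.
  have H := main z; set c := rdot y z - rphi z in H.
  suff : c = 0 by rewrite /c => /eqP; rewrite subr_eq0 => /eqP.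
  have [z0|z0] := eqVneq (rnorm z) 0.
    by have := H 1; have := H (-1); rewrite z0; lra.
  have zp : 0 < rnorm z ^+ 2 by rewrite exprn_gt0// lt_neqAle eq_sym z0 rnorm_ge0.
  have := H (- c / rnorm z ^+ 2).
  have -> : (- c / rnorm z ^+ 2) ^+ 2 * rnorm z ^+ 2 + 2 * (- c / rnorm z ^+ 2) * c =
    - (c ^+ 2 / rnorm z ^+ 2) by field.
  rewrite oppr_ge0 pmulr_lle0 ?invr_gt0// => c2.
  by apply/eqP; rewrite -sqrf_eq0 eq_le c2 sqr_ge0.
exists y => z; apply/eqP; rewrite eq_complex; apply/andP; split; apply/eqP.
  by rewrite -/(rphi z) -rE rdotC.
rewrite hdot_Im rdotC rE /rphi phiZ; case: (phi z) => u v /=; ring.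
Qed.

(** Bounded below and onto, so the pointwise inverse is linear and bounded by 1/c; since an inverse
    exists, [binv] selects one instead of its default. *)
Lemma binvP U (D : bop U U) (c : R) : 0 < c ->
  (forall v, c * rnorm v <= rnorm (D v)) -> (forall w, exists v, D v = w) ->
  forall v, binv D (D v) = v.
Proof.
move=> c0 Dc /choice[B DB] v.
have inj v1 v2 : D v1 = D v2 -> v1 = v2.
  move=> E; apply/eqP; rewrite -subr_eq0; apply/eqP/rnorm0_eq0/le_anti.
  rewrite rnorm_ge0 andbT -(pmulr_rle0 _ c0); apply: le_trans (Dc _) _.
  by rewrite bopB E subrr rnorm0.
have Bl : linear B.
  by move=> a x y; apply: inj; rewrite DB bopD bopZ !DB.
have BM w : rnorm (B w) <= c^-1 * rnorm w by rewrite ler_pdivlMl// -{2}(DB w).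
have ex : exists C : bop U U, C \ob D = bid /\ D \ob C = bid.
  by exists (mk_bop Bl BM); split; apply: bopP => w; [apply: inj|]; exact: DB.
have [CD _] := @xgetPex _ 0 [set C : bop U U | C \ob D = bid /\ D \ob C = bid] ex.
by rewrite -[LHS]/((binv D \ob D) v) [binv D \ob D]CD.
Qed.

End Bounded.

Section Adjoint.
Variable R : realType.
Implicit Types U V W : hilbertType R.

(** Riesz representation of x |-> (A x, v) yields the adjoint pointwise, and |B v|^2 = Re (A (B v),
    v) its boundedness. *)
Lemma adjP U V (A : bop U V) x y : hdot (A x) y = hdot x (adj A y).
Proof.
suff H : exists B : bop V U, forall x y, hdot (A x) y = hdot x (B y).
  by have := xgetPex (0 : bop V U) H; exact.
have [M M0 AM] := bop_bounded A.
have /choice[B AB] (v : V) : exists u, forall x, hdot (A x) v = hdot x u.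
  apply: (@riesz _ _ _ (M * rnorm v)) => [a x1 x2|x1].
    by rewrite linearP hdotP.
  apply: le_trans (rdot_CS _ _) _.
  by rewrite mulrAC ler_wpM2r ?rnorm_ge0.
have Bl : linear B.
  by move=> a v w; apply: hdot_ext => x1; rewrite -AB hdotDr hdotZr hdotDr hdotZr !AB.
have BM v : rnorm (B v) <= M * rnorm v.
  have [->|b0] := eqVneq (rnorm (B v)) 0; first by rewrite mulr_ge0 ?rnorm_ge0 ?ltW.
  have bp : 0 < rnorm (B v) by rewrite lt_neqAle eq_sym b0 rnorm_ge0.
  rewrite -(ler_pM2l bp) -expr2 -rdotxx /rdot -AB -/(rdot _ _).
  apply: le_trans (ler_norm _) _; apply: le_trans (rdot_CS _ _) _.
  by rewrite mulrA [rnorm (B v) * M]mulrC ler_wpM2r ?rnorm_ge0.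
by exists (mk_bop Bl BM).
Qed.

Lemma rdot_adj U V (A : bop U V) x y : rdot (A x) y = rdot x (adj A y).
Proof. by rewrite /rdot adjP. Qed.

Lemma contractiveP U V (A : bop U V) : contractive A <-> forall x, rnorm (A x) <= rnorm x.
Proof. by split=> H x; have := H x; rewrite le_rnorm. Qed.

Lemma adj_contractive U V (A : bop U V) : contractive A -> contractive (adj A).
Proof.
move=> /contractiveP A1; apply/contractiveP => y.
have [->|b0] := eqVneq (rnorm (adj A y)) 0; first exact: rnorm_ge0.
have bp : 0 < rnorm (adj A y) by rewrite lt_neqAle eq_sym b0 rnorm_ge0.
rewrite -(ler_pM2l bp) -expr2 -rdotxx -rdot_adj.
apply: le_trans (ler_norm _) _; apply: le_trans (rdot_CS _ _) _.
by rewrite ler_wpM2r ?rnorm_ge0.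
Qed.

End Adjoint.

(** * Positive square roots and defect operators *)

Section SquareRoot.
Variables (R : realType) (U : hilbertType R) (K : bop U U).
Hypothesis K_sym : forall x y, rdot (K x) y = rdot x (K y).
Hypothesis K_contr : forall x, rnorm (K x) <= rnorm x.

(* The square root of 1 - K is 1 - Y, where Y is the limit of the iteration
   Y <- (K + Y^2) / 2; the same iteration on scalars, with K = 1, dominates it
   in norm. *)
Let half : R[i] := (2^-1 : R)%:C.
Fixpoint sqrt_iter n : bop U U :=
  if n is n.+1 then half *: (K + sqrt_iter n \ob sqrt_iter n) else 0.
Fixpoint sqrt_iter_bound n : R :=
  if n is n.+1 then 2^-1 * (1 + sqrt_iter_bound n ^+ 2) else 0.
Notation Y := sqrt_iter.
Notation b := sqrt_iter_bound.

Let YS n x : Y n.+1 x = half *: (K x + Y n (Y n x)).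
Proof. by []. Qed.

Let rnorm_half (x : U) : rnorm (half *: x) = 2^-1 * rnorm x.
Proof. by rewrite rnormZ cabs_real ger0_norm. Qed.

Let b01 n : 0 <= b n <= 1.
Proof. by elim: n => [|n /andP[? ?]] /=; rewrite ?lexx ?ler01//; apply/andP; split; nra. Qed.

Let bS n : b n <= b n.+1.
Proof. by have := b01 n => /= /andP[? ?]; have := sqr_ge0 (1 - b n); nra. Qed.

Let Yb n x : rnorm (Y n x) <= b n * rnorm x.
Proof.
elim: n x => [|n IH] x; first by rewrite rnorm0 mul0r.
rewrite YS rnorm_half -mulrA ler_pM2l// mulrDl mul1r.
apply: le_trans (rnormD _ _) _; apply: lerD => //.
apply: le_trans (IH _) _; rewrite expr2 -mulrA ler_wpM2l//.
by case/andP: (b01 n).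
Qed.

(** With Y' the successor of Y, Y'^2 - Y^2 = Y' (Y' - Y) + (Y' - Y) Y holds without commutation; the
    scalar iteration obeys the same identity, so it dominates the differences by induction. *)
Let Ydist n x : rnorm (Y n.+1 x - Y n x) <= (b n.+1 - b n) * rnorm x.
Proof.
elim: n x => [|n IH] x; first by rewrite subr0 -[b 0]/0 subr0; exact: (Yb 1).
have -> : Y n.+2 x - Y n.+1 x =
    half *: (Y n.+1 (Y n.+1 x - Y n x) + (Y n.+1 (Y n x) - Y n (Y n x))).
  transitivity (half *: ((K x + Y n.+1 (Y n.+1 x)) - (K x + Y n (Y n x)))).
    by rewrite scalerBr.
  by congr (_ *: _); rewrite linearB opprD addrACA subrr add0r addrA subrK.
have -> : b n.+2 - b n.+1 = 2^-1 * (b n.+1 * (b n.+1 - b n) + (b n.+1 - b n) * b n).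
  rewrite -[b n.+2]/(2^-1 * (1 + b n.+1 ^+ 2)).
  by rewrite -[X in _ - X = _]/(2^-1 * (1 + b n ^+ 2)); ring.
rewrite rnorm_half -mulrA ler_pM2l// mulrDl.
have [/andP[b0 _] /andP[b0' _]] := (b01 n, b01 n.+1).
apply: le_trans (rnormD _ _) _; apply: lerD.
  by apply: le_trans (Yb _ _) _; rewrite -mulrA ler_wpM2l.
apply: le_trans (IH _) _; rewrite -mulrA ler_wpM2l//.
by rewrite subr_ge0.
Qed.

Let Ydist_le n k x : rnorm (Y (n + k)%N x - Y n x) <= (b (n + k)%N - b n) * rnorm x.
Proof.
elim: k => [|k IH]; first by rewrite addn0 !subrr rnorm0 mul0r.
rewrite addnS -(subrK (Y (n + k)%N x) (Y (n + k).+1 x)) -addrA.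
apply: le_trans (rnormD _ _) _; apply: le_trans (lerD (Ydist _ _) IH) _.
by rewrite -mulrDl subrKA.
Qed.

Let b_mono : {homo b : n m / (n <= m)%N >-> n <= m}.
Proof. by apply/nondecreasing_seqP. Qed.

Let bcvg : exists l : R, b @ \oo --> l.
Proof.
apply/cvg_ex/nondecreasing_is_cvgn; first exact: b_mono.
by exists 1 => _ [n _ <-]; case/andP: (b01 n).
Qed.

Let Ycvg (x : U) : exists l : U, (fun n => Y n x) @ \oo --> l.
Proof.
apply: rnorm_complete => e e0; have [l bl] := bcvg.
pose e' := e / (2 * (rnorm x + 1)).
have x1 : 0 < rnorm x + 1 by rewrite ltr_wpDl ?rnorm_ge0.
have e'0 : 0 < e' by rewrite divr_gt0// mulr_gt0.
move/cvgrPdist_le : bl => /(_ _ e'0) [N _ HN]; exists N.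
have key n m : (N <= n)%N -> (n <= m)%N -> rnorm (Y m x - Y n x) <= e.
  move=> Nn nm; rewrite -(subnKC nm); apply: le_trans (Ydist_le _ _ _) _; rewrite subnKC//.
  have := HN n Nn; have := HN m (leq_trans Nn nm).
  rewrite !ler_norml => /andP[? ?] /andP[? ?].
  apply: le_trans (_ : 2 * e' * (rnorm x + 1) <= _); last first.
    by rewrite le_eqVlt; apply/orP; left; apply/eqP; rewrite /e'; field; rewrite gt_eqF.
  apply: ler_pM; rewrite ?rnorm_ge0//; [|lra|lra].
  by rewrite subr_ge0; apply: b_mono.
move=> n m Nn Nm; have [nm|/ltnW mn] := leqP n m; last exact: key.
by rewrite rnormBC; exact: key.
Qed.

Let Ysym n x y : rdot (Y n x) y = rdot x (Y n y).
Proof.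
elim: n x y => [|n IH] x y; first by rewrite /rdot hdot0l hdot0r.
by rewrite !YS rdotZl rdotZr rdotDl rdotDr K_sym !IH.
Qed.

(** The limit L satisfies 2 L = K + L^2, which is (1 - L)^2 = 1 - K. Positivity of 1 - L follows
    from |L| <= 1 and from the symmetry of L, which makes (L x, x) real. *)
Lemma sqrt_exists : exists S : bop U U, bop_ge0 S /\ S \ob S = bid - K.
Proof.
have /choice[L HL] := Ycvg.
have Ll : linear L.
  move=> a x y; apply: cvg_seq_unique (HL _) _.
  under eq_fun do rewrite linearP.
  by apply: cvgD; [apply: cvgZl_tmp; exact: HL|exact: HL].
have Lb x : rnorm (L x) <= 1 * rnorm x.
  apply: ler_cvg_to (cvg_rnormF (HL x)) (cvg_cst _) _; apply: nearW => n.
  apply: le_trans (Yb _ _) _; rewrite ler_wpM2r ?rnorm_ge0//.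
  by case/andP: (b01 n).
pose LL := mk_bop Ll Lb.
have LLE : forall x, 2%:C *: L x = K x + L (L x).
  move=> x.
  have c1 : (fun n => 2%:C *: Y n.+1 x) @ \oo --> 2%:C *: L x.
    apply: cvgZl_tmp; have := HL x; rewrite -(cvg_shiftS (fun n => Y n x)); exact.
  apply: cvg_seq_unique c1 _; under eq_fun.
    move=> n; rewrite YS scalerA -rmorphM /= divff// scale1r; over.
  apply: cvgD; first exact: cvg_cst.
  apply/cvg_rnorm => e e0.
  have e2 : 0 < e / 2 by rewrite divr_gt0.
  have H1 := (cvg_rnorm _ _).1 (HL x) _ e2.
  have H2 := (cvg_rnorm _ _).1 (HL (L x)) _ e2.
  near=> n; rewrite -(subrK (Y n (L x)) (L (L x))) -addrA -linearB.
  apply: le_trans (rnormD _ _) _; rewrite [e]splitr lerD//; first by near: n; exact: H2.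
  apply: le_trans (Yb _ _) _; apply: le_trans (_ : 1 * rnorm (L x - Y n x) <= _).
    by rewrite ler_wpM2r ?rnorm_ge0//; case/andP: (b01 n).
  by rewrite mul1r; near: n; exact: H1.
have Lsym x y : rdot (L x) y = rdot x (L y).
  have c1 := @cvg_rdotl _ _ _ _ y (HL x); have c2 := @cvg_rdotl _ _ _ _ x (HL y).
  have : (fun n => rdot (Y n x) y) = (fun n => rdot (Y n y) x).
    by apply/funext => n; rewrite Ysym rdotC.
  move=> E; rewrite E in c1; rewrite [RHS]rdotC.
  by rewrite -(cvg_lim (@norm_hausdorff _ _) c1) -(cvg_lim (@norm_hausdorff _ _) c2).
exists (bid - LL); split.
  move=> x; have H : complex.Im (hdot (L x) x) = 0.
    suff E : rdot ('i *: L x) x = 0 by rewrite hdot_Im E oppr0.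
    have : rdot ('i *: L x) x = - rdot ('i *: L x) x.
      have LZ : L ('i *: x) = 'i *: L x by exact: (bopZ LL).
      by rewrite [X in _ = - X]rdot_i opprK -LZ Lsym rdotC.
    lra.
  have -> : hdot ((bid - LL) x) x = (rnorm x ^+ 2 - rdot (L x) x)%:C.
    have -> : (bid - LL) x = x - L x by [].
    have E : hdot (L x) x = (rdot (L x) x)%:C.
      by apply/eqP; rewrite eq_complex H /rdot /= !eqxx.
    by rewrite hdotBl hdot_rnorm E -rmorphB.
  rewrite lecR subr_ge0; apply: le_trans (ler_norm _) _; apply: le_trans (rdot_CS _ _) _.
  by rewrite expr2 ler_wpM2r ?rnorm_ge0//; have := Lb x; rewrite mul1r.
apply: bopP => x; have -> : ((bid - LL) \ob (bid - LL)) x = x - L x - L (x - L x) by [].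
have -> : (bid - K) x = x - K x by [].
have LB : L (x - L x) = L x - L (L x) by exact: (bopB LL).
have -> : K x = L x + L x - L (L x).
  by apply/eqP; rewrite eq_sym subr_eq -LLE rmorph_nat scaler_nat mulr2n.
by rewrite LB !opprD !opprK !addrA.
Unshelve. all: by end_near. Qed.

End SquareRoot.

Section Defect.
Variable R : realType.
Implicit Types U V : hilbertType R.

(** A nonnegative form takes real values; reality at 'i x, y and 'i x + y gives the symmetry. *)
Lemma bop_ge0_sym U (D : bop U U) : bop_ge0 D -> forall x y, rdot (D x) y = rdot x (D y).
Proof.
move=> D0 x y.
have Im0 z : complex.Im (hdot (D z) z) = 0.
  by have := D0 z; rewrite lecE => /andP[/eqP].
have := Im0 ('i *: x + y); have := Im0 ('i *: x); have := Im0 y.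
rewrite !(bopD D, bopZ D) !(hdotDl, hdotDr, hdotZl, hdotZr) (rdotC x) /rdot.
case: (hdot (D x) x) (hdot (D y) y) (hdot (D x) y) (hdot (D y) x) => a b [c d] [e f] [g h] /=.
lra.
Qed.

Lemma defect_spec U V (C : bop U V) : contractive C ->
  bop_ge0 (defect C) /\ defect C \ob defect C = bid - adj C \ob C.
Proof.
move=> C1; have [] := @sqrt_exists _ _ (adj C \ob C).
- by move=> x y; rewrite /= rdotC -rdot_adj rdotC rdot_adj.
- move=> x; apply: le_trans ((contractiveP _).1 (adj_contractive C1) _) _.
  exact: (contractiveP _).1.
move=> S HS; apply: (@xgetPex _ 0 [set B | bop_ge0 B /\ B \ob B = bid - adj C \ob C]).
by exists S.
Qed.

(** |D x|^2 = (D^2 x, x) by the symmetry of D. Conditions on defect operators become norm identities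
    in this way. *)
Lemma rnorm_defect U V (C : bop U V) x : contractive C ->
  rnorm (defect C x) ^+ 2 = rnorm x ^+ 2 - rnorm (C x) ^+ 2.
Proof.
move=> /defect_spec[D0 DD]; rewrite -rdotxx -(bop_ge0_sym D0).
have -> : defect C (defect C x) = x - adj C (C x).
  by rewrite -[LHS]/((defect C \ob defect C) x) DD.
by rewrite rdotBl [rdot (adj C _) _]rdotC -rdot_adj !rdotxx.
Qed.

End Defect.

(** * Vector-valued power series *)

Section GeometricTail.
Variables (R : realType) (U : hilbertType R).
Implicit Types (a x : nat -> U) (z : R[i]) (rho kappa M : R).

Definition psum a N z : U := \sum_(k < N) z ^+ k *: a k.

Lemma psumS a N z : psum a N.+1 z = psum a N z + z ^+ N *: a N.
Proof. by rewrite /psum big_ord_recr. Qed.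

Lemma is_taylor_psum f a : is_taylor f a <->
  forall z, cabs z < 1 -> (fun N => psum a N z) @ \oo --> f z.
Proof.
have E z : [series z ^+ n *: a n]_n = (fun N => psum a N z).
  by apply/funext => N; rewrite seriesEord.
by split=> H z; have := H z; rewrite cabs_lt1 E.
Qed.

Lemma geometric_sum_le kappa n : 0 <= kappa < 1 -> \sum_(k < n) kappa ^+ k <= (1 - kappa)^-1.
Proof.
move=> /andP[k0 k1]; have d0 : 0 < 1 - kappa by rewrite subr_gt0.
rewrite -[leRHS]mul1r ler_pdivlMr//.
have -> : (\sum_(k < n) kappa ^+ k) * (1 - kappa) = 1 - kappa ^+ n.
  elim: n => [|n IH]; first by rewrite big_ord0 mul0r expr0 subrr.
  by rewrite big_ord_recr /= mulrDl IH exprS; ring.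
by rewrite gerBl exprn_ge0.
Qed.

Lemma psum_tail a z kappa M : 0 <= kappa < 1 ->
  (forall k, cabs z ^+ k * rnorm (a k) <= M * kappa ^+ k) ->
  forall N k, rnorm (psum a (N + k) z - psum a N z) <= M / (1 - kappa) * kappa ^+ N.
Proof.
move=> k01 aM N k; have [k0 k1] := andP k01.
have M0 : 0 <= M by have := aM 0%N; rewrite !expr0 mul1r mulr1; apply: le_trans; exact: rnorm_ge0.
apply: le_trans (_ : \sum_(j < k) M * kappa ^+ N * kappa ^+ j <= _); last first.
  have -> : M / (1 - kappa) * kappa ^+ N = M * kappa ^+ N * (1 - kappa)^-1 by ring.
  by rewrite -mulr_sumr ler_wpM2l ?geometric_sum_le// mulr_ge0 ?exprn_ge0.
elim: k => [|k IH]; first by rewrite addn0 subrr rnorm0 big_ord0.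
rewrite addnS psumS addrAC big_ord_recr /=; apply: le_trans (rnormD _ _) _.
by apply: lerD => //; rewrite rnormZ cabsX -mulrA -exprD.
Qed.

(** Once the partial sums are within 1 of their limit, consecutive ones differ by at most 2; the
    finitely many earlier terms are added to the bound. *)
Lemma is_taylor_bound f a rho : is_taylor f a -> 0 <= rho < 1 ->
  exists2 M, 0 <= M & forall n, rho ^+ n * rnorm (a n) <= M.
Proof.
move=> /is_taylor_psum fa /andP[rho0 rho1].
have := fa rho%:C; rewrite cabs_real ger0_norm// => /(_ rho1) /cvg_rnorm /(_ 1 ltr01) [N _ HN].
have term n : (N <= n)%N -> rho ^+ n * rnorm (a n) <= 2.
  move=> Nn; have := HN n Nn; have := HN n.+1 (leqW Nn); rewrite /= psumS.
  set S := psum a n _; set l := f _ => h1 h2.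
  have -> : rho ^+ n * rnorm (a n) = rnorm ((l - S) - (l - (S + rho%:C ^+ n *: a n))).
    rewrite opprB addrC addrA subrK addrAC subrr add0r rnormZ cabsX cabs_real.
    by rewrite ger0_norm.
  by apply: le_trans (rnormB _ _) _; lra.
have pos k : 0 <= rho ^+ k * rnorm (a k) by rewrite mulr_ge0 ?exprn_ge0 ?rnorm_ge0.
exists (2 + \sum_(k < N) rho ^+ k * rnorm (a k)) => [|n].
  by rewrite addr_ge0// sumr_ge0.
have [Nn|nN] := leqP N n; first by rewrite (le_trans (term n Nn))// lerDl sumr_ge0.
rewrite (bigD1 (Ordinal nN)) //= addrCA lerDl addr_ge0// sumr_ge0//.
Qed.

(** Boundedness of the terms at the midpoint rho' of rho and 1 yields geometric decay with ratio rho
    / rho' on the smaller disc. The case N = 0 also bounds f there. *)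
Lemma is_taylor_tail f a rho : is_taylor f a -> 0 <= rho < 1 ->
  exists M kappa, [/\ 0 <= M, 0 <= kappa < 1 & forall z, cabs z <= rho -> forall N,
    rnorm (f z - psum a N z) <= M * kappa ^+ N].
Proof.
move=> fa /andP[rho0 rho1]; pose rho' := (1 + rho) / 2.
have r'0 : 0 < rho' by rewrite /rho'; lra.
have [|M M0 aM] := is_taylor_bound (rho := rho') fa; first by rewrite ltW//= /rho'; lra.
pose kappa := rho / rho'.
have k01 : 0 <= kappa < 1.
  by rewrite divr_ge0 ?(ltW r'0)//= ltr_pdivrMr// mul1r /rho'; lra.
exists (M / (1 - kappa)), kappa; split=> //.
  by rewrite divr_ge0// subr_ge0; case/andP: k01 => _ /ltW.
move=> z zrho N.
have zM k : cabs z ^+ k * rnorm (a k) <= M * kappa ^+ k.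
  apply: le_trans (_ : rho ^+ k * rnorm (a k) <= _).
    by rewrite ler_wpM2r ?rnorm_ge0// lerXn2r ?nnegrE ?cabs_ge0.
  rewrite /kappa expr_div_n mulrA ler_pdivlMr ?exprn_gt0//.
  by rewrite mulrC mulrCA mulrC ler_wpM2r ?exprn_ge0.
have z1 : cabs z < 1 by apply: le_lt_trans rho1.
have L := (is_taylor_psum _ _).1 fa z z1.
have c : (fun k => rnorm (psum a k z - psum a N z)) @ \oo --> rnorm (f z - psum a N z).
  by apply: cvg_rnormF; apply: cvgB => //; exact: cvg_cst.
apply: ler_cvg_to c (cvg_cst _) _; exists N => // k /= Nk.
by rewrite -(subnKC Nk); apply: psum_tail.
Qed.

Lemma is_taylor_exists a :
  (forall rho, 0 < rho < 1 -> exists M, forall n, rho ^+ n * rnorm (a n) <= M) ->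
  exists f, is_taylor f a.
Proof.
move=> aM.
have H z : exists l : U, cabs z < 1 -> (fun N => psum a N z) @ \oo --> l.
  have [z1|z1] := ltP (cabs z) 1; last by exists 0.
  pose rho' := (1 + cabs z) / 2; have z0 := cabs_ge0 z.
  have r'0 : 0 < rho' by rewrite /rho'; lra.
  have [|M {}aM] := aM rho'; first by rewrite r'0 /rho'; lra.
  pose kappa := cabs z / rho'.
  have k01 : 0 <= kappa < 1.
    by rewrite divr_ge0 ?(ltW r'0)//= ltr_pdivrMr// mul1r /rho'; lra.
  have zM k : cabs z ^+ k * rnorm (a k) <= M * kappa ^+ k.
    rewrite /kappa expr_div_n mulrA ler_pdivlMr ?exprn_gt0//.
    by rewrite mulrC mulrCA mulrC ler_wpM2r ?exprn_ge0.
  have tail := psum_tail k01 zM.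
  have [l lP] : exists l : U, (fun N => psum a N z) @ \oo --> l; last by exists l.
  apply: rnorm_complete => e e0.
  have c : (fun N => M / (1 - kappa) * kappa ^+ N) @ \oo --> M / (1 - kappa) * 0.
    apply: cvgMr; apply: cvg_expr; case/andP: k01 => k0 k1; by rewrite ger0_norm.
  rewrite mulr0 in c; have e2 : 0 < e / 2 by rewrite divr_gt0.
  move/cvgrPdist_le : c => /(_ _ e2) [N _ HN]; exists N => n m Nn Nm.
  have key k : (N <= k)%N -> rnorm (psum a k z - psum a N z) <= e / 2.
    move=> Nk; rewrite -(subnKC Nk); apply: le_trans (tail _ _) _.
    have := HN N (leqnn N); rewrite sub0r normrN; exact/le_trans/ler_norm.
  have -> : psum a n z - psum a m z = (psum a n z - psum a N z) - (psum a m z - psum a N z).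
    by rewrite opprB addrA subrK.
  by apply: le_trans (rnormB _ _) _; rewrite [e]splitr lerD// key.
have /choice[f Hf] := H; exists f; apply/is_taylor_psum => z; exact: Hf.
Qed.

End GeometricTail.

(** * Parseval's identity and subharmonicity *)

Section Parseval.
Variables (R : realType) (U : hilbertType R).
Implicit Types (a b : nat -> U) (rho t r th m e : R) (u v : U).

Definition polar rho t : R[i] := rho%:C * expi t.

Lemma cabs_polar rho t : 0 <= rho -> cabs (polar rho t) = rho.
Proof. by move=> r0; rewrite /polar cabsM cabs_real cabs_expi mulr1 ger0_norm. Qed.

Lemma polarX rho t n : polar rho t ^+ n = (rho ^+ n)%:C * expi (n%:R * t).
Proof. by rewrite /polar exprMn expiX rmorphXn. Qed.

Lemma rdot_expi s t u v : rdot (expi s *: u) (expi t *: v) =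
  rdot u v * cos (s - t) - complex.Im (hdot u v) * sin (s - t).
Proof.
rewrite /rdot hdotZl hdotZr cosB sinB; case: (hdot u v) => x y /=; ring.
Qed.

(** By induction on N: the new top term meets b (N - k) at frequency k, which yields 2 Re and - 2 Im
    of (b N, b (N - k)) as coefficients, and meets itself at frequency 0. The constant coefficient
    is thus the l^2 energy, which is Parseval's identity for polynomials. *)
Lemma trigsum_sqr_psum b N : exists al be : nat -> R,
  al 0%N = \sum_(k < N) rnorm (b k) ^+ 2 /\
  forall t, rnorm (psum b N (expi t)) ^+ 2 = trigsum al be N 1 t.
Proof.
elim: N => [|N [al [be [al0 IH]]]].
  exists (fun=> 0), (fun=> 0); split; first by rewrite big_ord0.
  by move=> t; rewrite /psum /trigsum !big_ord0 rnorm0 expr0n.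
pose h k := hdot (b N) (b (N - k)%N).
exists (fun k => (if (k < N)%N then al k else 0) +
   (if k == 0%N then rnorm (b N) ^+ 2 else 2 * complex.Re (h k))).
exists (fun k => (if (k < N)%N then be k else 0) +
   (if k == 0%N then 0 else - (2 * complex.Im (h k)))).
split.
  rewrite big_ord_recr /= -al0; case: N @h al0 IH => [|N] h //=.
  by rewrite big_ord0 => ->.
move=> t; pose c k := (if k == 0%N then rnorm (b N) ^+ 2 else 2 * complex.Re (h k)).
pose s k := (if k == 0%N then 0 else - (2 * complex.Im (h k))).
transitivity (trigsum (fun k => if (k < N)%N then al k else 0)
   (fun k => if (k < N)%N then be k else 0) N.+1 1 t + trigsum c s N.+1 1 t); last first.
  by rewrite /trigsum -big_split /=; apply: eq_bigr => k _; rewrite -mulrDr addrACA -!mulrDl.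
have -> : trigsum (fun k => if (k < N)%N then al k else 0)
   (fun k => if (k < N)%N then be k else 0) N.+1 1 t = trigsum al be N 1 t.
  rewrite /trigsum big_ord_recr /= ltnn !mul0r addr0 mulr0 addr0.
  by apply: eq_bigr => k _; rewrite ltn_ord.
rewrite psumS sqr_rnormD IH -addrA; congr (_ + _).
rewrite /trigsum big_ord_recl /= mul0r cos0 sin0 expr0 mul1r mulr0 addr0 mulr1 addrC.
rewrite {1}expiX rnormZ cabs_expi mul1r; congr (_ + _).
(* Reversing the sum makes its index the frequency, up to a shift by one for the frequency 0 already
   split off. *)
rewrite rdotC /psum (reindex_inj rev_ord_inj) /=.
rewrite rdot_sumr.
rewrite mulr_sumr; apply: eq_bigr => j _.
rewrite /bump /= add1n !expiX rdot_expi expr1n mul1r.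
have -> : N%:R * t - (N - j.+1)%:R * t = j.+1%:R * t :> R.
  by rewrite natrB//; ring.
by rewrite /c /s /= /rdot /h; ring.
Qed.

Lemma psum_polar a N rho t :
  psum a N (polar rho t) = psum (fun k => (rho ^+ k)%:C *: a k) N (expi t).
Proof. by apply: eq_bigr => k _; rewrite polarX expiX mulrC scalerA. Qed.

Lemma continuous_psum_sqr a N rho :
  continuous (fun t => rnorm (psum a N (polar rho t)) ^+ 2).
Proof.
have [al [be [_ E]]] := trigsum_sqr_psum (fun k => (rho ^+ k)%:C *: a k) N.
under eq_fun do rewrite psum_polar E.
exact: continuous_trigsum.
Qed.

Lemma parseval_psum a N rho c n : (0 < n)%N -> 0 <= rho ->
  segint c (c + 2 * pi * n%:R) (fun t => rnorm (psum a N (polar rho t)) ^+ 2) =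
  2 * pi * n%:R * \sum_(k < N) (rho ^+ k * rnorm (a k)) ^+ 2.
Proof.
move=> n0 rho0.
have [al [be [al0 E]]] := trigsum_sqr_psum (fun k => (rho ^+ k)%:C *: a k) N.
under [X in segint _ _ X]eq_fun do rewrite psum_polar E.
case: N al0 E => [|N] al0 E.
  rewrite big_ord0 mulr0 (_ : @trigsum R al be 0%N 1 = (fun=> 0)); last first.
    by apply/funext => t; rewrite /trigsum big_ord0.
  by rewrite segint_cst ?mul0r// lerDl !mulr_ge0 ?pi_ge0.
rewrite segint_trigsum// al0 mulrC; congr (_ * _); apply: eq_bigr => k _.
by rewrite rnormZ cabs_real ger0_norm ?exprn_ge0.
Qed.

Section Taylor.
Variables (G : R[i] -> U) (a : nat -> U).
Hypothesis Ga : is_taylor G a.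

Lemma harmonic_rdot u : disc_harmonic (fun rho t => rdot (G (polar rho t)) u)
  (fun k => rdot (a k) u) (fun k => - complex.Im (hdot (a k) u)).
Proof.
move=> rho rho01 e e0; have [rho0 rho1] := andP rho01.
have [M [kappa [M0 /andP[k0 k1] tail]]] := is_taylor_tail Ga rho01.
have c : (fun N => M * kappa ^+ N * rnorm u) @ \oo --> M * 0 * rnorm u.
  by apply: cvgMl; apply: cvgMr; apply: cvg_expr; rewrite ger0_norm.
rewrite mulr0 mul0r in c; move/cvgrPdist_le : c => /(_ _ e0).
apply: filterS => N; rewrite sub0r normrN => HN t.
have -> : trigsum (fun k => rdot (a k) u) (fun k => - complex.Im (hdot (a k) u)) N rho t =
   rdot (psum a N (polar rho t)) u.
  rewrite /psum rdot_suml.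
  apply: eq_bigr => k _; rewrite polarX -scalerA rdotZl /rdot hdotZl.
  by congr (_ * _); case: (hdot (a k) u) => x y /=; ring.
rewrite -rdotBl; apply: le_trans (rdot_CS _ _) _; apply: le_trans (le_trans _ HN); last first.
  exact: ler_norm.
by rewrite ler_wpM2r ?rnorm_ge0// tail// cabs_polar.
Qed.

Let sqr_diff u v : `|rnorm u ^+ 2 - rnorm v ^+ 2| <= rnorm (u - v) * (2 * rnorm u + rnorm (u - v)).
Proof.
have d := rnorm_dist u v; have := rnorm_ge0 u; have := rnorm_ge0 v => v0 u0.
have -> : rnorm u ^+ 2 - rnorm v ^+ 2 = (rnorm u - rnorm v) * (rnorm u + rnorm v) by ring.
rewrite normrM ler_pM// ger0_norm ?addr_ge0//.
by move: d; rewrite ler_norml => /andP[? ?]; lra.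
Qed.

Lemma psum_sqr_uniform rho e : 0 <= rho < 1 -> 0 < e ->
  \forall N \near \oo, forall t,
    `|rnorm (G (polar rho t)) ^+ 2 - rnorm (psum a N (polar rho t)) ^+ 2| <= e.
Proof.
move=> rho01 e0; have [rho0 rho1] := andP rho01.
have [M [kappa [M0 /andP[k0 k1] tail]]] := is_taylor_tail Ga rho01.
have c : (fun N => M * kappa ^+ N * (2 * M + M * kappa ^+ N)) @ \oo --> M * 0 * (2 * M + M * 0).
  have ck : (fun N => M * kappa ^+ N) @ \oo --> M * 0.
    by apply: cvgMr; apply: cvg_expr; rewrite ger0_norm.
  by apply: cvgM => //; apply: cvgD => //; exact: cvg_cst.
rewrite mulr0 mul0r in c; move/cvgrPdist_le : c => /(_ _ e0).
apply: filterS => N; rewrite sub0r normrN => HN t.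
have tl := tail (polar rho t) _; rewrite cabs_polar// in tl; have {}tl := tl (lexx _).
have gM : rnorm (G (polar rho t)) <= M.
  by have := tl 0%N; rewrite expr0 mulr1 /psum big_ord0 subr0.
apply: le_trans (sqr_diff _ _) _; apply: le_trans (le_trans _ HN); last exact: ler_norm.
by apply: ler_pM; rewrite ?rnorm_ge0 ?addr_ge0 ?mulr_ge0 ?rnorm_ge0// lerD// ler_wpM2l.
Qed.

Lemma continuous_sqr rho : 0 <= rho < 1 ->
  continuous (fun t => rnorm (G (polar rho t)) ^+ 2).
Proof.
move=> rho01 t; apply/cvgrPdist_le => e e0; have e3 : 0 < e / 3 by rewrite divr_gt0.
have [N _ hN] := psum_sqr_uniform rho01 e3.
have /cvgrPdist_le/(_ _ e3) := @continuous_psum_sqr a N rho t.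
apply: filterS => u /=; have := hN N (leqnn N) t; have := hN N (leqnn N) u.
move: (rnorm (G _) ^+ 2) (rnorm (G _) ^+ 2) (rnorm (psum _ _ _) ^+ 2) (rnorm (psum _ _ _) ^+ 2).
by clear hN => v w x y; rewrite !ler_norml => /andP[? ?] /andP[? ?] /andP[? ?]; apply/andP; split; lra.
Qed.

(** A limit of finite sums rather than an infinite series; it is applied through its one-sided
    consequences [bessel] and [parseval_le]. *)
Lemma parseval rho c n : (0 < n)%N -> 0 <= rho < 1 ->
  (fun N => 2 * pi * n%:R * \sum_(k < N) (rho ^+ k * rnorm (a k)) ^+ 2) @ \oo -->
  segint c (c + 2 * pi * n%:R) (fun t => rnorm (G (polar rho t)) ^+ 2).
Proof.
move=> n0 rho01; have [rho0 rho1] := andP rho01.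
have L0 : 0 < 2 * pi * n%:R :> R by rewrite !mulr_gt0 ?pi_gt0 ?ltr0n.
apply/cvgrPdist_le => e e0.
have e3 : 0 < e / (2 * pi * n%:R) by rewrite divr_gt0.
have := psum_sqr_uniform rho01 e3; apply: filterS => N HN.
rewrite -(parseval_psum a N c n0 rho0).
apply: le_trans (segint_uniform _ _ _ HN) _.
- by rewrite lerDl ltW.
- exact: continuous_sqr.
- exact: continuous_psum_sqr.
- by rewrite addrAC subrr add0r divfK ?gt_eqF.
Qed.

Lemma bessel N rho c n : (0 < n)%N -> 0 <= rho < 1 ->
  2 * pi * n%:R * \sum_(k < N) (rho ^+ k * rnorm (a k)) ^+ 2 <=
  segint c (c + 2 * pi * n%:R) (fun t => rnorm (G (polar rho t)) ^+ 2).
Proof.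
move=> n0 rho01.
apply: ler_cvg_to (cvg_cst _) (@parseval rho c n n0 rho01) _; exists N => // M /= NM.
rewrite ler_wpM2l ?mulr_ge0 ?pi_ge0// -(subnKC NM) big_split_ord /= lerDl.
by apply: sumr_ge0 => k _; rewrite sqr_ge0.
Qed.

Lemma parseval_le m rho c n : (0 < n)%N -> 0 <= rho < 1 ->
  (forall N, \sum_(k < N) rnorm (a k) ^+ 2 <= m) ->
  segint c (c + 2 * pi * n%:R) (fun t => rnorm (G (polar rho t)) ^+ 2) <= 2 * pi * n%:R * m.
Proof.
move=> n0 rho01 am; have [rho0 rho1] := andP rho01.
apply: ler_cvg_to (@parseval rho c n n0 rho01) (cvg_cst _) _; apply: nearW => N.
rewrite ler_wpM2l ?mulr_ge0 ?pi_ge0//; apply: le_trans (am N).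
apply: ler_sum => k _; rewrite exprMn ler_piMl ?sqr_ge0// -exprM.
by rewrite exprn_ile1// ltW.
Qed.

(** With v the value at the point in question, Re (G, v) is harmonic with value |v|^2 there, and 2
    Re (G, v) <= |G|^2 + |v|^2; averaging against the kernel, of mass 2 pi, leaves one |v|^2 on the
    left. *)
Lemma subpoisson_sqr : subpoisson (fun rho t => rnorm (G (polar rho t)) ^+ 2).
Proof.
move=> r rho th r01 rho01; set v := G (polar (r * rho) th).
have H := poisson_harmonic (harmonic_rdot v) th r01 rho01.
have c1 := @continuous_poisson R r th r01; have c2 := continuous_sqr rho01.
have c3 := harmonic_continuous (harmonic_rdot v) rho01.
have H1 : segint (th - pi) (th + pi) (fun t => poisson r (t - th)) = 2 * pi.
  have := @poisson_trig R r th r01 0 1 0.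
  have -> : r ^+ 0 * (1 * cos (0%:R * th) + 0 * sin (0%:R * th)) = 1 :> R.
    by rewrite expr0 !mul0r cos0 addr0 !mulr1.
  rewrite mulr1 => <-.
  by congr segint; apply/funext => t; rewrite mul0r cos0 mul1r mul0r addr0 mulr1.
have : segint (th - pi) (th + pi) (fun t => 2 * (poisson r (t - th) * rdot (G (polar rho t)) v))
   <= segint (th - pi) (th + pi) (fun t => poisson r (t - th) * rnorm (G (polar rho t)) ^+ 2
        + rnorm v ^+ 2 * poisson r (t - th)).
  apply: le_segint.
  - by move=> t; apply: cvgM; [exact: cvg_cst|apply: cvgM; [exact: c1|exact: c3]].
  - by move=> t; apply: cvgD; (apply: cvgM; [|]); [exact: c1|exact: c2|exact: cvg_cst|exact: c1].
  - move=> t _; have := poisson_ge0 (t - th) r01; have := rdot_young (G (polar rho t)) v.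
    by nra.
rewrite segintZ; last by move=> t; apply: cvgM; [exact: c1|exact: c3].
rewrite H segintD; last 2 first.
- by move=> t; apply: cvgM; [exact: c1|exact: c2].
- by move=> t; apply: cvgM; [exact: cvg_cst|exact: c1].
by rewrite segintZ// H1 rdotxx; lra.
Qed.

End Taylor.

Lemma subpoisson_abs (h : R -> R -> R) al be : disc_harmonic h al be ->
  subpoisson (fun rho t => `|h rho t|).
Proof.
move=> hh r rho th r01 rho01.
have -> : 2 * pi * `|h (r * rho) th| = `|2 * pi * h (r * rho) th|.
  by rewrite normrM [`|2 * pi|]ger0_norm// mulr_ge0 ?pi_ge0.
rewrite -(poisson_harmonic hh)//.
have cP : continuous (fun t => poisson r (t - th) * h rho t).
  by move=> t; apply: cvgM; [exact: continuous_poisson|exact: (harmonic_continuous hh)].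
apply: le_trans (segint_norm_le _ _ cP) _; rewrite le_eqVlt; apply/orP; left; apply/eqP.
by congr segint; apply/funext => t; rewrite normrM ger0_norm ?poisson_ge0.
Qed.

End Parseval.

(** * Radial limits *)

Section RadialApproximation.
Variables (R : realType) (U : hilbertType R).
Variables (G : R[i] -> U) (a : nat -> U) (p : R -> R -> R) (al be : nat -> R).
Hypothesis Ga : is_taylor G a.
Hypothesis harm_p : disc_harmonic p al be.
Hypothesis pG : forall rho t, 0 <= rho < 1 -> rnorm (G (polar rho t)) ^+ 2 <= p rho t.
Implicit Types (rho t e : R).
Local Notation mu := (@lebesgue_measure R).
Local Notation m := (al 0%N).

Lemma near_left1 (r : R) : r < 1 -> \forall rho \near (1 : R)^'-, r < rho < 1.
Proof.
by move=> r1; near=> rho; apply/andP; split; near: rho; [exact: nbhs_left_gt|exact: nbhs_left_lt].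
Unshelve. all: by end_near. Qed.

Lemma near_left01 : \forall rho \near (1 : R)^'-, 0 <= rho < 1.
Proof. by have := near_left1 ltr01; apply: filterS => rho /andP[/ltW -> ->]. Qed.

Lemma cvg_exprn_left1 (k : nat) : (fun rho : R => rho ^+ k) @ 1^'- --> (1 : R).
Proof.
by have := @cvg_at_left_filter _ _ _ _ _ (@exprn_continuous R k 1); rewrite expr1n.
Qed.

Lemma cvg_sum_left1 N (f : nat -> R -> R) (l : nat -> R) :
  (forall k, f k @ 1^'- --> l k) ->
  (fun rho => \sum_(k < N) f k rho) @ (1 : R)^'- --> \sum_(k < N) l k.
Proof.
move=> fl; elim: N => [|N IH].
  by under eq_fun do rewrite big_ord0; rewrite big_ord0; exact: cvg_cst.
under eq_fun do rewrite big_ord_recr /=.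
by rewrite big_ord_recr; apply: cvgD.
Qed.

Lemma cvg_trigsum_left1 (al' be' : nat -> R) N t :
  (fun rho => trigsum al' be' N rho t) @ (1 : R)^'- --> trigsum al' be' N 1 t.
Proof.
apply: (@cvg_sum_left1 N (fun k rho => rho ^+ k * (al' k * cos (k%:R * t) + be' k * sin (k%:R * t)))
  (fun k => 1 ^+ k * (al' k * cos (k%:R * t) + be' k * sin (k%:R * t)))) => k.
by rewrite expr1n; apply: cvgMl; exact: cvg_exprn_left1.
Qed.

(** Bessel on the circle of radius rho, the bound |G|^2 <= p and the mean value m of p, then rho ->
    1. *)
Lemma coef_sum_le N : \sum_(k < N) rnorm (a k) ^+ 2 <= m.
Proof.
have c : (fun rho => \sum_(k < N) (rho ^+ k * rnorm (a k)) ^+ 2) @ (1 : R)^'- -->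
    \sum_(k < N) rnorm (a k) ^+ 2.
  apply: (@cvg_sum_left1 N (fun k rho => (rho ^+ k * rnorm (a k)) ^+ 2) (fun k => rnorm (a k) ^+ 2)) => k.
  under eq_fun do rewrite exprMn -exprM.
  have H : (fun rho : R => rho ^+ (k * 2) * rnorm (a k) ^+ 2) @ 1^'- --> 1 * rnorm (a k) ^+ 2.
    by apply: cvgMl; exact: cvg_exprn_left1.
  by rewrite mul1r in H.
apply: ler_cvg_to c (cvg_cst _) _; have := near_left01; apply: filterS => rho rho01.
have pi2 : 0 < 2 * pi * 1%:R :> R by rewrite mulr1 mulr_gt0 ?pi_gt0.
rewrite -(ler_pM2l pi2); apply: le_trans (bessel Ga N 0 (n := 1) isT rho01) _.
rewrite [leRHS]mulrC -(@segint_harmonic _ _ _ _ harm_p rho 0 1)//.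
apply: le_segint; [exact: (continuous_sqr Ga)|exact: (harmonic_continuous harm_p)|].
by move=> t _; exact: pG.
Qed.

Section Isometric.
(** Together with [coef_sum_le], this says that the l^2 energy of the coefficients is exactly m. *)
Hypothesis iso : forall e, 0 < e -> exists N, m - e <= \sum_(k < N) rnorm (a k) ^+ 2.

Lemma is_taylor_remainder N : is_taylor (fun z => G z - psum a N z)
  (fun k => if (k < N)%N then 0 else a k).
Proof.
apply/is_taylor_psum => z z1.
have c : (fun M => psum a M z - psum a N z) @ \oo --> G z - psum a N z.
  by apply: cvgB; [exact: (is_taylor_psum _ _).1|exact: cvg_cst].
apply: cvg_trans c; apply: near_eq_cvg; exists N => // M /= NM.
rewrite -(subnKC NM) /psum !big_split_ord /= addrAC subrr add0r.
rewrite [X in _ = X + _]big1 ?add0r; last by move=> k _; rewrite ltn_ord scaler0.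
by apply: eq_bigr => k _; rewrite ltnNge leq_addr.
Qed.

Let remainder_coef N M : \sum_(k < M) rnorm (if (k < N)%N then 0 else a k) ^+ 2 <=
  m - \sum_(k < N) rnorm (a k) ^+ 2.
Proof.
rewrite lerBrDl; apply: le_trans (coef_sum_le (N + M)).
rewrite big_split_ord /= lerD2l.
apply: le_trans (_ : \sum_(k < N + M) rnorm (if (k < N)%N then 0 else a k) ^+ 2 <= _).
  by rewrite addnC big_split_ord /= lerDl; apply: sumr_ge0 => k _; rewrite sqr_ge0.
rewrite big_split_ord /= big1 ?add0r; last by move=> k _; rewrite ltn_ord rnorm0 expr0n.
by apply: ler_sum => k _; rewrite ltnNge leq_addr.
Qed.

(** Young's inequality 2 y d <= tau y^2 + d^2 / tau for the cross term; tau trades a small multiple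
    of a bounded energy against a large multiple of a tiny one. *)
Let sqr_diff (u v : U) (tau : R) : 0 < tau ->
  `|rnorm u ^+ 2 - rnorm v ^+ 2| <= tau * rnorm v ^+ 2 + (1 + tau^-1) * rnorm (u - v) ^+ 2.
Proof.
move=> tau0; have := rnorm_dist u v; have := rnorm_ge0 u; have := rnorm_ge0 v.
set x := rnorm u; set y := rnorm v; set d := rnorm (u - v) => y0 x0 xyd.
have -> : x ^+ 2 - y ^+ 2 = (x - y) * (2 * y + (x - y)) by ring.
have d0 : 0 <= d by exact: rnorm_ge0.
rewrite normrM; apply: le_trans (_ : d * (2 * y + d) <= _).
  apply: ler_pM => //; apply: le_trans (ler_normD _ _) _.
  by rewrite (ger0_norm (_ : 0 <= 2 * y)) ?mulr_ge0// lerD2l.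
have : 0 <= tau^-1 * (tau * y - d) ^+ 2 by rewrite mulr_ge0 ?sqr_ge0// invr_ge0 ltW.
have -> : tau^-1 * (tau * y - d) ^+ 2 = tau * y ^+ 2 - 2 * y * d + tau^-1 * d ^+ 2.
  by field; rewrite gt_eqF.
lra.
Qed.

(** The squared norm of a polynomial need not be harmonic; it is compared with the harmonic
    extension of its boundary values. The two agree at rho = 1, and both move away from there by at
    most quantities built from sums of |rho^k - 1| times coefficients, uniformly in t. *)
Lemma trig_uniform (al' be' : nat -> R) N (tau : R) : 0 < tau ->
  (forall t, rnorm (psum a N (expi t)) ^+ 2 = trigsum al' be' N 1 t) ->
  \forall rho \near (1 : R)^'-, forall t,
    `|rnorm (psum a N (polar rho t)) ^+ 2 - trigsum al' be' N rho t| <= tau.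
Proof.
move=> tau0 E.
pose c1 rho := \sum_(k < N) `|rho ^+ k - 1| * (`|al' k| + `|be' k|).
pose c2 rho := \sum_(k < N) `|rho ^+ k - 1| * rnorm (a k).
pose A := \sum_(k < N) rnorm (a k).
have lim0 (w : nat -> R) : (fun rho => \sum_(k < N) `|rho ^+ k - 1| * w k) @ (1 : R)^'- --> (0 : R).
  have := @cvg_sum_left1 N (fun k rho => `|rho ^+ k - 1| * w k) (fun k => 0 * w k).
  rewrite big1; last by move=> k _; rewrite mul0r.
  apply=> k.
  apply: cvgMl; have := @cvg_norm _ _ _ _ _ _ _ (cvgB (cvg_exprn_left1 k) (cvg_cst (1 : R))).
  by rewrite subrr normr0; apply.
have L : (fun rho => c1 rho + c2 rho * (2 * A + c2 rho)) @ (1 : R)^'- --> (0 : R) + 0 * (2 * A + 0).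
  apply: cvgD; first exact: (lim0 (fun k => `|al' k| + `|be' k|)).
  apply: cvgM; first exact: (lim0 (fun k => rnorm (a k))).
  by apply: cvgD; [exact: cvg_cst|exact: (lim0 (fun k => rnorm (a k)))].
rewrite mul0r addr0 in L; move/cvgrPdist_le : L => /(_ _ tau0).
apply: filterS => rho; rewrite sub0r normrN => /(le_trans (ler_norm _)) H t.
have h1 : `|trigsum al' be' N 1 t - trigsum al' be' N rho t| <= c1 rho.
  rewrite /trigsum -sumrB; apply: le_trans (ler_norm_sum _ _ _) _; apply: ler_sum => k _.
  rewrite -mulrBl expr1n normrM distrC ler_wpM2l//.
  apply: le_trans (ler_normD _ _) _; rewrite !normrM.
  by apply: lerD; rewrite ler_piMr// ?cos_max ?sin_max.
have h2 : rnorm (psum a N (polar rho t) - psum a N (expi t)) <= c2 rho.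
  rewrite /psum -sumrB; apply: le_trans (rnorm_sum _) _; apply: ler_sum => k _.
  rewrite polarX expiX -scalerBl -[X in _ - X]mul1r -mulrBl -(rmorphB _ _ 1) rnormZ cabsM.
  by rewrite cabs_real cabs_expi mulr1.
have h3 : rnorm (psum a N (expi t)) <= A.
  rewrite /psum; apply: le_trans (rnorm_sum _) _; apply: ler_sum => k _.
  by rewrite expiX rnormZ cabs_expi mul1r.
have dd := rnorm_dist (psum a N (polar rho t)) (psum a N (expi t)).
have -> : rnorm (psum a N (polar rho t)) ^+ 2 - trigsum al' be' N rho t =
  (rnorm (psum a N (polar rho t)) ^+ 2 - rnorm (psum a N (expi t)) ^+ 2) +
  (trigsum al' be' N 1 t - trigsum al' be' N rho t) by rewrite E addrA subrK.
apply: le_trans (ler_normD _ _) _; apply: le_trans H; rewrite addrC; apply: lerD => //.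
move: h2 h3 dd (rnorm_ge0 (psum a N (polar rho t))) (rnorm_ge0 (psum a N (expi t))).
move: (rnorm (psum _ _ (polar _ _))) (rnorm (psum _ _ (expi _))) (rnorm (_ - _)).
move=> x y d h2 h3 dd x0 y0.
have -> : x ^+ 2 - y ^+ 2 = (x - y) * (2 * y + (x - y)) by ring.
rewrite normrM; apply: ler_pM => //; first exact: le_trans h2.
apply: le_trans (ler_normD _ _) _; rewrite ger0_norm ?mulr_ge0//.
by apply: lerD; [rewrite ler_pM2l|exact: le_trans h2].
Qed.

Let L : R := 4 * pi.
Let L0 : 0 < L. Proof. by rewrite mulr_gt0// pi_gt0. Qed.
Let LE : 3 * pi = - pi + 2 * pi * 2%:R :> R. Proof. by ring. Qed.
Let LE' : 2 * pi * 2%:R = L. Proof. by rewrite /L; ring. Qed.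
Let le_pi : - pi <= 3 * pi :> R. Proof. by have := @pi_gt0 R; lra. Qed.

Let dist_split (P g s q x2 x3 tau : R) : `|s - q| <= tau -> g <= P ->
  `|g - s| <= x2 + x3 -> `|P - q| <= P - g + x2 + x3 + tau.
Proof.
by rewrite !ler_norml => /andP[? ?] ? /andP[? ?]; apply/andP; split; lra.
Qed.

Let budget (i1 i2 i3 i4 l e eta tv tau s b : R) : i1 = b * l -> l * (s - tau) <= i2 ->
  tau * i3 <= tau * (l * b) -> (1 + tv) * i4 <= (1 + tv) * (l * e) ->
  l * tau * (b + 2) = eta / 2 -> l * e * (2 + tv) = eta / 2 ->
  l * (b - s) <= l * e -> i1 - i2 + tau * i3 + (1 + tv) * i4 + tau * l <= eta.
Proof. lra. Qed.

(** Since p - |G|^2 is nonnegative, its L^1 norm on a circle is a difference of two integrals, m L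
    and nearly S L, which is small when the energy of the coefficients exhausts m. The rest of |p -
    trigsum| compares |G|^2 with the square of a Taylor polynomial, and that square with its
    harmonic replacement. *)
Lemma trig_approximation (eta : R) : 0 < eta -> exists N (al' be' : nat -> R),
  [/\ al' 0%N = \sum_(k < N) rnorm (a k) ^+ 2,
      forall t, rnorm (psum a N (expi t)) ^+ 2 = trigsum al' be' N 1 t,
      \forall rho \near (1 : R)^'-,
        segint (- pi) (3 * pi) (fun t => `|p rho t - trigsum al' be' N rho t|) <= eta &
      forall rho, 0 <= rho < 1 -> segint (- pi) (3 * pi)
        (fun t => rnorm (G (polar rho t) - psum a N (polar rho t)) ^+ 2) <= eta].
Proof.
move=> eta0; have m0 : 0 <= m by have := coef_sum_le 0; rewrite big_ord0.
(* The errors add up to L tau (m + 2) + L e (2 + 1 / tau); tau, and then e, make each of the two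
   terms eta / 2. *)
pose tau := eta / (L * (2 * (m + 2))).
have m2 : 0 < m + 2 by lra.
have tau0 : 0 < tau by apply: divr_gt0 => //; apply: mulr_gt0 => //; apply: mulr_gt0.
have tv0 : 0 < tau^-1 by rewrite invr_gt0.
have t2 : 0 < 2 + tau^-1 by lra.
pose e := eta / (L * (2 * (2 + tau^-1))).
have e0 : 0 < e by apply: divr_gt0 => //; apply: mulr_gt0 => //; apply: mulr_gt0.
have [N HN] := iso e0; exists N.
have [al' [be' [al'0 E]]] := trigsum_sqr_psum a N; exists al', be'.
set S := \sum_(k < N) rnorm (a k) ^+ 2 in HN al'0 *.
have rem rho : 0 <= rho < 1 -> segint (- pi) (3 * pi)
    (fun t => rnorm (G (polar rho t) - psum a N (polar rho t)) ^+ 2) <= L * e.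
  move=> rho01; rewrite LE; have H := @parseval_le _ _ _ _ (@is_taylor_remainder N) _ rho (- pi) 2 isT rho01 (remainder_coef N).
  apply: le_trans H _; rewrite -/S.
  by rewrite LE' ler_wpM2l ?(ltW L0)//; lra.
have tn : [&& tau != 0, 2 * tau + 1 != 0 & L != 0].
  by rewrite !lt0r_neq0//; lra.
have Le : L * e = eta / (2 * (2 + tau^-1)) by rewrite /e; field.
split=> //; last first.
  move=> rho rho01; apply: le_trans (rem _ rho01) _.
  by rewrite Le ler_pdivrMr ?mulr_gt0//; nra.
have lim : (fun rho => \sum_(k < N) (rho ^+ k * rnorm (a k)) ^+ 2) @ (1 : R)^'- --> S.
  apply: (@cvg_sum_left1 N (fun k rho => (rho ^+ k * rnorm (a k)) ^+ 2) (fun k => rnorm (a k) ^+ 2)) => k.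
  under eq_fun do rewrite exprMn -exprM.
  have H : (fun rho : R => rho ^+ (k * 2) * rnorm (a k) ^+ 2) @ 1^'- --> 1 * rnorm (a k) ^+ 2.
    by apply: cvgMl; exact: cvg_exprn_left1.
  by rewrite mul1r in H.
move/cvgrPdist_le : lim => /(_ _ tau0) lim.
have unif := trig_uniform tau0 E.
near=> rho.
have rho01 : 0 <= rho < 1 by near: rho; exact: near_left01.
have h1 : S - \sum_(k < N) (rho ^+ k * rnorm (a k)) ^+ 2 <= tau.
  by apply: le_trans (ler_norm _) _; near: rho.
have h2 : forall t, `|rnorm (psum a N (polar rho t)) ^+ 2 - trigsum al' be' N rho t| <= tau.
  by near: rho.
have cp := harmonic_continuous harm_p rho01.
have cG := continuous_sqr Ga rho01.
have cT := @continuous_trigsum R al' be' N rho.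
have cN := @continuous_psum_sqr R U a N rho.
have cD := continuous_sqr (@is_taylor_remainder N) rho01.
pose f1 t := p rho t - rnorm (G (polar rho t)) ^+ 2.
pose f2 t := tau * rnorm (psum a N (polar rho t)) ^+ 2.
pose f3 t := (1 + tau^-1) * rnorm (G (polar rho t) - psum a N (polar rho t)) ^+ 2.
have c1 : continuous f1 by move=> t; apply: cvgB; [exact: cp|exact: cG].
have c2 : continuous f2 by move=> t; apply: cvgM; [exact: cvg_cst|exact: cN].
have c3 : continuous f3 by move=> t; apply: cvgM; [exact: cvg_cst|exact: cD].
have c12 : continuous (fun t => f1 t + f2 t) by move=> t; apply: cvgD; [exact: c1|exact: c2].
have c123 : continuous (fun t => f1 t + f2 t + f3 t) by move=> t; apply: cvgD; [exact: c12|exact: c3].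
apply: (@le_trans _ _ (segint (- pi) (3 * pi) (fun t => f1 t + f2 t + f3 t + tau))).
  apply: le_segint.
  - by move=> t; apply: cvg_norm; apply: cvgB; [exact: cp|exact: cT].
  - by move=> t; apply: cvgD; [exact: c123|exact: cvg_cst].
  move=> t _.
  exact: dist_split (h2 t) (pG t rho01) (sqr_diff _ _ tau0).
rewrite segintD//; last exact: cst_continuous.
rewrite segintD// segintD// segint_cst// segintB// !segintZ//.
have -> : 3 * pi - - pi = L by rewrite /L; ring.
have b1 : segint (- pi) (3 * pi) (p rho) = m * L by rewrite LE (@segint_harmonic _ _ _ _ harm_p rho (- pi) 2)// LE'.
have b2 : L * (S - tau) <= segint (- pi) (3 * pi) (fun t => rnorm (G (polar rho t)) ^+ 2).
  rewrite LE; apply: le_trans (@bessel _ _ _ _ Ga N rho (- pi) 2 isT rho01).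
  by rewrite LE' ler_wpM2l ?(ltW L0)//; lra.
have b3 : segint (- pi) (3 * pi) (fun t => rnorm (psum a N (polar rho t)) ^+ 2) <= L * m.
  have [r0 r1] := andP rho01.
  rewrite LE parseval_psum// LE' ler_wpM2l ?(ltW L0)//; apply: le_trans (coef_sum_le N).
  by apply: ler_sum => k _; rewrite exprMn ler_piMl ?sqr_ge0// -exprM exprn_ile1// ltW.
have b4 := rem _ rho01.
have b3' := ler_wpM2l (ltW tau0) b3.
have tv1 : 0 <= 1 + tau^-1 by lra.
have b4' := ler_wpM2l tv1 b4.
have e1 : L * tau * (m + 2) = eta / 2 by rewrite /tau; field; rewrite !lt0r_neq0.
have e2 : L * e * (2 + tau^-1) = eta / 2 by rewrite /e; field.
have Sm : m - S <= e by rewrite lerBlDr addrC -lerBlDr.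
have LSm := ler_wpM2l (ltW L0) Sm.
exact: (budget b1 b2 b3' b4' e1 e2 LSm).
Unshelve. all: by end_near. Qed.

End Isometric.
End RadialApproximation.

(** * Radial limits almost everywhere *)

Section RadialLimits.
Variables (R : realType) (U : hilbertType R).
Variables (G : R[i] -> U) (a : nat -> U) (p : R -> R -> R) (al be : nat -> R).
Hypothesis Ga : is_taylor G a.
Hypothesis harm_p : disc_harmonic p al be.
Hypothesis pG : forall rho t : R, 0 <= rho < 1 -> rnorm (G (polar rho t)) ^+ 2 <= p rho t.
Hypothesis iso : forall e : R, 0 < e -> exists N, al 0%N - e <= \sum_(k < N) rnorm (a k) ^+ 2.
Implicit Types (rho t e : R).
Local Notation mu := (@lebesgue_measure R).

(** One trigonometric sum has to serve along the whole radius from 1/2 to 1; this is what the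
    maximal inequality provides. *)
Let approx t e := exists N (al' be' : nat -> R),
  (forall s, rnorm (psum a N (expi s)) ^+ 2 = trigsum al' be' N 1 s) /\
  forall r, 2^-1 <= r < 1 -> `|p r t - trigsum al' be' N r t| <= e /\
    rnorm (G (polar r t) - psum a N (polar r t)) <= e.

(** The L^1 tolerance lam^2 / (i + 1) is dictated by the second use of the weak type inequality, at
    level lam^2 because it concerns the squared remainder; lam <= 1 makes the first use no worse. *)
Let approx_outside : exists2 C : R, 0 < C & forall (lam : R) (i : nat), 0 < lam <= 1 ->
  exists B : set R, [/\ measurable B, (mu B <= (C / i.+1%:R)%:E)%E &
    forall t, 0 <= t <= 2 * pi -> ~ B t -> approx t lam].
Proof.
have [C C0 HC] := weak_type_radial R; exists (2 * C); first by rewrite mulr_gt0.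
move=> lam i /andP[lam0 lam1]; pose eta := lam ^+ 2 / i.+1%:R.
have i0 : 0 < i.+1%:R :> R by rewrite ltr0n.
have l20 : 0 < lam ^+ 2 by rewrite exprn_gt0.
have eta0 : 0 < eta by rewrite divr_gt0.
have [N [al' [be' [_ E v_small D_small]]]] := trig_approximation Ga harm_p pG iso eta0.
have hv := harmonicB harm_p (harmonic_trigsum al' be' N).
have tD : is_taylor (fun z => G z - psum a N z) (fun k => if (k < N)%N then 0 else a k).
  exact: is_taylor_remainder.
have [|||rho0 r01||N1 [mN1 muN1 HN1]] := HC (fun rho t => `|p rho t - trigsum al' be' N rho t|) eta lam.
- by move=> rho rho01 t; apply: cvg_norm; exact: (harmonic_continuous hv).
- by [].
- exact: (subpoisson_abs hv).
- have := filter_ex (filterI (near_left1 r01) v_small).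
  by move=> [rho [rr Hrho]]; exists rho.
- exact: lam0.
have [|||rho0 r01||N2 [mN2 muN2 HN2]] := HC (fun rho t => rnorm (G (polar rho t) - psum a N (polar rho t)) ^+ 2) eta (lam ^+ 2).
- by move=> rho rho01; exact: (continuous_sqr tD).
- by move=> rho t; exact: sqr_ge0.
- exact: (subpoisson_sqr tD).
- have [rho [rr Hrho]] := filter_ex (filterI (near_left1 r01) (near_left01 R)).
  by exists rho => //; exact: D_small.
- exact: l20.
exists (N1 `|` N2); split.
- exact: measurableU.
- apply: le_trans (measureU2 _ _ _) _ => //; apply: le_trans (leeD muN1 muN2) _.
  rewrite -EFinD lee_fin.
  have -> : C * eta / lam = C * lam / i.+1%:R by rewrite /eta; field; rewrite !gt_eqF.
  have -> : C * eta / lam ^+ 2 = C / i.+1%:R by rewrite /eta; field; rewrite !gt_eqF.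
  rewrite -mulrDl ler_pM2r ?invr_gt0//.
  have : C * lam <= C by rewrite ler_piMr// ltW.
  lra.
move=> t t02 nB; exists N, al', be'; split=> // r r12; split.
  by rewrite leNgt; apply/negP => H; apply: nB; left; exact: HN1 H.
rewrite -(@ler_pXn2r _ 2) ?nnegrE ?rnorm_ge0 ?(ltW lam0)// leNgt; apply/negP => H.
by apply: nB; right; exact: HN2 H.
Qed.

(** For precision 1 / (j + 1) the exceptional sets have measure at most C / (i + 1), so their
    intersection over i is null; Z is the union of these over j. *)
Let approx_ae : exists2 Z : set R, mu.-negligible Z &
  forall t, 0 <= t <= 2 * pi -> ~ Z t -> forall e, 0 < e -> approx t e.
Proof.
have [C C0 HC] := approx_outside.
have lam01 (j : nat) : 0 < (j.+1%:R^-1 : R) <= 1 by rewrite invr_gt0 ltr0n/= invf_le1// ler1n.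
have /choice[B HB] (ji : nat * nat) : exists B : set R, [/\ measurable B,
    (mu B <= (C / ji.2.+1%:R)%:E)%E &
    forall t, 0 <= t <= 2 * pi -> ~ B t -> approx t (ji.1.+1%:R^-1)].
  exact: HC.
exists (\bigcup_j \bigcap_i B (j, i)).
  apply: negligible_bigcup => j.
  have mI : measurable (\bigcap_i B (j, i)).
    by apply: bigcap_measurable => // i _; have [] := HB (j, i).
  exists (\bigcap_i B (j, i)); split=> //.
  apply/eqP; rewrite -measure_le0; apply/lee_addgt0Pr => e e0; rewrite add0e.
  have [_ muB _] := HB (j, Num.bound (C / e)).
  apply: le_trans (le_trans _ muB) _; first by
    apply: le_measure; [apply: mem_set; exact: mI|apply: mem_set; have [] := HB (j, Num.bound (C / e))|move=> x H; exact: H].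
  rewrite lee_fin ler_pdivrMr ?ltr0n// mulrC -ler_pdivrMr//.
  apply: le_trans (ltW (archi_boundP _)) _; first by rewrite divr_ge0 ?ltW.
  by rewrite ler_nat leqW.
move=> t t02 nZ e e0.
pose j := Num.bound e^-1.
have je : j.+1%:R^-1 <= e.
  rewrite -[leRHS]invrK lef_pV2 ?posrE ?invr_gt0//.
  apply: le_trans (ltW (archi_boundP _)) _; first by rewrite invr_ge0 ltW.
  by rewrite ler_nat leqW.
have [i nB] : exists i, ~ B (j, i) t.
  apply/not_existsP => H; apply: nZ; exists j => // i _.
  by have := H i => /contrapT.
have [_ _ /(_ t t02 nB) [N [al' [be' [E H]]]]] := HB (j, i).
exists N, al', be'; split=> // r r12; have [h1 h2] := H r r12.
by split; apply: le_trans je.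
Qed.

(** Trigonometric sums converge along every radius, so p, being within e of such a sum for each e,
    is Cauchy. Then p and |G|^2 are compared through a common sum, where |G| stays bounded because p
    converges. *)
Let approx_cvg t : (forall e, 0 < e -> approx t e) ->
  (exists l : R, (fun rho => p rho t) @ (1 : R)^'- --> l) /\
  (fun rho => p rho t - rnorm (G (polar rho t)) ^+ 2) @ (1 : R)^'- --> (0 : R).
Proof.
move=> ap.
have near_half : \forall rho \near (1 : R)^'-, 2^-1 <= rho < 1.
  have h : 2^-1 < 1 :> R by rewrite invf_lt1 ?ltr1n.
  by have := near_left1 h; apply: filterS => rho /andP[/ltW -> ->].
have [l pl] : exists l : R, (fun rho => p rho t) @ (1 : R)^'- --> l.
  have : cvg ((fun rho => p rho t) @ (1 : R)^'-); last by move=> /cvg_ex[l pl]; exists l.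
  apply: cauchy_cvg; apply: cauchy_exP => e e0; have e4 : 0 < e / 4 by rewrite divr_gt0.
  have [N [al' [be' [_ H]]]] := ap _ e4.
  exists (trigsum al' be' N 1 t).
  have /cvgrPdist_le/(_ _ e4) T := @cvg_trigsum_left1 R al' be' N t.
  change (\forall rho \near (1 : R)^'-, ball (trigsum al' be' N 1 t) e (p rho t)).
  near=> rho; rewrite /ball /=.
  have rh : 2^-1 <= rho < 1 by near: rho; exact: near_half.
  have [h1 _] := H rho rh.
  have h2 : `|trigsum al' be' N 1 t - trigsum al' be' N rho t| <= e / 4 by near: rho.
  move: h1 h2; rewrite ltr_norml !ler_norml => /andP[? ?] /andP[? ?]; apply/andP; split; lra.
split; first by exists l.
apply/cvgrPdist_le => dl dl0.
(* Eventually p <= K, hence |G| <= K + 1; the three errors are lam, lam and lam (2 (K + 1) + 1),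
   whence the divisor 5 + 2 K. *)
pose K := `|l| + 1; have K0 : 0 < K by rewrite ltr_wpDl.
have c0 : 0 < 5 + 2 * K by lra.
pose lam := Num.min 1 (dl / (5 + 2 * K)).
have lam0 : 0 < lam by rewrite lt_min ltr01 divr_gt0.
have lam1 : lam <= 1 by rewrite ge_min lexx.
have lamd : lam * (5 + 2 * K) <= dl by rewrite -ler_pdivlMr// ge_min lexx orbT.
have [N [al' [be' [E H]]]] := ap _ lam0.
have unif := trig_uniform lam0 E.
move/cvgrPdist_le : (pl) => /(_ _ ltr01) pl1.
near=> rho; rewrite sub0r normrN.
have rho01 : 0 <= rho < 1 by near: rho; exact: near_left01.
have rh : 2^-1 <= rho < 1 by near: rho; exact: near_half.
have [h1 h2] := H rho rh.
have h3 : forall s, `|rnorm (psum a N (polar rho s)) ^+ 2 - trigsum al' be' N rho s| <= lam.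
  by near: rho.
have h4 : `|l - p rho t| <= 1 by near: rho.
have h5 := pG t rho01; have {}h3 := h3 t.
have h6 := rnorm_dist (G (polar rho t)) (psum a N (polar rho t)).
have h7 := rnorm_ge0 (G (polar rho t)); have h8 := rnorm_ge0 (psum a N (polar rho t)).
have lK : l + 1 <= K by rewrite lerD2r ler_norm.
move: h1 h2 h3 h4 h5 h6 h7 h8.
move: (rnorm (G _)) (rnorm (psum _ _ _)) (rnorm _) (trigsum _ _ _ _ _) (p rho t) => g s d T P h1 h2 h3 h4 h5 h6 h7 h8.
have gK : g <= K + 1.
  by move: h4; rewrite ler_norml => /andP[? ?]; have := sqr_ge0 (g - 1); nra.
have sg : `|s ^+ 2 - g ^+ 2| <= lam * (2 * (K + 1) + 1).
  have -> : s ^+ 2 - g ^+ 2 = - ((g - s) * (2 * g - (g - s))) by ring.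
  rewrite normrN normrM; apply: ler_pM => //; first exact: le_trans h2.
  apply: le_trans (ler_normB _ _) _; rewrite ger0_norm ?mulr_ge0//.
  apply: lerD; first by rewrite ler_pM2l.
  by apply: le_trans lam1; exact: le_trans h2.
rewrite ger0_norm ?subr_ge0//; move: h1 h3 sg; rewrite !ler_norml.
by move=> /andP[? ?] /andP[? ?] /andP[? ?]; lra.
Unshelve. all: by end_near. Qed.

Lemma radial_limits : exists2 Z : set R, mu.-negligible Z &
  forall t, 0 <= t <= 2 * pi -> ~ Z t ->
  (exists l : R, (fun rho => p rho t) @ (1 : R)^'- --> l) /\
  (fun rho => p rho t - rnorm (G (polar rho t)) ^+ 2) @ (1 : R)^'- --> (0 : R).
Proof.
have [Z Z0 HZ] := approx_ae; exists Z => // t t02 nZ; apply: approx_cvg; exact: HZ.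
Qed.

End RadialLimits.

(** * Comparison of integrals off a null set *)

Section AlmostEverywhere.
Context d (T : measurableType d) (R : realType) (mu : {measure set T -> \bar R}).
Local Open Scope ereal_scope.
Implicit Types (D : set T) (f g : T -> \bar R).

(* No measurability is assumed: the integral of a nonnegative function is the
   supremum of the integrals of the simple functions below it. *)
Lemma ge0_le_integral_nonmeasurable D f g : (forall x, D x -> 0 <= f x) ->
  (forall x, D x -> f x <= g x) -> \int[mu]_(x in D) f x <= \int[mu]_(x in D) g x.
Proof.
move=> f0 fg.
have g0 x : D x -> 0 <= g x by move=> Dx; exact: le_trans (f0 _ Dx) (fg _ Dx).
rewrite !(integral_mkcond D) !ge0_integralTE.
- apply: ereal_sup_le => _ [h /= hf <-]; exists h => //= x.
  apply: le_trans (hf x) _; rewrite !patchE; case: ifPn => // /set_mem; exact: fg.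
- by move=> x; rewrite patchE; case: ifPn => // /set_mem; exact: g0.
- by move=> x; rewrite patchE; case: ifPn => // /set_mem; exact: f0.
Qed.

Variables (D Z : set T).
Hypotheses (mD : measurable D) (Z0 : mu.-negligible Z).

(** Measurability is asked of g only, since f is to be a radial limit. Raising g to +oo on a
    measurable null set containing Z keeps its integral and makes f <= g true on all of D. *)
Lemma ae_le_integral_upper f g : (forall x, D x -> 0 <= f x) -> (forall x, D x -> 0 <= g x) ->
  measurable_fun D g -> (forall x, D x -> ~ Z x -> f x <= g x) ->
  \int[mu]_(x in D) f x <= \int[mu]_(x in D) g x.
Proof.
move=> f0 g0 mg fg; have [A [mA muA ZA]] := Z0.
pose g' := fun x => g x + (cst +oo \_ A) x.
have mg' : measurable_fun D g'.
  apply: emeasurable_funD => //; apply/measurable_restrict => //; exact: measurable_cst.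
have -> : \int[mu]_(x in D) g x = \int[mu]_(x in D) g' x.
  apply: ae_eq_integral => //; exists A; split=> // x /= H.
  apply: contrapT => nA; apply: H => _; by rewrite /g' patchE memNset// adde0.
apply: ge0_le_integral_nonmeasurable => // x Dx; rewrite /g' patchE; case: ifPn => [_|].
  by rewrite addey ?leey// -ltNye (lt_le_trans _ (g0 x Dx)).
by rewrite adde0 notin_setE => nA; apply: fg => // Zx; apply: nA; exact: ZA.
Qed.

(** Here the radial limit is to stand on the right, so the measurable f is altered instead, to 0 on
    the null set. *)
Lemma ae_le_integral_lower f g : (forall x, D x -> 0 <= f x) -> (forall x, D x -> 0 <= g x) ->
  measurable_fun D f -> (forall x, D x -> ~ Z x -> f x <= g x) ->
  \int[mu]_(x in D) f x <= \int[mu]_(x in D) g x.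
Proof.
move=> f0 g0 mf fg; have [A [mA muA ZA]] := Z0.
pose f' := f \_ (~` A).
have mf' : measurable_fun D f'.
  apply/measurable_restrict => //; first exact: measurableC.
  by apply: measurable_funS mf => // x [].
have -> : \int[mu]_(x in D) f x = \int[mu]_(x in D) f' x.
  apply: ae_eq_integral => //; exists A; split=> // x /= H.
  apply: contrapT => nA; apply: H => _; by rewrite /f' patchE mem_set.
apply: ge0_le_integral_nonmeasurable => x Dx; rewrite /f' patchE; case: ifPn => //.
- by move=> _; exact: f0.
- by move=> /set_mem nA; apply: fg => // Zx; apply: nA; exact: ZA.
- by move=> _; exact: g0.
Qed.

Lemma measurable_limn_einf D' (f : nat -> T -> \bar R) : (forall n, measurable_fun D' (f n)) ->
  measurable_fun D' (fun x => limn_einf (f ^~ x)).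
Proof.
move=> mf.
have -> : (fun x => limn_einf (f ^~ x)) = (fun x => - limn_esup (fun n => - f n x)).
  by apply/funext => x; rewrite -[RHS]limn_einfN; congr limn_einf; apply/funext => n /=; rewrite oppeK.
apply: measurableT_comp => //; apply: measurable_fun_limn_esup => n.
exact: measurableT_comp.
Qed.

Lemma limn_einf_ge0 (u : nat -> \bar R) : (forall n, 0 <= u n) -> 0 <= limn_einf u.
Proof.
move=> u0; rewrite limn_einf_lim; apply: lime_ge; first exact: is_cvg_einfs.
by apply: nearW => n; apply: le_ereal_inf_tmp => _ [m _ <-].
Qed.

End AlmostEverywhere.

(** * The isometry property in terms of radial limits *)

Section IsometryCriterion.
Variables (R : realType) (U : hilbertType R).
Variables (G : R[i] -> U) (a : nat -> U) (p : R -> R -> R) (al be : nat -> R).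
Hypothesis Ga : is_taylor G a.
Hypothesis harm_p : disc_harmonic p al be.
Hypothesis pG : forall rho t : R, 0 <= rho < 1 -> rnorm (G (polar rho t)) ^+ 2 <= p rho t.
Implicit Types (rho t e : R).
Local Notation mu := (@lebesgue_measure R).
Local Notation m := (al 0%N).

(** Fatou's lemma and measurability of a liminf call for a sequence of radii. *)
Let rn (k : nat) : R := 1 - k.+2%:R^-1.
Let rn1 k : rn k < 1. Proof. by rewrite gtrBl invr_gt0. Qed.
Let rn01 k : 0 <= rn k < 1.
Proof. by rewrite rn1 andbT subr_ge0 invf_le1// ler1n. Qed.
Let rn_to1 : rn @ \oo --> (1 : R).
Proof.
have := @cvg_harmonic R; rewrite -(cvg_shiftS (@harmonic R)) => H.
have : (fun k => 1 - @harmonic R k.+1) @ \oo --> (1 - 0 : R).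
  by apply: cvgB; [exact: cvg_cst|exact: H].
by rewrite subr0.
Qed.
Let rn_cvg (f : R -> R) (l : R) : f @ (1 : R)^'- --> l -> (fun k => f (rn k)) @ \oo --> l.
Proof.
by move=> fl; apply: (cvg_at_leftP f 1 l).1 => //; split=> //.
Qed.

Let D : set R := `[0, 2 * pi].
Let mD : measurable D. Proof. exact: measurable_itv. Qed.
Let L0 : 0 < 2 * pi :> R. Proof. by rewrite mulr_gt0// pi_gt0. Qed.
Let LE : 2 * pi = 0 + 2 * pi * 1%:R :> R. Proof. by rewrite add0r mulr1. Qed.

Definition radial_lim t : R := lim ((fun rho => p rho t) @ (1 : R)^'-).

Let p_ge0 rho t : 0 <= rho < 1 -> 0 <= p rho t.
Proof. by move=> /(pG t); apply: le_trans; exact: sqr_ge0. Qed.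

(** At an angle without limit, [lim] takes the default value 0, so nonnegativity holds at every
    t. *)
Let radial_lim_ge0 t : 0 <= radial_lim t.
Proof.
have [c|c] := pselect (cvg ((fun rho => p rho t) @ (1 : R)^'-)).
  apply: ler_cvg_to (cvg_cst 0) c _; have := near_left01 R; apply: filterS => rho.
  exact: p_ge0.
by rewrite /radial_lim (dvgP c).
Qed.

Let radial_limE t l : (fun rho => p rho t) @ (1 : R)^'- --> l -> radial_lim t = l.
Proof. by move=> pl; apply: cvg_lim => //; exact: norm_hausdorff. Qed.

Let cp k : continuous (p (rn k)). Proof. exact: (harmonic_continuous harm_p). Qed.
Let cG k : continuous (fun t => rnorm (G (polar (rn k) t)) ^+ 2).
Proof. exact: (continuous_sqr Ga). Qed.
Let mf (f : R -> R) : continuous f -> measurable_fun D (fun t => (f t)%:E).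
Proof.
by move=> cf; apply/measurable_EFinP/measurable_funTS; exact: continuous_measurable_fun.
Qed.

Let fatou_segint (f : nat -> R -> R) (c : R) : (forall k, continuous (f k)) ->
  (forall k t, 0 <= f k t) -> (\forall k \near \oo, segint 0 (2 * pi) (f k) <= c) ->
  (\int[mu]_(t in D) limn_einf (fun k => (f k t)%:E) <= c%:E)%E.
Proof.
move=> cf f0 fc; have F := @fatou _ _ R mu D mD (fun k t => (f k t)%:E) (fun k => mf (cf k)).
apply: le_trans (F _) _; first by move=> k t _; rewrite lee_fin.
rewrite limn_einf_lim; apply: lime_le; first exact: is_cvg_einfs.
case: fc => N _ HN; apply: nearW => n.
apply: (@le_trans _ _ (\int[mu]_(t in D) (f (maxn n N) t)%:E)%E).
  by apply: ereal_inf_lbound; exists (maxn n N) => //=; exact: leq_maxl.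
by rewrite -segintE// lee_fin; apply: HN => /=; exact: leq_maxr.
Qed.

Let limn_einf_real (u : nat -> R) (l : R) : u @ \oo --> l ->
  limn_einf (fun k => (u k)%:E) = l%:E.
Proof.
move=> ul; have ul' : (fun k => (u k)%:E) @ \oo --> l%:E by apply: cvg_EFin => //; exact: nearW.
by have [-> _] := cvg_limn_einf_sup ul'.
Qed.

(** If the energy stayed below M - e, Parseval and Fatou would bound the integral of liminf |G|^2 by
    2 pi (M - e). Off a null set this liminf dominates the radial limit of p, whose integral is 2 pi
    M. *)
Lemma isometry_of_radial_limits (M : R) (Z : set R) :
  (\int[mu]_(t in D) (radial_lim t)%:E = (2 * pi * M)%:E)%E ->
  mu.-negligible Z ->
  (forall t, D t -> ~ Z t ->
    (fun rho => p rho t - rnorm (G (polar rho t)) ^+ 2) @ (1 : R)^'- --> (0 : R)) ->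
  forall e, 0 < e -> exists N, M - e <= \sum_(k < N) rnorm (a k) ^+ 2.
Proof.
move=> Ih Z0 HZ e e0; apply: contrapT => /forallNP H.
have {}H N : \sum_(k < N) rnorm (a k) ^+ 2 <= M - e.
  by rewrite leNgt; apply/negP => /ltW; exact: H.
have F := @fatou_segint (fun k t => rnorm (G (polar (rn k) t)) ^+ 2) (2 * pi * (M - e)) cG.
have {}F : (\int[mu]_(t in D) limn_einf (fun k => (rnorm (G (polar (rn k) t)) ^+ 2)%:E)
    <= (2 * pi * (M - e))%:E)%E.
  apply: F; first by move=> k t; exact: sqr_ge0.
  apply: nearW => k; have := @parseval_le _ _ _ _ Ga (M - e) (rn k) 0 1 isT (rn01 k) H.
  by rewrite -LE mulr1.
have : ((2 * pi * M)%:E <= (2 * pi * (M - e))%:E)%E.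
  rewrite -Ih; apply: le_trans _ F.
  apply: (@ae_le_integral_upper _ _ R mu D Z mD Z0).
  - by move=> t _; rewrite lee_fin.
  - by move=> t _; apply: limn_einf_ge0 => k; rewrite lee_fin sqr_ge0.
  - apply: (@measurable_limn_einf _ _ _ D (fun k t => (rnorm (G (polar (rn k) t)) ^+ 2)%:E)) => k.
    by apply: mf; exact: cG.
  move=> t Dt nZ.
  (* The vanishing of p - |G|^2 does not by itself make p converge at t; where p has no limit,
     [radial_lim] is 0 and the inequality is trivial. *)
  have [c|c] := pselect (cvg ((fun rho => p rho t) @ (1 : R)^'-)); last first.
    rewrite /radial_lim (dvgP c); apply: limn_einf_ge0 => k; by rewrite lee_fin sqr_ge0.
  have [l pl] : exists l : R, (fun rho => p rho t) @ (1 : R)^'- --> l by exists (lim ((fun rho => p rho t) @ (1 : R)^'-)).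
  rewrite (radial_limE pl).
  have gl : (fun rho => rnorm (G (polar rho t)) ^+ 2) @ (1 : R)^'- --> l.
    have -> : (fun rho => rnorm (G (polar rho t)) ^+ 2) =
        (fun rho => p rho t - (p rho t - rnorm (G (polar rho t)) ^+ 2)).
      by apply/funext => rho /=; rewrite subKr.
    by rewrite -[l]subr0; apply: cvgB => //; exact: HZ.
  by rewrite (limn_einf_real (rn_cvg gl)).
rewrite lee_fin ler_pM2l//; lra.
Qed.

(** Fatou bounds the integral from above only; the lower bound says that no mass escapes. It comes
    from a trigonometric sum whose difference v from p has L^1 norm at most e / 2 on circles near
    the boundary: the integral of the sum is right up to e / 2, and almost everywhere its boundary
    values are at most liminf p + liminf |v|. *)
Lemma radial_limits_of_isometry :
  (forall e, 0 < e -> exists N, m - e <= \sum_(k < N) rnorm (a k) ^+ 2) ->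
  (\int[mu]_(t in D) (radial_lim t)%:E = (2 * pi * m)%:E)%E /\
  exists2 Z : set R, mu.-negligible Z & forall t, D t -> ~ Z t ->
    (fun rho => p rho t - rnorm (G (polar rho t)) ^+ 2) @ (1 : R)^'- --> (0 : R).
Proof.
move=> iso; have [Z Z0 HZ] := radial_limits Ga harm_p pG iso.
have Dt02 t : D t -> 0 <= t <= 2 * pi by rewrite /D /= in_itv.
split; last by exists Z => // t Dt nZ; have [] := HZ t (Dt02 t Dt) nZ.
have {}HZ t : D t -> ~ Z t -> exists l : R, (fun rho => p rho t) @ (1 : R)^'- --> l.
  by move=> Dt nZ; have [] := HZ t (Dt02 t Dt) nZ.
pose L t := limn_einf (fun k => (p (rn k) t)%:E).
have mL : measurable_fun D L.
  apply: (@measurable_limn_einf _ _ _ D (fun k t => (p (rn k) t)%:E)) => k.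
  by apply: mf; exact: cp.
have L_ge0 t : (0 <= L t)%E by apply: limn_einf_ge0 => k; rewrite lee_fin p_ge0.
have LE' t l : (fun rho => p rho t) @ (1 : R)^'- --> l -> L t = l%:E.
  by move=> pl; apply: limn_einf_real; exact: (@rn_cvg (fun rho => p rho t) l pl).
apply/eqP; rewrite eq_le; apply/andP; split.
  apply: (@le_trans _ _ (\int[mu]_(t in D) L t)%E).
    apply: (@ae_le_integral_upper _ _ R mu D Z mD Z0) => //.
    - by move=> t _; rewrite lee_fin.
    - by move=> t Dt nZ; have [l pl] := HZ t Dt nZ; rewrite (LE' _ _ pl) (radial_limE pl).
  apply: fatou_segint => [|k t|]; [exact: cp|exact: p_ge0|].
  apply: nearW => k; rewrite {1}LE (@segint_harmonic _ _ _ _ harm_p (rn k) 0 1)//.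
  by rewrite mulr1 mulrC.
apply/lee_addgt0Pr => e e0; have e2 : 0 < e / 2 by rewrite divr_gt0.
have [N [al' [be' [_ E v_small _]]]] := trig_approximation Ga harm_p pG iso e2.
pose v rho t := p rho t - trigsum al' be' N rho t.
have hv : disc_harmonic v _ _ := harmonicB harm_p (harmonic_trigsum al' be' N).
have cv k : continuous (fun t => `|v (rn k) t|).
  by move=> t; apply: cvg_norm; exact: (harmonic_continuous hv).
have v2 rho : 0 <= rho < 1 -> segint 0 (2 * pi) (fun t => `|v rho t|) <=
    segint (- pi) (3 * pi) (fun t => `|v rho t|).
  move=> rho01; have cvr : continuous (fun t => `|v rho t|).
    by move=> t; apply: cvg_norm; exact: (harmonic_continuous hv).
  rewrite -lee_fin !segintE//; apply: ge0_subset_integral.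
  - exact: measurable_itv.
  - exact: measurable_itv.
  - by apply/measurable_EFinP/measurable_funTS; exact: continuous_measurable_fun.
  - by move=> t _; rewrite lee_fin.
  - by move=> t /=; rewrite !in_itv /= => /andP[? ?]; have := @pi_gt0 R => ?; apply/andP; split; lra.
have v_small' : \forall k \near \oo, segint 0 (2 * pi) (fun t => `|v (rn k) t|) <= e / 2.
  have H0 : \forall k \near \oo, rn k < 1 ->
      segint (- pi) (3 * pi) (fun t => `|v (rn k) t|) <= e / 2 := rn_to1 v_small.
  move: H0; apply: filterS => k H.
  by apply: le_trans (v2 _ (rn01 k)) (H (rn1 k)).
pose c0 := if (0 < N)%N then al' 0%N else 0.
(* Any one radius at which |v| has small integral will do, since the means of p and of the sum do
   not depend on the radius. *)
have c0m : 2 * pi * m - e / 2 <= 2 * pi * c0.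
  have [k Hk] := filter_ex v_small'.
  have := @segint_harmonic _ _ _ _ hv (rn k) 0 1 isT (rn01 k); rewrite -LE mulr1 => H.
  have := segint_norm_le 0 (2 * pi) (harmonic_continuous hv (rn01 k)).
  rewrite H => /le_trans/(_ Hk)/(le_trans (ler_norm _)).
  rewrite -/c0; lra.
have IQ : segint 0 (2 * pi) (trigsum al' be' N 1) = 2 * pi * c0.
  rewrite /c0; case: posnP => [N0|N0]; last first.
    by rewrite {1}LE segint_trigsum// mulr1 mulrC.
  have -> : trigsum al' be' N 1 = fun=> 0.
    by apply/funext => t; rewrite N0 /trigsum big_ord0.
  by rewrite segint_cst ?(ltW L0)// mul0r mulr0.
pose M t := limn_einf (fun k => `|v (rn k) t|%:E).
have mM : measurable_fun D M.
  apply: (@measurable_limn_einf _ _ _ D (fun k t => `|v (rn k) t|%:E)) => k.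
  by apply: mf; exact: cv.
have M_ge0 t : (0 <= M t)%E by apply: limn_einf_ge0 => k; rewrite lee_fin.
have IM : (\int[mu]_(t in D) M t <= (e / 2)%:E)%E.
  by apply: fatou_segint => //.
have IL : (\int[mu]_(t in D) L t <= \int[mu]_(t in D) (radial_lim t)%:E)%E.
  apply: (@ae_le_integral_lower _ _ R mu D Z mD Z0) => //.
  - by move=> t _; rewrite lee_fin.
  - by move=> t Dt nZ; have [l pl] := HZ t Dt nZ; rewrite (LE' _ _ pl) (radial_limE pl).
have IQL : ((2 * pi * c0)%:E <= \int[mu]_(t in D) (L t + M t))%E.
  rewrite -IQ segintE; last exact: continuous_trigsum.
  apply: (@ae_le_integral_upper _ _ R mu D Z mD Z0).
  - by move=> t _; rewrite lee_fin -E sqr_ge0.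
  - by move=> t _; rewrite adde_ge0.
  - exact: emeasurable_funD.
  move=> t Dt nZ; have [l pl] := HZ t Dt nZ.
  have vl : (fun k => `|v (rn k) t|) @ \oo --> `|l - trigsum al' be' N 1 t|.
    apply: cvg_norm; apply: cvgB; first exact: (@rn_cvg (fun rho => p rho t) l pl).
    by apply: (@rn_cvg (fun rho => trigsum al' be' N rho t)); exact: cvg_trigsum_left1.
  rewrite (LE' _ _ pl) /M (limn_einf_real vl) -EFinD lee_fin.
  by have := ler_norm (- (l - trigsum al' be' N 1 t)); rewrite normrN; lra.
rewrite ge0_integralD// in IQL.
have -> : 2 * pi * m = (2 * pi * m - e / 2) + e / 2 by ring.
have -> : (e%:E = (e / 2)%:E + (e / 2)%:E)%E by rewrite -EFinD -splitr.
rewrite EFinD addeA; apply: leeD => //.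
apply: (@le_trans _ _ (2 * pi * c0)%:E); first by rewrite lee_fin.
by apply: le_trans IQL _; apply: leeD.
Qed.

End IsometryCriterion.

(** * The operator omega_bar *)

Section Subspaces.
Variable R : realType.
Implicit Types U V W : hilbertType R.

Lemma rdot_ext U (x y : U) : (forall z, rdot z x = rdot z y) -> x = y.
Proof.
move=> xy; apply/eqP; rewrite -subr_eq0; apply/eqP/rnorm0_eq0/eqP.
by rewrite -sqrf_eq0 -rdotxx rdotBr xy subrr.
Qed.

Lemma hdot_eq0 U (x y : U) : rdot x y = 0 -> rdot ('i *: x) y = 0 -> hdot x y = 0.
Proof.
move=> r0 i0; have := hdot_Im x y; rewrite i0 oppr0 => im0.
by apply/eqP; rewrite eq_complex im0 -/(rdot x y) r0 /= !eqxx.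
Qed.

Lemma rdot_polarization U (x y : U) :
  rdot x y = 4^-1 * (rnorm (x + y) ^+ 2 - rnorm (x - y) ^+ 2).
Proof. by rewrite sqr_rnormD sqr_rnormB; field. Qed.

Lemma rdot_of_rnorm U V W (A : bop U V) (B : bop U W) (c : R) :
  (forall x, rnorm (A x) ^+ 2 = c * rnorm (B x) ^+ 2) ->
  forall x y, rdot (A x) (A y) = c * rdot (B x) (B y).
Proof.
by move=> AB x y; rewrite !rdot_polarization -!bopD -!bopB !AB; ring.
Qed.

Lemma closure_rnorm U (A : set U) x : closure A x ->
  forall e : R, 0 < e -> exists2 y, A y & rnorm (x - y) <= e.
Proof.
move=> Ax e e0; have H : (fun y : U => y) @ nbhs x --> x by exact: cvg_id.
have [y [Ay xy]] := Ax _ ((cvg_rnorm _ _).1 H e e0).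
by exists y.
Qed.

Lemma closure_rdot0 U (A : set U) x z : closure A x ->
  (forall y, A y -> rdot y z = 0) -> rdot x z = 0.
Proof.
move=> Ax A0; apply/normr0_eq0/le_anti; rewrite normr_ge0 andbT.
apply/ler_addgt0Pr => e e0; rewrite add0r.
have z1 : 0 < rnorm z + 1 by rewrite ltr_wpDl ?rnorm_ge0.
have e1 : 0 < e / (rnorm z + 1) by rewrite divr_gt0.
have [y Ay xy] := closure_rnorm Ax e1.
have -> : rdot x z = rdot (x - y) z by rewrite rdotBl (A0 y Ay) subr0.
apply: le_trans (rdot_CS _ _) _.
apply: le_trans (_ : e / (rnorm z + 1) * (rnorm z + 1) <= _); last by rewrite divfK ?gt_eqF.
by apply: ler_pM; rewrite ?rnorm_ge0// lerDl.
Qed.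

Lemma closure_hdot0 U (A : set U) x z : closure A x ->
  (forall y, A y -> hdot y z = 0) -> hdot x z = 0.
Proof.
move=> Ax A0; apply: hdot_eq0.
  by apply: (closure_rdot0 Ax) => y Ay; rewrite /rdot A0.
rewrite rdot_i (closure_rdot0 Ax) ?oppr0// => y Ay.
by rewrite /rdot hdotZr A0// mulr0.
Qed.

Lemma rnorm_val U (S : csubspace U) (x : csub S) : rnorm x = rnorm (val x).
Proof. by []. Qed.
Lemma rdot_val U (S : csubspace U) (x y : csub S) : rdot x y = rdot (val x) (val y).
Proof. by []. Qed.

Lemma bcorestrP U V (S : csubspace V) (A : bop U V) : (forall x, cs_set S (A x)) ->
  forall x, val (bcorestr S A x) = A x.
Proof.
move=> SA; suff [B HB] : exists B : bop U (csub S), forall x, val (B x) = A x.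
  exact: (@xgetPex _ 0 [set B : bop U (csub S) | forall x, val (B x) = A x] (ex_intro _ B HB)).
pose f x : csub S := Sub (A x) (asboolT (SA x)).
have fl : linear f by move=> a x y; apply: val_inj; exact: bop_linear.
have [M M0 AM] := bop_bounded A.
have fM x : rnorm (f x) <= M * rnorm x by exact: AM.
by exists (mk_bop fl fM).
Qed.

Lemma defectrP U V (C : bop U V) x : val (defectr C x) = defect C x.
Proof. by apply: bcorestrP => {}x; apply: subset_closure; exists x. Qed.

Lemma rnorm_defectr U V (C : bop U V) x : contractive C ->
  rnorm (defectr C x) ^+ 2 = rnorm x ^+ 2 - rnorm (C x) ^+ 2.
Proof. by move=> C1; rewrite rnorm_val defectrP rnorm_defect. Qed.

Lemma rnorm_hsum U V (x : hsum U V) : rnorm x ^+ 2 = rnorm x.1 ^+ 2 + rnorm x.2 ^+ 2.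
Proof. by rewrite -!rdotxx /rdot -cReD. Qed.

Lemma rnorm_fst U V (x : hsum U V) : rnorm x.1 <= rnorm x.
Proof. by rewrite -le_rnorm; exact: hsum_norm_fst. Qed.
Lemma rnorm_snd U V (x : hsum U V) : rnorm x.2 <= rnorm x.
Proof. by rewrite -le_rnorm; exact: hsum_norm_snd. Qed.

Lemma bpair_exists U V W (A : bop U V) (B : bop U W) :
  exists P : bop U (hsum V W), forall x, P x = (A x, B x).
Proof.
pose f x : hsum V W := (A x, B x).
have fl : linear f.
  by move=> a x y; rewrite /f !bop_linear.
have [[M M0 AM] [M' M'0 BM]] := (bop_bounded A, bop_bounded B).
have fM x : rnorm (f x) <= (M + M') * rnorm x.
  have H : rnorm (f x) <= rnorm (A x) + rnorm (B x).
    by rewrite -lecR rmorphD /= -!rnormE; exact: hsum_norm_le.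
  by apply: le_trans H _; rewrite mulrDl lerD.
by exists (mk_bop fl fM).
Qed.

End Subspaces.

Section PartialIsometry.
Variables (R : realType) (H K L : hilbertType R) (V : bop H K) (Z : bop H L).
Hypothesis VZ : forall h, rnorm (V h) = rnorm (Z h).

(* On the closed graph G of V h |-> Z h, the first projection E satisfies
   |E g|^2 = |g|^2 / 2, so that 2 E E^* is the projection onto the closure of
   the range of V. *)
Lemma partial_isometry_exists : exists W : bop K L,
  (forall h, W (V h) = Z h) /\ (forall d, (forall h, hdot d (V h) = 0) -> W d = 0).
Proof.
have [P HP] := bpair_exists V Z.
pose G := brange P; pose E := hfst \ob cs_incl G; pose F := hsnd \ob cs_incl G.
have EF (g : csub G) : rnorm (E g) = rnorm (F g).
  have Gg : closure (range P) (val g) by exact: asboolW (valP g).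
  apply/eqP; rewrite -subr_eq0 -normr_le0; apply/ler_addgt0Pr => e e0; rewrite add0r.
  have e2 : 0 < e / 2 by rewrite divr_gt0.
  have [_ [h _ <-] gh] := closure_rnorm Gg e2.
  have h1 := le_trans (rnorm_fst _) gh; have h2 := le_trans (rnorm_snd _) gh.
  rewrite HP /= in h1 h2.
  have d1 := le_trans (rnorm_dist _ _) h1; have d2 := le_trans (rnorm_dist _ _) h2.
  move: d1 d2; rewrite VZ !ler_norml => /andP[? ?] /andP[? ?].
  by apply/andP; split; rewrite /E /F /=; lra.
have Eg (g : csub G) : rnorm (E g) ^+ 2 = 2^-1 * rnorm (bid g) ^+ 2.
  have : rnorm g ^+ 2 = rnorm (E g) ^+ 2 + rnorm (F g) ^+ 2.
    by rewrite rnorm_val rnorm_hsum.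
  by rewrite -EF => ->; field.
have EE g : adj E (E g) = (2^-1)%:C *: g.
  apply: rdot_ext => f; rewrite -rdot_adj rdotZr.
  exact: (rdot_of_rnorm Eg).
(* Since [adj E \ob E] is 1/2, this sends V h = E g to F g = Z h, for g the pair (V h, Z h). *)
exists (2%:C *: (F \ob adj E)); split=> [h|d dV].
  have Ph : cs_set G (P h) by apply: subset_closure; exists h.
  pose g : csub G := Sub (P h) (asboolT Ph).
  have -> : V h = E g by rewrite /E /= HP.
  have -> : (2%:C *: (F \ob adj E)) (E g) = 2%:C *: F (adj E (E g)) by [].
  by rewrite EE bopZ scalerA -rmorphM divff// rmorph1 scale1r /F /= HP.
suff E0 : adj E d = 0.
  have -> : (2%:C *: (F \ob adj E)) d = 2%:C *: F (adj E d) by [].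
  by rewrite E0 bop0 scaler0.
apply: hdot_ext => g; rewrite -adjP hdot0r.
have -> : hdot (E g) d = hdot (val g) ((d, 0) : hsum K L).
  by rewrite /hdot /= /hsum_dot /= hdot0r addr0.
have Gg : closure (range P) (val g) by exact: asboolW (valP g).
apply: (closure_hdot0 Gg) => _ [h _ <-].
by rewrite HP -[LHS]/(hdot (V h) d + hdot (Z h) 0) hdot0r addr0 hdotC dV rmorph0.
Qed.

End PartialIsometry.

Section OmegaBar.
Variables (R : realType) (H' H : hilbertType R).
Variables (T' : bop H' H') (T : bop H H) (X : bop H H').
Hypothesis T'_contr : contractive T'.
Hypothesis T_isom : isometric T.
Hypothesis X_intertw : T' \ob X = X \ob T.
Hypothesis X_contr : contractive X.
Notation DT' := (csub (defect_space T')).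
Notation DX := (csub (defect_space X)).
Notation om := (omega_bar T' T X).

Let Z (h : H) : hsum DT' DX := (defectr T' (X h), defectr X h).

Let rnorm_T h : rnorm (T h) = rnorm h.
Proof. by rewrite /rnorm T_isom. Qed.

(** Both squared norms equal |h|^2 - |T' X h|^2: on the left because T is isometric and X T = T' X,
    on the right because |X h|^2 cancels. *)
Let VZ h : rnorm (defectr X (T h)) = rnorm (Z h).
Proof.
apply/eqP; rewrite -(@eqrXn2 _ 2)// ?rnorm_ge0//; apply/eqP.
rewrite rnorm_hsum /= !rnorm_defectr// rnorm_T.
have -> : X (T h) = T' (X h) by rewrite -[RHS]/((T' \ob X) h) X_intertw.
by ring.
Qed.

Lemma omega_barP : (forall h, om (defectr X (T h)) = Z h) /\
  (forall d, (forall h, hdot d (defectr X (T h)) = 0) -> om d = 0).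
Proof.
have [P HP] := bpair_exists (defectr T' \ob X) (defectr X).
have [|W HW] := @partial_isometry_exists R H DX (hsum DT' DX) (defectr X \ob T) P.
  by move=> h; rewrite HP; exact: VZ.
apply: (@xgetPex _ 0 [set W : bop DX (hsum DT' DX) |
    (forall h, W (defectr X (T h)) = (defectr T' (X h), defectr X h)) /\
    (forall d, (forall h, hdot d (defectr X (T h)) = 0) -> W d = 0)]).
exists W; split; last by have [] := HW.
by move=> h; have [+ _] := HW => /(_ h) /= ->; exact: HP.
Qed.

(** x may be replaced by its projection P x on the closure of the range of D_X T, since [omega_bar]
    kills the rest; there density and the polarized form of [VZ] apply. *)
Let rdot_Z x h : rdot (om x) (Z h) = rdot x (defectr X (T h)).
Proof.
have [omV om0] := omega_barP.
pose S := brange (defectr X \ob T); pose P := adj (cs_incl S).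
have Zsym h1 h2 : rdot (Z h1) (Z h2) = rdot (defectr X (T h1)) (defectr X (T h2)).
  have [B HB] := bpair_exists (defectr T' \ob X) (defectr X).
  have := @rdot_of_rnorm R H (hsum DT' DX) DX B (defectr X \ob T) 1 _ h1 h2.
  by rewrite mul1r !HB; apply => h3; rewrite mul1r HB -VZ.
have omP : om x = om (val (P x)).
  apply/eqP; rewrite -subr_eq0 -bopB; apply/eqP/om0 => h1.
  have Sh : cs_set S (defectr X (T h1)) by apply: subset_closure; exists h1.
  pose s : csub S := Sub (defectr X (T h1)) (asboolT Sh).
  have : hdot s (P x) = hdot (val s) x by rewrite -adjP.
  rewrite -[defectr X (T h1)]/(val s) => E.
  by rewrite hdotBl [hdot x _]hdotC -E [hdot (val (P x)) _]hdotC subrr.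
have Pdot : rdot x (defectr X (T h)) = rdot (val (P x)) (defectr X (T h)).
  have Sh : cs_set S (defectr X (T h)) by apply: subset_closure; exists h.
  pose s : csub S := Sub (defectr X (T h)) (asboolT Sh).
  rewrite -[defectr X (T h)]/(val s) rdotC -[RHS]rdot_val [RHS]rdotC.
  by rewrite -rdot_adj.
rewrite omP Pdot; apply/eqP; rewrite -subr_eq0.
have Ss : closure (range (defectr X \ob T)) (val (P x)) by exact: asboolW (valP (P x)).
rewrite rdotC [X in _ - X]rdotC.
have -> : rdot (Z h) (om (val (P x))) - rdot (defectr X (T h)) (val (P x)) =
   rdot (val (P x)) (adj om (Z h) - defectr X (T h)).
  by rewrite rdotBr -rdot_adj rdotC [X in _ - X]rdotC.
apply/eqP; apply: (closure_rdot0 Ss) => _ [h1 _ <-].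
by rewrite rdotBr -rdot_adj /= omV Zsym subrr.
Qed.

(** [adj om (om x) - x] is orthogonal to the range of D_X T, so [omega_bar] kills it. Real
    orthogonality, applied to x and to 'i x, gives the complex one. *)
Let om_adj_om x : om (adj om (om x)) = om x.
Proof.
have [omV om0] := omega_barP.
have key y h : rdot (adj om (om y) - y) (defectr X (T h)) = 0.
  by rewrite rdotBl rdotC -rdot_adj omV rdotC rdot_Z subrr.
apply/eqP; rewrite -subr_eq0 -bopB; apply/eqP/om0 => h; apply: hdot_eq0; first exact: key.
have -> : 'i *: (adj om (om x) - x) = adj om (om ('i *: x)) - 'i *: x.
  by rewrite scalerBr !bopZ.
exact: key.
Qed.

Lemma val_ker_proj x : val (ker_proj T' T X x) = x - adj om (om x).
Proof.
rewrite /ker_proj bcorestrP// => y.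
change (om (y - adj om (om y)) = 0).
by rewrite bopB om_adj_om subrr.
Qed.

Lemma rnorm_omega_bar x : rnorm x ^+ 2 = rnorm (om x) ^+ 2 + rnorm (ker_proj T' T X x) ^+ 2.
Proof.
rewrite [rnorm (ker_proj _ _ _ _)]rnorm_val val_ker_proj sqr_rnormB.
have -> : rdot x (adj om (om x)) = rnorm (om x) ^+ 2 by rewrite -rdot_adj rdotxx.
have -> : rnorm (adj om (om x)) ^+ 2 = rnorm (om x) ^+ 2.
  by rewrite -rdotxx -rdot_adj om_adj_om rdotxx.
ring.
Qed.

Variable Rz : R[i] -> bop (csub (bker om)) (csub (bker (adj om))).
Hypothesis Rz_schur : schur_contraction Rz.

(** The two summands of W x are orthogonal because R takes values in the kernel of [adj om], and x
    itself splits by [rnorm_omega_bar]. *)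
Lemma rnorm_Wfun z x : `|z| < 1 ->
  rnorm (Wfun Rz z x) ^+ 2 = rnorm x ^+ 2 - rnorm (defect (Rz z) (ker_proj T' T X x)) ^+ 2.
Proof.
move=> z1; have Rc := Rz_schur.2 z z1; rewrite rnorm_defect//.
set k := ker_proj T' T X x.
have -> : Wfun Rz z x = om x + val (Rz z k) by [].
have : rdot (om x) (val (Rz z k)) = 0.
  by rewrite rdot_adj; have := asboolW (valP (Rz z k)) => /= ->; rewrite /rdot hdot0r.
rewrite sqr_rnormD => ->; rewrite (rnorm_omega_bar x) -/k -rnorm_val; ring.
Qed.

Lemma Wfun_analytic : op_analytic (Wfun Rz).
Proof.
have [Th HTh] := Rz_schur.1.
exists (fun n => (if n == 0%N then om else 0) + cs_incl (bker (adj om)) \ob Th n \ob ker_proj T' T X).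
move=> z z1 x; have := HTh z z1 (ker_proj T' T X x).
rewrite !seriesEord => /cvg_bop - /(_ _ (cs_incl (bker (adj om)))) H1.
(* The empty partial sum lacks the constant term om x, whence the case n = 0. *)
have : (fun n => (if n is 0%N then 0 else om x) +
   cs_incl (bker (adj om)) (\sum_(k < n) z ^+ k *: Th k (ker_proj T' T X x))) @ \oo --> Wfun Rz z x.
  rewrite -[Wfun Rz z x]/(om x + cs_incl (bker (adj om)) (Rz z (ker_proj T' T X x))).
  apply: cvgD => //; apply: cvg_near_cst.
  by exists 1%N => // -[].
apply: cvg_trans; apply: near_eq_cvg; apply: nearW => n.
set C := cs_incl _; set y := ker_proj _ _ _ x.
transitivity (\sum_(k < n) z ^+ k *: (if k == 0%N :> nat then om else 0) x +
   C (\sum_(k < n) z ^+ k *: Th k y)); last first.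
  by rewrite linear_sum -big_split; apply: eq_bigr => k _; exact: esym (scalerDr _ _ _).
congr (_ + _); case: n => [|n]; first by rewrite big_ord0.
rewrite big_ord_recl big1 /=; first by rewrite addr0 expr0 scale1r.
by move=> k _; rewrite scaler0.
Qed.

End OmegaBar.

(** * The resolvent power series *)

Section TaylorAlgebra.
Variables (R : realType).
Implicit Types U V : hilbertType R.

Lemma is_taylor_add U (f g : R[i] -> U) a b : is_taylor f a -> is_taylor g b ->
  is_taylor (fun z => f z + g z) (fun n => a n + b n).
Proof.
move=> /is_taylor_psum fa /is_taylor_psum gb; apply/is_taylor_psum => z z1.
have -> : (fun N => psum (fun n => a n + b n) N z) = (fun N => psum a N z + psum b N z).
  apply/funext => N; rewrite /psum -big_split; apply: eq_bigr => k _.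
  exact: scalerDr.
by apply: cvgD; [exact: fa|exact: gb].
Qed.

Lemma psum_shift U (a : nat -> U) (c : U) N z :
  psum (fun n => if n is k.+1 then a k else c) N.+1 z = c + z *: psum a N z.
Proof.
rewrite /psum big_ord_recl expr0 scale1r scaler_sumr; congr (_ + _).
by apply: eq_bigr => k _; rewrite exprS scalerA.
Qed.

Lemma is_taylor_shift U (f : R[i] -> U) a : is_taylor f a ->
  is_taylor (fun z => z *: f z) (fun n => if n is k.+1 then a k else 0).
Proof.
move=> /is_taylor_psum fa; apply/is_taylor_psum => z z1.
rewrite -cvg_shiftS.
have -> : (fun N => psum (fun n => if n is k.+1 then a k else 0) N.+1 z) =
   (fun N => z *: psum a N z).
  by apply/funext => N; rewrite psum_shift add0r.
by apply: cvgZl_tmp; exact: fa.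
Qed.

Lemma is_taylor0 U : is_taylor (fun=> 0 : U) (fun=> 0).
Proof.
apply/is_taylor_psum => z z1.
have -> : (fun N => psum (fun=> 0 : U) N z) = (fun=> 0).
  by apply/funext => N; rewrite /psum big1// => k _; rewrite scaler0.
exact: cvg_cst.
Qed.

Lemma is_taylor_bop U V (A : bop U V) (f : R[i] -> U) a : is_taylor f a ->
  is_taylor (fun z => A (f z)) (fun n => A (a n)).
Proof.
move=> /is_taylor_psum fa; apply/is_taylor_psum => z z1.
have -> : (fun N => psum (fun n => A (a n)) N z) = (fun N => A (psum a N z)).
  apply/funext => N; rewrite /psum linear_sum; apply: eq_bigr => k _.
  by rewrite -bopZ.
exact/cvg_bop/fa.
Qed.

(** Bessel's inequality on the circle of radius 1/2, for the difference series, whose sum is the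
    zero function. *)
Lemma is_taylor_unique U (f : R[i] -> U) a b : is_taylor f a -> is_taylor f b -> a = b.
Proof.
move=> fa fb; apply/funext => n.
have h : is_taylor (fun z => f z + (- f z)) (fun n => a n + (- b n)).
  apply: is_taylor_add => //.
  exact: (@is_taylor_bop U U (- bid) f b fb).
have r01 : 0 <= (2^-1 : R) < 1 by apply/andP; split; lra.
have := bessel h n.+1 0 (n := 1) isT r01.
have -> : segint 0 (0 + 2 * pi * 1%:R)
    (fun t => rnorm (f (polar 2^-1 t) + - f (polar 2^-1 t)) ^+ 2) = 0.
  under [X in segint _ _ X]eq_fun do rewrite subrr rnorm0 expr0n.
  by rewrite segint_cst ?mul0r// add0r mulr1 mulr_ge0 ?pi_ge0.
have p0 : 0 < 2 * pi * 1%:R :> R by rewrite mulr1 mulr_gt0 ?pi_gt0.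
rewrite pmulr_rle0// big_ord_recr /= => H.
have s0 : 0 <= \sum_(k < n) (2^-1 ^+ k * rnorm (a k - b k)) ^+ 2.
  by apply: sumr_ge0 => k _; exact: sqr_ge0.
have : (2^-1 ^+ n * rnorm (a n - b n)) ^+ 2 <= 0.
  by apply: le_trans H; rewrite lerDr.
rewrite real_exprn_even_le0//= ?num_real// mulf_eq0 expf_eq0 invr_eq0 pnatr_eq0 andbF /=.
by move=> /eqP/rnorm0_eq0/eqP; rewrite subr_eq0 => /eqP.
Qed.

End TaylorAlgebra.

(** * Toeplitz matrices of Schur functions *)

Section Toeplitz.
Variables (R : realType) (U V : hilbertType R) (F : R[i] -> bop U V) (Th : nat -> bop U V).
Hypothesis F_taylor : forall z : R[i], `|z| < 1 -> forall x,
  [series z ^+ n *: Th n x]_n @ \oo --> F z x.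
Hypothesis F_contr : forall z : R[i], `|z| < 1 -> contractive (F z).
Implicit Types x : nat -> U.

(* The coefficient of z^n in F(z) (x_0 + x_1 z + ... + x_(N-1) z^(N-1)). *)
Fixpoint toeplitz N x n : V := if N is N'.+1 then
  Th n (x 0%N) + (if n is k.+1 then toeplitz N' (fun j => x j.+1) k else 0) else 0.

(** The coefficient of z^n involves x_0, ..., x_n only, so that for infinite x it is
    [toeplitz n.+1 x n]. *)
Lemma toeplitz_stable N x n : (n < N)%N -> toeplitz N x n = toeplitz n.+1 x n.
Proof.
elim: N n x => // N IH [|n] x nN //.
by rewrite [LHS]/= IH.
Qed.

Lemma toeplitz_ext N x y n : (forall k, (k <= n)%N -> x k = y k) -> toeplitz N x n = toeplitz N y n.
Proof.
elim: N n x y => // N IH [|n] x y xy /=; first by rewrite xy.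
by rewrite xy// (IH n _ (fun j => y j.+1))// => k kn; rewrite xy.
Qed.

Lemma is_taylor_toeplitz_psum N x : is_taylor (fun z => F z (psum x N z)) (toeplitz N x).
Proof.
elim: N x => [|N IH] x.
  have := @is_taylor0 R V; rewrite /is_taylor => H z z1.
  by rewrite /psum big_ord0 bop0; exact: H.
have h0 : is_taylor (fun z => F z (x 0%N)) (fun n => Th n (x 0%N)) by move=> z z1; exact: F_taylor.
have h := is_taylor_add h0 (is_taylor_shift (IH (fun j => x j.+1))).
move=> z z1; have := h z z1.
suff -> : F z (x 0%N) + z *: F z (psum (fun j => x j.+1) N z) = F z (psum x N.+1 z) by [].
rewrite -bopZ -bopD -psum_shift; congr (F z _).
by apply: eq_bigr => k _; case: (nat_of_ord k).
Qed.

(** On the circle of radius rho the right side is the mean square of the polynomial, and the left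
    side is at most that of its image under F, which contracts pointwise. *)
Lemma toeplitz_le N M x (rho : R) : 0 <= rho < 1 ->
  \sum_(n < M) (rho ^+ n * rnorm (toeplitz N x n)) ^+ 2 <=
  \sum_(n < N) (rho ^+ n * rnorm (x n)) ^+ 2.
Proof.
move=> rho01; have [rho0 rho1] := andP rho01.
have p0 : 0 < 2 * pi * 1%:R :> R by rewrite mulr1 mulr_gt0 ?pi_gt0.
rewrite -(ler_pM2l p0) -(parseval_psum x N 0 (n := 1))//.
apply: le_trans (bessel (@is_taylor_toeplitz_psum N x) M 0 (n := 1) isT rho01) _.
apply: le_segint.
- exact: (continuous_sqr (@is_taylor_toeplitz_psum N x)).
- exact: continuous_psum_sqr.
move=> t _; rewrite ler_pXn2r ?nnegrE ?rnorm_ge0//.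
rewrite -le_rnorm; apply: F_contr; by rewrite cabs_lt1 cabs_polar.
Qed.

Lemma toeplitz_le1 N x :
  \sum_(n < N) rnorm (toeplitz n.+1 x n) ^+ 2 <= \sum_(n < N) rnorm (x n) ^+ 2.
Proof.
have c (w : nat -> R) : (fun rho => \sum_(k < N) (rho ^+ k * w k) ^+ 2) @ (1 : R)^'- -->
    \sum_(k < N) w k ^+ 2.
  apply: (@cvg_sum_left1 R N (fun k rho => (rho ^+ k * w k) ^+ 2) (fun k => w k ^+ 2)) => k.
  under eq_fun do rewrite exprMn -exprM.
  have H : (fun rho : R => rho ^+ (k * 2) * w k ^+ 2) @ 1^'- --> 1 * w k ^+ 2.
    by apply: cvgMl; exact: cvg_exprn_left1.
  by rewrite mul1r in H.
apply: ler_cvg_to (c (fun n => rnorm (toeplitz n.+1 x n))) (c (fun n => rnorm (x n))) _.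
have := near_left01 R; apply: filterS => rho rho01.
apply: le_trans (toeplitz_le N N x rho01); apply: ler_sum => n _.
by rewrite (toeplitz_stable _ (ltn_ord n)).
Qed.

(** F z applied to the partial sums of f tends to F z (f z), and the coefficients of F z (psum x N
    z) below N are already final. What lies beyond N is a geometric tail, since [toeplitz_le] bounds
    rho^n times the nth coefficient independently of N. *)
Lemma is_taylor_toeplitz (f : R[i] -> U) x (C : R) : is_taylor f x ->
  (forall n, rnorm (x n) <= C) -> is_taylor (fun z => F z (f z)) (fun n => toeplitz n.+1 x n).
Proof.
move=> fx xC; apply/is_taylor_psum => z z1.
have z0 := cabs_ge0 z; pose rho := (1 + cabs z) / 2.
have rho01 : 0 <= rho < 1 by rewrite /rho; apply/andP; split; lra.
have rho0 : 0 < rho by rewrite /rho; lra.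
pose kappa := cabs z / rho.
have k01 : 0 <= kappa < 1.
  by rewrite divr_ge0 ?(ltW rho0)//= ltr_pdivrMr// mul1r /rho; lra.
have C0 : 0 <= C by apply: le_trans (xC 0%N); exact: rnorm_ge0.
have r2 : 0 <= rho ^+ 2 < 1 by rewrite sqr_ge0/= expr_lt1//; case/andP: rho01.
(* B bounds the energy, at radius rho, of a sequence bounded by C; t <= t^2 + 1 later turns this
   bound on squares into B + 1. *)
pose B := C ^+ 2 / (1 - rho ^+ 2).
have B0 : 0 <= B by rewrite divr_ge0 ?sqr_ge0// subr_ge0; case/andP: r2 => _ /ltW.
have xB N : \sum_(n < N) (rho ^+ n * rnorm (x n)) ^+ 2 <= B.
  apply: le_trans (_ : \sum_(n < N) C ^+ 2 * (rho ^+ 2) ^+ n <= _).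
    apply: ler_sum => n _; have -> : (rho ^+ n * rnorm (x n)) ^+ 2 = rnorm (x n) ^+ 2 * (rho ^+ 2) ^+ n.
      by rewrite exprMn mulrC exprAC.
    apply: ler_wpM2r; first by rewrite exprn_ge0 ?sqr_ge0.
    by apply: lerXn2r; rewrite ?nnegrE ?rnorm_ge0.
  by rewrite -mulr_sumr ler_wpM2l ?sqr_ge0// geometric_sum_le.
have cB N n : rho ^+ n * rnorm (toeplitz N x n) <= B + 1.
  have H : (rho ^+ n * rnorm (toeplitz N x n)) ^+ 2 <= B.
    apply: le_trans (xB N); apply: le_trans (toeplitz_le N n.+1 x rho01).
    by rewrite big_ord_recr /= lerDr sumr_ge0// => k _; exact: sqr_ge0.
  by have := sqr_ge0 (rho ^+ n * rnorm (toeplitz N x n) - 1); nra.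
have tail N : rnorm (F z (psum x N z) - psum (toeplitz N x) N z) <= (B + 1) / (1 - kappa) * kappa ^+ N.
  have zM k : cabs z ^+ k * rnorm (toeplitz N x k) <= (B + 1) * kappa ^+ k.
    rewrite /kappa expr_div_n mulrA ler_pdivlMr ?exprn_gt0//.
    by rewrite mulrC mulrCA mulrC ler_wpM2r ?exprn_ge0.
  have L := (is_taylor_psum _ _).1 (@is_taylor_toeplitz_psum N x) z z1.
  have c : (fun k => rnorm (psum (toeplitz N x) k z - psum (toeplitz N x) N z)) @ \oo -->
      rnorm (F z (psum x N z) - psum (toeplitz N x) N z).
    by apply: cvg_rnormF; apply: cvgB => //; exact: cvg_cst.
  apply: ler_cvg_to c (cvg_cst _) _; exists N => // k /= Nk.
  by rewrite -(subnKC Nk); exact: psum_tail.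
have yE N : psum (fun n => toeplitz n.+1 x n) N z = psum (toeplitz N x) N z.
  by apply: eq_bigr => k _; rewrite (toeplitz_stable _ (ltn_ord k)).
have L1 := @cvg_bop R U V (F z) _ _ ((is_taylor_psum _ _).1 fx z z1).
have L2 : (fun N => F z (psum x N z) - psum (toeplitz N x) N z) @ \oo --> (0 : V).
  apply/cvg_rnorm => e e0; have e1 := e0.
  have c : (fun N => (B + 1) / (1 - kappa) * kappa ^+ N) @ \oo --> (B + 1) / (1 - kappa) * 0.
    by apply: cvgMr; apply: cvg_expr; case/andP: k01 => k0 k1; rewrite ger0_norm.
  rewrite mulr0 in c; move/cvgrPdist_le : c => /(_ _ e0); apply: filterS => N.
  rewrite !sub0r normrN rnormN => /(le_trans (ler_norm _)).
  exact/le_trans/tail.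
have -> : (fun N => psum (fun n => toeplitz n.+1 x n) N z) =
   (fun N => F z (psum x N z) - (F z (psum x N z) - psum (toeplitz N x) N z)).
  by apply/funext => N; rewrite subKr yE.
by rewrite -[F z (f z)]subr0; apply: cvgB.
Qed.

End Toeplitz.

(** Each new value depends on all earlier ones, so the sequence is the diagonal of the iterates: the
    nth value is constant from the nth iterate on. *)
Lemma strong_recursion (T : Type) (t0 : T) (f : nat -> (nat -> T) -> T) :
  (forall n v w, (forall k, (k <= n)%N -> v k = w k) -> f n v = f n w) ->
  exists u, u 0%N = t0 /\ forall n, u n.+1 = f n u.
Proof.
move=> f_ext.
pose step v n := if n is k.+1 then f k v else t0.
pose U k := iter k step (fun=> t0).
have US k n : U k.+1 n = step (U k) n by [].
have stable k l n : (n <= k)%N -> (k <= l)%N -> U k n = U l n.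
  elim: n k l {-2}n (leqnn n) => [|m IH] k l n.
    by rewrite leqn0 => /eqP -> _ _; case: k l => [|k] [|l].
  move=> nm nk kl; case: n nm nk => [|n] nm nk; first by case: (k) (l) => [|?] [|?].
  case: k l nk kl => [|k] [|l] // nk kl; rewrite !US /=; apply: f_ext => j jn.
  by apply: IH => //; apply: leq_trans jn _.
exists (fun n => U n n); split=> // n.
rewrite US /=; apply: f_ext => k kn; exact/esym/stable.
Qed.

(** * The solution of u = d + zAu as a power series *)

Section Lifting.
Variables (R : realType) (H' H : hilbertType R).
Variables (T' : bop H' H') (T : bop H H) (X : bop H H').
Hypothesis T'_contr : contractive T'.
Hypothesis T_isom : isometric T.
Hypothesis X_intertw : T' \ob X = X \ob T.
Hypothesis X_contr : contractive X.
Notation DT' := (csub (defect_space T')).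
Notation DX := (csub (defect_space X)).
Notation om := (omega_bar T' T X).
Variable Rz : R[i] -> bop (csub (bker om)) (csub (bker (adj om))).
Hypothesis Rz_schur : schur_contraction Rz.

Let W_norm z x : `|z| < 1 ->
  rnorm (Wfun Rz z x) ^+ 2 = rnorm x ^+ 2 - rnorm (defect (Rz z) (ker_proj T' T X x)) ^+ 2.
Proof. exact: rnorm_Wfun. Qed.

Lemma Wfun_contractive z : `|z| < 1 -> contractive (Wfun Rz z).
Proof.
move=> z1; apply/contractiveP => x.
rewrite -(@ler_pXn2r _ 2) ?nnegrE ?rnorm_ge0// W_norm// gerBl; exact: sqr_ge0.
Qed.

Lemma rnorm_Afun z x : `|z| < 1 -> rnorm (Afun Rz z x) <= rnorm x.
Proof.
move=> z1; apply: le_trans (rnorm_snd (Wfun Rz z x)) _.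
exact/(contractiveP _).1/Wfun_contractive.
Qed.

(** The equation determines the coefficients: u_(n+1) is the second component, and g_n the first, of
    the nth Toeplitz coefficient of W u. Contractivity of the Toeplitz matrix telescopes to sum_(n <
    N) |g_n|^2 + |u_N|^2 <= |d|^2, which bounds the u_n and shows that Gamma is a contraction. *)
Lemma resolvent_series (d : DX) : exists (u_ : nat -> DX) (g_ : nat -> DT') (u : R[i] -> DX),
  [/\ is_taylor u u_, is_taylor (fun z => (Wfun Rz z (u z)).1) g_, u_ 0%N = d,
      forall N, \sum_(n < N) rnorm (g_ n) ^+ 2 <= rnorm d ^+ 2 &
      forall z : R[i], `|z| < 1 -> u z - z *: Afun Rz z (u z) = d].
Proof.
have [Th W_taylor] := Wfun_analytic Rz_schur.
have [u_ [u0 uS]] := @strong_recursion DX d (fun n v => (toeplitz Th n.+1 v n).2)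
  (fun n v w vw => congr1 snd (toeplitz_ext Th n.+1 vw)).
pose g_ n : DT' := (toeplitz Th n.+1 u_ n).1.
have energy N : \sum_(n < N) rnorm (g_ n) ^+ 2 + rnorm (u_ N) ^+ 2 <= rnorm d ^+ 2.
  have := toeplitz_le1 W_taylor Wfun_contractive N u_.
  under eq_bigr do rewrite rnorm_hsum -/(g_ _) -uS.
  rewrite big_split /= => h.
  have : \sum_(n < N) rnorm (u_ n) ^+ 2 + rnorm (u_ N) ^+ 2 =
         rnorm d ^+ 2 + \sum_(n < N) rnorm (u_ n.+1) ^+ 2.
    by rewrite -u0 -(big_ord_recr _ (fun n => rnorm (u_ n) ^+ 2)) big_ord_recl.
  lra.
have u_le n : rnorm (u_ n) <= rnorm d.
  rewrite -(@ler_pXn2r _ 2) ?nnegrE ?rnorm_ge0//; apply: le_trans (energy n).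
  by rewrite lerDr sumr_ge0// => k _; exact: sqr_ge0.
have [|u u_taylor] := @is_taylor_exists R DX u_.
  move=> rho /andP[rho0 rho1]; exists (rnorm d) => n; apply: le_trans (u_le n).
  by rewrite ler_piMl ?rnorm_ge0// exprn_ile1// ltW.
have W_u := is_taylor_toeplitz W_taylor Wfun_contractive u_taylor u_le.
have g_taylor := @is_taylor_bop R _ _ (@hfst R DT' DX) _ _ W_u.
have A_taylor := @is_taylor_bop R _ _ (@hsnd R DT' DX) _ _ W_u.
exists u_, g_, u; split=> // [N|z z1].
  by apply: le_trans (energy N); rewrite lerDl sqr_ge0.
have z1' : cabs z < 1 by rewrite -cabs_lt1.
have c1 := (is_taylor_psum _ _).1 u_taylor z z1'; rewrite -cvg_shiftS in c1.
have c2 : (fun N => d + z *: psum (fun n => u_ n.+1) N z) @ \oo --> d + z *: Afun Rz z (u z).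
  apply: cvgD; first exact: cvg_cst.
  have -> : (fun n => u_ n.+1) = (fun n => (toeplitz Th n.+1 u_ n).2) by apply/funext.
  by apply: cvgZl_tmp; exact: (is_taylor_psum _ _).1 A_taylor z z1'.
have E : (fun N => psum u_ N.+1 z) = (fun N => d + z *: psum (fun n => u_ n.+1) N z).
  apply/funext => N; rewrite -psum_shift; apply: eq_bigr => k _.
  by case: (nat_of_ord k) => [|//]; rewrite u0.
by rewrite E in c1; rewrite {1}(cvg_seq_unique c1 c2) addrK.
Qed.

End Lifting.

Lemma near_eq_filter (T U : Type) (F : set_system T) (f g : T -> U) : Filter F ->
  (\forall x \near F, f x = g x) -> f @ F = g @ F.
Proof.
move=> FF fg; apply/seteqP; split=> A; rewrite /fmap /=; apply: filterS2 fg => x /=;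
  by [move=> -> | move=> <-].
Qed.

Section SquareSum.
Variables (R : realType) (U : hilbertType R) (g : nat -> U) (c : R).
Hypothesis g_le : forall N, \sum_(n < N) rnorm (g n) ^+ 2 <= c.

Let pos (n : nat) : xpredT n -> (0 <= (rnorm (g n) ^+ 2)%:E)%E.
Proof. by move=> _; rewrite lee_fin sqr_ge0. Qed.

Lemma sqsum_le b : (forall N, \sum_(n < N) rnorm (g n) ^+ 2 <= b) -> (sqsum g <= b%:E)%E.
Proof.
move=> gb; apply: lime_le; first by apply: is_cvg_nneseries => n _ _; exact: pos.
by apply: nearW => N; rewrite sumEFin lee_fin big_mkord.
Qed.

Lemma le_sqsum N : ((\sum_(n < N) rnorm (g n) ^+ 2)%:E <= sqsum g)%E.
Proof.
rewrite -(big_mkord xpredT (fun n => rnorm (g n) ^+ 2)) -sumEFin.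
by apply: nneseries_lim_ge => n _ _; exact: pos.
Qed.

Lemma sqsum_eqP : (sqsum g = c%:E) <->
  forall e : R, 0 < e -> exists N, c - e <= \sum_(n < N) rnorm (g n) ^+ 2.
Proof.
split=> [gc e e0|H].
  apply: contrapT => /forallNP H.
  have : (sqsum g <= (c - e)%:E)%E.
    by apply: sqsum_le => N; rewrite leNgt; apply/negP => /ltW; exact: H.
  by rewrite gc lee_fin; lra.
apply/eqP; rewrite eq_le sqsum_le//=; apply/lee_addgt0Pr => e e0.
have [N HN] := H e e0; apply: (@le_trans _ _ ((\sum_(n < N) rnorm (g n) ^+ 2)%:E + e%:E)%E).
  by rewrite -EFinD lee_fin; lra.
by apply: leeD => //; exact: le_sqsum.
Qed.

Lemma hardy2_normE (f : R[i] -> U) : is_taylor f g ->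
  hardy2 f /\ hardy2_norm f = Num.sqrt (fine (sqsum g)).
Proof.
move=> fg; split; first by exists g => //; apply: le_lt_trans (sqsum_le g_le) (ltry _).
rewrite /hardy2_norm.
have tx : is_taylor f (xget (fun=> 0) [set a | is_taylor f a]).
  exact: (@xgetPex _ (fun=> 0) [set a | is_taylor f a] (ex_intro _ g fg)).
by rewrite (is_taylor_unique tx fg).
Qed.

End SquareSum.

(** * The criterion for a single vector *)

Section Resolvent.
Variables (R : realType) (H' H : hilbertType R).
Variables (T' : bop H' H') (T : bop H H) (X : bop H H').
Hypothesis T'_contr : contractive T'.
Hypothesis T_isom : isometric T.
Hypothesis X_intertw : T' \ob X = X \ob T.
Hypothesis X_contr : contractive X.
Notation DT' := (csub (defect_space T')).
Notation DX := (csub (defect_space X)).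
Notation om := (omega_bar T' T X).
Variable Rz : R[i] -> bop (csub (bker om)) (csub (bker (adj om))).
Hypothesis Rz_schur : schur_contraction Rz.
Local Notation mu := (@lebesgue_measure R).

Let A_le z x : `|z| < 1 -> rnorm (Afun Rz z x) <= rnorm x.
Proof. by apply: rnorm_Afun. Qed.

Let resolvent_lower z v : `|z| < 1 ->
  (1 - cabs z) * rnorm v <= rnorm (v - z *: Afun Rz z v).
Proof.
move=> z1; have := rnorm_dist v (z *: Afun Rz z v).
rewrite rnormZ ler_norml => /andP[_ H1].
have := A_le v z1 => H2; have := cabs_ge0 z => z0.
by nra.
Qed.

(** I - zA is bounded below by 1 - |z|, and onto because [resolvent_series] solves for a
    preimage. *)
Lemma resolventE z v : `|z| < 1 -> resolvent Rz z (v - z *: Afun Rz z v) = v.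
Proof.
move=> z1; have d0 : 0 < 1 - cabs z by rewrite subr_gt0 -cabs_lt1.
apply: (binvP d0) => [w|w]; first exact: resolvent_lower.
have [_ [_ [u [_ _ _ _ Hu]]]] := resolvent_series T'_contr T_isom X_intertw X_contr Rz_schur w.
by exists (u z); exact: Hu.
Qed.

Let polar_lt1 (rho t : R) : 0 <= rho < 1 -> `|polar rho t| < 1.
Proof. by move=> /andP[r0 r1]; rewrite cabs_lt1 cabs_polar. Qed.

Section Vector.
Variables (d : DX) (u_ : nat -> DX) (g_ : nat -> DT') (u : R[i] -> DX).
Hypotheses (u_taylor : is_taylor u u_) (u0 : u_ 0%N = d).
Hypothesis g_taylor : is_taylor (fun z => (Wfun Rz z (u z)).1) g_.
Hypothesis g_le : forall N, \sum_(n < N) rnorm (g_ n) ^+ 2 <= rnorm d ^+ 2.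
Hypothesis u_eq : forall z, `|z| < 1 -> u z - z *: Afun Rz z (u z) = d.

Let uE z : `|z| < 1 -> resolvent Rz z d = u z.
Proof. by move=> z1; rewrite -(u_eq z1) resolventE. Qed.

(** The one-term [trigsum] is the constant |d|^2, written so that [harmonicB] applies. *)
Let p (rho t : R) : R := rdot (u (polar rho t)) (2%:C *: d) -
  trigsum (fun=> rnorm d ^+ 2) (fun=> 0) 1 rho t.
Let G z := z *: (Wfun Rz z (u z)).1.
Let a n := if n is k.+1 then g_ k else 0.
Let q (rho t : R) := let z := polar rho t in
  (1 - complex.Re `|z| ^+ 2) * rnorm (u z) ^+ 2 +
  rnorm (defect (Rz z) (ker_proj T' T X (u z))) ^+ 2.

Let pE rho t : p rho t = rnorm (u (polar rho t)) ^+ 2 - rnorm (u (polar rho t) - d) ^+ 2.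
Proof.
rewrite /p /trigsum big_ord_recl big_ord0 expr0 mul0r cos0 rdotZr sqr_rnormB; ring.
Qed.

Let zA_contr z : `|z| < 1 -> contractive (z *: Afun Rz z).
Proof.
move=> z1; apply/contractiveP => x; have -> : (z *: Afun Rz z) x = z *: Afun Rz z x by [].
rewrite rnormZ.
apply: le_trans (A_le x z1); rewrite ler_piMl ?rnorm_ge0//.
by rewrite ltW// -cabs_lt1.
Qed.

Let p_defect rho t : 0 <= rho < 1 -> let z := polar rho t in
  rnorm (defect (z *: Afun Rz z) (resolvent Rz z d)) ^+ 2 = p rho t.
Proof.
move=> rho01 z; have z1 : `|z| < 1 by exact: polar_lt1.
rewrite rnorm_defect; last exact: zA_contr.
rewrite uE// pE -/z; congr (_ - rnorm _ ^+ 2).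
by rewrite -{1}(u_eq z1) subKr.
Qed.

Let p_minus_G rho t : 0 <= rho < 1 -> let z := polar rho t in
  p rho t - rnorm (G z) ^+ 2 = (1 - rho ^+ 2) * rnorm (u z) ^+ 2 +
    rho ^+ 2 * rnorm (defect (Rz z) (ker_proj T' T X (u z))) ^+ 2.
Proof.
move=> rho01 z; have z1 : `|z| < 1 by exact: polar_lt1.
have [r0 r1] := andP rho01.
have zA : u z - d = z *: Afun Rz z (u z) by rewrite -{1}(u_eq z1) subKr.
rewrite pE -/z zA /G !rnormZ cabs_polar// !exprMn.
have := rnorm_Wfun T'_contr T_isom X_intertw X_contr Rz_schur (u z) z1.
rewrite rnorm_hsum -[(Wfun Rz z (u z)).2]/(Afun Rz z (u z)) => E.
have -> : rnorm (defect (Rz z) (ker_proj T' T X (u z))) ^+ 2 = rnorm (u z) ^+ 2 -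
  (rnorm (Wfun Rz z (u z)).1 ^+ 2 + rnorm (Afun Rz z (u z)) ^+ 2) by rewrite E; ring.
ring.
Qed.

Let harm_p : disc_harmonic p
    (fun k => rdot (u_ k) (2%:C *: d) - (if (k < 1)%N then rnorm d ^+ 2 else 0)) _ :=
  harmonicB (harmonic_rdot u_taylor (2%:C *: d)) (harmonic_trigsum (fun=> rnorm d ^+ 2) (fun=> 0) 1).

Let pG rho t : 0 <= rho < 1 -> rnorm (G (polar rho t)) ^+ 2 <= p rho t.
Proof.
move=> rho01; rewrite -subr_ge0 p_minus_G//; have [r0 /ltW r1] := andP rho01.
by rewrite addr_ge0// mulr_ge0 ?sqr_ge0// subr_ge0 expr_le1.
Qed.

Let m_eq : rdot (u_ 0%N) (2%:C *: d) - (if (0 < 1)%N then rnorm d ^+ 2 else 0) = rnorm d ^+ 2.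
Proof. by rewrite u0 rdotZr rdotxx /=; ring. Qed.

Let G_taylor : is_taylor G a := is_taylor_shift g_taylor.

(** Multiplication by z puts a 0 in front of the coefficients and keeps their energy. *)
Let iso_shift : (forall e : R, 0 < e -> exists N, rnorm d ^+ 2 - e <= \sum_(n < N) rnorm (g_ n) ^+ 2) <->
  (forall e : R, 0 < e -> exists N, rnorm d ^+ 2 - e <= \sum_(n < N) rnorm (a n) ^+ 2).
Proof.
have S N : \sum_(n < N.+1) rnorm (a n) ^+ 2 = \sum_(n < N) rnorm (g_ n) ^+ 2.
  by rewrite big_ord_recl /= rnorm0 expr0n add0r.
split=> H1 e e0; have [N HN] := H1 e e0; first by exists N.+1; rewrite S.
exists N; rewrite -S; apply: le_trans HN _; rewrite big_ord_recr /= lerDl; exact: sqr_ge0.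
Qed.

(** The two functions of rho are known to agree on [0, 1), which determines the left limit at 1. *)
Let hd_eq t : hd Rz d t = radial_lim p t.
Proof.
rewrite /hd /radial_lim; congr lim; apply: near_eq_filter.
by have := near_left01 R; apply: filterS => rho rho01; exact: p_defect.
Qed.

(** The bracket of condition (2) differs from p - |G|^2 by the factor rho^2 on the defect term, so
    for rho > 1/2 each is at most 4 times the other. *)
Let q_cvg t : (fun rho => p rho t - rnorm (G (polar rho t)) ^+ 2) @ (1 : R)^'- --> (0 : R) <->
  (let z := rho%:C * expi t in
     (1 - complex.Re `|z| ^+ 2) * rnorm (resolvent Rz z d) ^+ 2 +
     rnorm (defect (Rz z) (ker_proj T' T X (resolvent Rz z d))) ^+ 2)
    @[rho --> (1 : R)^'-] --> (0 : R).
Proof.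
have near_half : \forall rho \near (1 : R)^'-, 2^-1 < rho < 1.
  by apply: near_left1; rewrite invf_lt1 ?ltr1n.
have bounds rho : 2^-1 < rho < 1 -> [/\ 0 <= p rho t - rnorm (G (polar rho t)) ^+ 2,
    p rho t - rnorm (G (polar rho t)) ^+ 2 <= q rho t &
    q rho t <= 4 * (p rho t - rnorm (G (polar rho t)) ^+ 2)].
  move=> /andP[r2 r1]; have rho0 : 0 <= rho by lra.
  have rho01 : 0 <= rho < 1 by rewrite rho0.
  rewrite subr_ge0 pG// p_minus_G// /q -/(cabs _) cabs_polar//.
  set y := rnorm (u _) ^+ 2; set x := rnorm (defect _ _) ^+ 2.
  have [x0 y0] : 0 <= x /\ 0 <= y by split; exact: sqr_ge0.
  have rr : rho ^+ 2 <= 1 by rewrite expr_le1// ltW.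
  have rr4 : 1 <= 4 * rho ^+ 2 by nra.
  have h1 : 0 <= (1 - rho ^+ 2) * y by rewrite mulr_ge0// subr_ge0.
  have h2 : rho ^+ 2 * x <= x by rewrite ler_piMl.
  have h3 : x <= 4 * rho ^+ 2 * x by rewrite ler_peMl.
  by clearbody x y; split=> //; lra.
have -> : ((let z := rho%:C * expi t in
     (1 - complex.Re `|z| ^+ 2) * rnorm (resolvent Rz z d) ^+ 2 +
     rnorm (defect (Rz z) (ker_proj T' T X (resolvent Rz z d))) ^+ 2)
    @[rho --> (1 : R)^'-]) = (fun rho => q rho t) @ (1 : R)^'-.
  apply: near_eq_filter; have := near_left01 R; apply: filterS => rho rho01.
  by rewrite /q -/(polar rho t) uE//; exact: polar_lt1.
split=> /cvgrPdist_le H1; apply/cvgrPdist_le => e e0.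
  have e4 : 0 < e / 4 by rewrite divr_gt0.
  have := H1 _ e4; apply: filterS2 near_half => rho /bounds[b0 b1 b2].
  rewrite !sub0r !normrN !ger0_norm//; last exact: le_trans b1.
  lra.
have := H1 _ e0; apply: filterS2 near_half => rho /bounds[b0 b1 b2].
rewrite !sub0r !normrN !ger0_norm//; last exact: le_trans b1.
lra.
Qed.

Let Gamma_taylor : is_taylor (fun z => Gamma Rz z d) g_.
Proof.
move=> z z1; have -> : Gamma Rz z d = (Wfun Rz z (u z)).1 by rewrite -(uE z1).
exact: g_taylor.
Qed.

Let hardy_iff :
  (hardy2 (fun z => Gamma Rz z d) /\ hardy2_norm (fun z => Gamma Rz z d) = rnorm d) <->
  (forall e : R, 0 < e -> exists N, rnorm d ^+ 2 - e <= \sum_(n < N) rnorm (g_ n) ^+ 2).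
Proof.
have [h2 ->] := hardy2_normE g_le Gamma_taylor.
rewrite -(sqsum_eqP g_le).
have s0 : (0 <= sqsum g_)%E by apply: le_trans (le_sqsum g_ 0); rewrite big_ord0.
have sfin : sqsum g_ \is a fin_num.
  by rewrite ge0_fin_numE//; apply: le_lt_trans (sqsum_le g_le) (ltry _).
split=> [[_ E]|->]; last by split=> //=; rewrite sqrtr_sqr ger0_norm ?rnorm_ge0.
by rewrite -(fineK sfin) -E sqr_sqrtr// fine_ge0.
Qed.

Let integral_hd : (\int[mu]_(t in `[0%R, (2 * pi)%R]) (hd Rz d t)%:E =
  \int[mu]_(t in `[0%R, (2 * pi)%R]) (radial_lim p t)%:E)%E.
Proof. by apply: eq_integral => t _; rewrite hd_eq. Qed.

Let integral_iff (I : \bar R) : (((2 * pi)^-1%:E * I = (rnorm d ^+ 2)%:E) <->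
  (I = (2 * pi * rnorm d ^+ 2)%:E))%E.
Proof.
have p0 : 2 * pi != 0 :> R by rewrite gt_eqF// mulr_gt0// pi_gt0.
split=> [E|->]; last by rewrite -EFinM mulKf.
by rewrite EFinM -E muleA -EFinM divff// mul1e.
Qed.

Lemma isometry_criterion :
  (hardy2 (fun z => Gamma Rz z d) /\ hardy2_norm (fun z => Gamma Rz z d) = rnorm d) <->
  (((2 * pi)^-1%:E * \int[mu]_(t in `[0%R, (2 * pi)%R]) (hd Rz d t)%:E
       = (rnorm d ^+ 2)%:E)%E /\
   {ae mu, forall t : R, t \in `[0, 2 * pi] ->
        (let z := rho%:C * expi t in
         (1 - complex.Re `|z| ^+ 2) * rnorm (resolvent Rz z d) ^+ 2 +
         rnorm (defect (Rz z) (ker_proj T' T X (resolvent Rz z d))) ^+ 2)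
        @[rho --> (1 : R)^'-] --> (0 : R)}).
Proof.
rewrite hardy_iff iso_shift integral_hd integral_iff.
have := radial_limits_of_isometry G_taylor harm_p pG.
rewrite m_eq => fwd; split=> [iso|[Ih Hae]].
  have [Ih [Z Z0 HZ]] := fwd iso.
  split; first exact: Ih.
  apply: negligibleS Z0 => t; apply: contra_notP => nZ t02.
  by apply/(q_cvg t).1/HZ.
(* The null set is the one where the almost everywhere statement fails, hence the double
   negation. *)
apply: (isometry_of_radial_limits G_taylor pG Ih Hae) => t Dt nZ.
by apply/(q_cvg t).2; move/contrapT : nZ; apply.
Qed.

End Vector.

End Resolvent.

Theorem proposition4p2 (R : realType) (H' H : hilbertType R)
    (T' : bop H' H') (T : bop H H) (X : bop H H')
    (sepH' : separable H') (sepH : separable H)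
    (T'_contr : contractive T') (T'_cnu : completely_nonunitary T')
    (T_isom : isometric T) (X_intertw : T' \ob X = X \ob T)
    (X_contr : contractive X)
    (Rz : R[i] -> bop (csub (bker (omega_bar T' T X)))
                      (csub (bker (adj (omega_bar T' T X)))))
    (Rz_schur : schur_contraction Rz) :
  (forall d : csub (defect_space X),
      hardy2 (fun z => Gamma Rz z d) /\
      hardy2_norm (fun z => Gamma Rz z d) = rnorm d)
  <->
  (forall d : csub (defect_space X),
      ((2 * pi)^-1%:E *
       \int[lebesgue_measure]_(t in `[0%R, (2 * pi)%R]) (hd Rz d t)%:E
       = (rnorm d ^+ 2)%:E)%E) /\
  (forall d : csub (defect_space X),
      {ae lebesgue_measure, forall t : R, t \in `[0, 2 * pi] ->
        (let z := rho%:C * expi t in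
         (1 - complex.Re `|z| ^+ 2) * rnorm (resolvent Rz z d) ^+ 2 +
         rnorm (defect (Rz z) (ker_proj T' T X (resolvent Rz z d))) ^+ 2)
        @[rho --> (1 : R)^'-] --> (0 : R)}).
Proof.
(* The equivalence holds for each d separately; only the quantifiers remain to be distributed. *)
have crit d := let: ex_intro _ (ex_intro _ (ex_intro _ (And5 ut gt u0 gle ueq))) :=
  resolvent_series T'_contr T_isom X_intertw X_contr Rz_schur d in
  isometry_criterion T'_contr T_isom X_intertw X_contr Rz_schur ut u0 gt gle ueq.
split=> [iso|[Ih Hae] d]; last by apply/crit.
by split=> d; have [] := (crit d).1 (iso d).
Qed.
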